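(* Let $(M,H)$ be a cooriented contact manifold of dimension $2n+1$ with a compatible almost CR structure $J$, and let $f\in\operatorname{Re}\mathcal{E}(1,1)$. Then the infinitesimal deformation tensor $\psi\in\operatorname{Re}(\mathcal{E}_{(\alpha\beta)}(1,1)\oplus\mathcal{E}_{(\overline\alpha\overline\beta)}(1,1))$ associated with the contact Hamiltonian vector field $X_f$ is given by $\psi=Df$, where $D$ is the CR Killing operator.
   Context: A contact form $\theta$ is a positive nowhere-vanishing section of $H^\perp$. Its Reeb field $T$ satisfies $\theta(T)=1$, $T\lrcorner d\theta=0$. $J$ is a complex structure on $H$; it is *compatible* if $h(X,Y)=d\theta(X,JY)$ is a positive-definite $J$-Hermitian form on $H$ (independent of the choice of $\theta$). $\mathbb{C}H=H^{1,0}\oplus H^{0,1}$ is the $(\pm i)$-eigendecomposition. For a local frame $\{Z_\alpha\}$ of $H^{1,0}$, $Z_{\overline\alpha}=\overline{Z_\alpha}$, the admissible coframe $\{\theta^\alpha\}$ is defined by $\theta^\alpha(Z_\beta)=\delta_\beta{}^\alpha$, $\theta^\alpha(Z_{\overline\beta})=\theta^\alpha(T)=0$, and $\theta^{\overline\alpha}=\overline{\theta^\alpha}$. Then $d\theta=ih_{\alpha\overline\beta}\theta^\alpha\wedge\theta^{\overline\beta}$. Tensor bundles (and their sections) are denoted by $\mathcal{E}$ with indices ($\mathcal{E}^\alpha=H^{1,0}$, $\mathcal{E}_\alpha=(H^{1,0})^*$, etc.); $(\cdots)$ denotes symmetrization. The Tanaka–Webster connection $\nabla$ of $\theta$ preserves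 $TM=H\oplus\mathbb{R}T$, makes $T,J,h$ parallel, and its connection forms ($\nabla Z_\alpha=\omega_\alpha{}^\beta\otimes Z_\beta$) are uniquely determined by $\omega_{\alpha\overline\beta}+\omega_{\overline\beta\alpha}=dh_{\alpha\overline\beta}$ and $$d\theta^\gamma=\theta^\alpha\wedge\omega_\alpha{}^\gamma+A_{\overline\alpha}{}^\gamma\,\theta\wedge\theta^{\overline\alpha}+\tfrac12N^\gamma{}_{\overline\alpha\overline\beta}\,\theta^{\overline\alpha}\wedge\theta^{\overline\beta},\qquad N^\gamma{}_{(\overline\alpha\overline\beta)}=0,$$ which also defines the torsion tensor $A$ and the Nijenhuis tensor $N$; complex conjugates have conjugated indices, and $N_{\gamma\alpha\beta}=h_{\gamma\overline\sigma}N^{\overline\sigma}{}_{\alpha\beta}$. Indices are raised and lowered with $h$. Densities: $\mathcal{K}=\bigwedge^{n+1}(H^{0,1})^\perp$; $\mathcal{E}(1,0)$ is the dual of a (local) $(n+2)$-nd root of $\mathcal{K}$, and $\mathcal{E}(w,w')=\mathcal{E}(1,0)^{\otimes w}\otimes\overline{\mathcal{E}(1,0)}^{\otimes w'}$; $\mathcal{E}(w,w)$ is globally defined. If $\{\theta^\alpha\}$ is a unitary admissible coframe for $\theta$ and $\xi^{-n-2}=\theta\wedge\theta^1\wedge\dots\wedge\theta^n$, then $|\xi|^{2w}$ trivializes $\mathcal{E}(w,w)$ and depends only on $\theta$; trivializations $f,\hat f$ of the same $(w,w)$-density with respect to $\theta$ and $\hat\theta=e^u\theta$ satisfy $\hat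 f=e^{wu}f$. The weighted Levi form $h_{\alpha\overline\beta}\otimes|\xi|^2\in\mathcal{E}_{\alpha\overline\beta}(1,1)$ is independent of $\theta$. CR Killing operator: in terms of any contact form (the result is independent of it), $$Df=\bigl(i\nabla_{(\alpha}\nabla_{\beta)}f-A_{\alpha\beta}f+iN_{(\alpha\beta)\gamma}\nabla^\gamma f,\ -i\nabla_{(\overline\alpha}\nabla_{\overline\beta)}f-A_{\overline\alpha\overline\beta}f-iN_{(\overline\alpha\overline\beta)\overline\gamma}\nabla^{\overline\gamma}f\bigr).$$ Contact Hamiltonian field: for a fixed $\theta$, identifying $f$ with its trivialization (a real function), $X_f$ is the vector field with $\theta(X_f)=f$ and $d\theta(X_f,Y)=-df(Y)$ for all $Y\in H$; it does not depend on $\theta$. Infinitesimal deformation tensor: let $\mathrm{Fl}_t$ be the flow of $X_f$ (a flow of contact diffeomorphisms) and $J_t=(\mathrm{Fl}_t^{-1})_*\circ J\circ(\mathrm{Fl}_t)_*$, a family of compatible almost CR structures on $(M,H)$. For small $t$ the $i$-eigenbundle of $J_t$ is $\{Z+\varphi_t(Z)\mid Z\in H^{1,0}\}$ for a unique bundle map $\varphi_t\colon H^{1,0}\to H^{0,1}$. Set $\psi=\frac{d}{dt}\big|_{t=0}\varphi_t$, with components $\psi_\alpha{}^{\overline\beta}$, extended to a real tensor by $\psi_{\overline\alpha}{}^{\beta}=\overline{\psi_\alpha{}^{\overline\beta}}$; lowering the upper index by the weighted Levi form, $\psi=(\psi_{\alpha\beta},\psi_{\overline\alpha\overline\beta})$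 lies in $\operatorname{Re}(\mathcal{E}_{(\alpha\beta)}(1,1)\oplus\mathcal{E}_{(\overline\alpha\overline\beta)}(1,1))$. *)

(* Defs.v *)
From HB Require Import structures.
From mathcomp Require Import all_boot all_order all_algebra.
From mathcomp Require Import all_classical all_reals topology normedtype derive exp.
From mathcomp Require Import complex.

Set Implicit Arguments.
Unset Strict Implicit.
Unset Printing Implicit Defensive.

Import Order.TTheory GRing.Theory Num.Theory.
Import numFieldNormedType.Exports.

Local Open Scope classical_set_scope.
Local Open Scope ring_scope.

(* [C^k] on an open set [A], through iterated directional derivatives. *)
Fixpoint Ck (R : realType) (V W : normedModType R) (k : nat)
    (f : V -> W) (A : set V) : Prop :=
  (forall x, A x -> {for x, continuous f}) /\
  match k with
  | 0 => True
  | k'.+1 => forall v : V,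
      (forall x, A x -> derivable f x v) /\ Ck k' (fun x => 'D_v f x) A
  end.

Definition Cinfty (R : realType) (V W : normedModType R)
    (f : V -> W) (A : set V) : Prop := forall k, Ck k f A.

(* A smooth manifold of dimension [m.+1]. The atlas is indexed by the points
   of [M], the chart of index [p] being a chart around [p]; any smooth atlas
   contains such a subfamily, and that subfamily defines the same smooth
   structure. [chart p] and [chart_inv p] are meaningful only on [dom p] and
   on its image. *)
Record smooth_atlas (R : realType) (m : nat) (M : topologicalType) := {
  dom : M -> set M;
  chart : M -> M -> 'rV[R]_m.+1;
  chart_inv : M -> 'rV[R]_m.+1 -> M;
  atlas_hausdorff : hausdorff_space M;
  atlas_second_countable : @second_countable M;
  dom_open : forall p, open (dom p);
  dom_self : forall p, dom p p;
  chart_image_open : forall p, open (chart p @` dom p);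
  chartK : forall p q, dom p q -> chart_inv p (chart p q) = q;
  chart_continuous : forall p q, dom p q -> {for q, continuous (chart p)};
  chart_inv_continuous : forall p x, (chart p @` dom p) x ->
    {for x, continuous (chart_inv p)};
  chart_transition : forall p q,
    Cinfty (chart q \o chart_inv p) (chart p @` (dom p `&` dom q))
}.

Definition mxRe (R : realType) a b (V : 'M[R[i]]_(a, b)) : 'M[R]_(a, b) :=
  map_mx (@complex.Re R) V.
Definition mxIm (R : realType) a b (V : 'M[R[i]]_(a, b)) : 'M[R]_(a, b) :=
  map_mx (@complex.Im R) V.
Definition mxconj (R : realType) a b (V : 'M[R[i]]_(a, b)) : 'M[R[i]]_(a, b) :=
  map_mx (@conjc R) V.
Definition mxC (R : realType) a b (V : 'M[R]_(a, b)) : 'M[R[i]]_(a, b) :=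
  map_mx (real_complex R) V.

(* Covectors are columns and act on row vectors. *)
Definition ev (K : nzRingType) m (v : 'rV[K]_m) (eta : 'cV[K]_m) : K :=
  (v *m eta) 0 0.

(* The complex bilinear extension of a real bilinear map. *)
Definition bilinC (R : realType) m (b : 'rV[R]_m -> 'rV[R]_m -> R)
    (V W : 'rV[R[i]]_m) : R[i] :=
  ((b (mxRe V) (mxRe W) - b (mxIm V) (mxIm W)) +i*
   (b (mxRe V) (mxIm W) + b (mxIm V) (mxRe W)))%C.

Definition wedge (K : nzRingType) m (a b : 'cV[K]_m) (v w : 'rV[K]_m) : K :=
  ev v a * ev w b - ev w a * ev v b.

Section Calculus.
Variables (R : realType) (m : nat) (M : topologicalType).
Variable S : smooth_atlas R m M.
Local Notation C := R[i].
Local Notation N := m.+1.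

Definition smooth_fun (U : set M) (g : M -> R) : Prop :=
  forall p, Cinfty (g \o chart_inv S p) (chart S p @` (dom S p `&` U)).

(* The tangent space at [p] is ['rV_N], by means of the chart of index [p]. *)
Definition dir (p : M) (v : 'rV[R]_N) (g : M -> R) : R :=
  'D_v (g \o chart_inv S p) (chart S p p).

Definition dirC (p : M) (V : 'rV[C]_N) (g : M -> C) : C :=
  let gr := fun q => complex.Re (g q) in
  let gi := fun q => complex.Im (g q) in
  ((dir p (mxRe V) gr - dir p (mxIm V) gi) +i*
   (dir p (mxRe V) gi + dir p (mxIm V) gr))%C.

(* The differential at [p] of a map [F : M -> M], acting on the right of row
   vectors. *)
Definition dmap (F : M -> M) (p : M) : 'M[R]_N :=
  lin1_mx (fun v => 'D_v (chart S (F p) \o F \o chart_inv S p) (chart S p p)).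

(* [v *m from_chart p q] is the tangent vector at [q] whose coordinates in the
   chart of index [p] are [v]. *)
Definition from_chart (p q : M) : 'M[R]_N :=
  lin1_mx (fun v => 'D_v (chart S q \o chart_inv S p) (chart S p q)).

Definition smooth_field (U : set M) (X : M -> 'rV[R]_N) : Prop :=
  forall (p : M) (j : 'I_N), smooth_fun (U `&` dom S p)
    (fun q => dir q (X q) (fun r => chart S p r 0 j)).

Definition smooth_form (U : set M) (eta : M -> 'cV[R]_N) : Prop :=
  forall (p : M) (v : 'rV[R]_N), smooth_fun (U `&` dom S p)
    (fun q => ev (v *m from_chart p q) (eta q)).

Definition smooth_fieldC (U : set M) (X : M -> 'rV[C]_N) : Prop :=
  smooth_field U (fun q => mxRe (X q)) /\ smooth_field U (fun q => mxIm (X q)).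

Definition smooth_formC (U : set M) (eta : M -> 'cV[C]_N) : Prop :=
  smooth_form U (fun q => mxRe (eta q)) /\ smooth_form U (fun q => mxIm (eta q)).

(* The exterior derivative of a 1-form, normalized by
   [d eta (X, Y) = X (eta Y) - Y (eta X) - eta [X, Y]]; [v] and [w] are extended
   with constant coordinates in the chart of index [p], so that the bracket
   vanishes. *)
Definition extd (eta : M -> 'cV[R]_N) (p : M) (v w : 'rV[R]_N) : R :=
  dir p v (fun q => ev (w *m from_chart p q) (eta q)) -
  dir p w (fun q => ev (v *m from_chart p q) (eta q)).

Definition extdC (eta : M -> 'cV[C]_N) (p : M) (V W : 'rV[C]_N) : C :=
  bilinC (extd (fun q => mxRe (eta q)) p) V W +
  'i%C * bilinC (extd (fun q => mxIm (eta q)) p) V W.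

(* A flow of [X] on a flow domain [D]: the maximal flow or a restriction of it
   to a smaller domain. *)
Record is_flow (X : M -> 'rV[R]_N) (D : set (R * M)) (Fl : R -> M -> M) : Prop := {
  flow_dom_open : open D;
  flow_dom0 : forall p, D (0, p);
  flow_dom_interval : forall t p s, D (t, p) -> 0 <= s <= 1 -> D (s * t, p);
  flow0 : forall p, Fl 0 p = p;
  flow_continuous : forall z, D z -> {for z, continuous (fun y : R * M => Fl y.1 y.2)};
  flow_smooth : forall p q : M,
    Cinfty (fun y : R * 'rV[R]_N => chart S q (Fl y.1 (chart_inv S p y.2)))
      [set y | [/\ (chart S p @` dom S p) y.2, D (y.1, chart_inv S p y.2) &
                   dom S q (Fl y.1 (chart_inv S p y.2))]];
  flow_ode : forall t p, D (t, p) ->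
    is_derive t (1 : R) (fun s => chart S (Fl t p) (Fl s p)) (X (Fl t p))
}.

End Calculus.

(* A cooriented contact structure: a hyperplane field [Hplane] with a choice
   [Hpos] of positive side, locally of the form [ker eta], [eta > 0], with
   [d eta] nondegenerate on [ker eta]. *)
Record contact_structure (R : realType) (n : nat) (M : topologicalType)
    (S : smooth_atlas R n.*2 M) := {
  Hplane : M -> set 'rV[R]_(n.*2.+1);
  Hpos : M -> set 'rV[R]_(n.*2.+1);
  contact_local : forall p, exists (U : set M) (eta : M -> 'cV[R]_(n.*2.+1)),
    [/\ open U, U p, smooth_form S U eta &
      forall q, U q -> [/\ eta q != 0,
        Hplane q = [set v | ev v (eta q) = 0],
        Hpos q = [set v | 0 < ev v (eta q)] &
        forall v, Hplane q v ->
          (forall w, Hplane q w -> extd S eta q v w = 0) -> v = 0]]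
}.

Section CR.
Variables (R : realType) (n : nat) (M : topologicalType).
Variable S : smooth_atlas R n.*2 M.
Variable H : contact_structure S.
Local Notation C := R[i].
Local Notation N := n.*2.+1.

Definition contact_form (theta : M -> 'cV[R]_N) : Prop :=
  smooth_form S setT theta /\
  forall p, [/\ theta p != 0, forall v, Hplane H p v -> ev v (theta p) = 0 &
                forall v, Hpos H p v -> 0 < ev v (theta p)].

Definition reeb_field (theta : M -> 'cV[R]_N) (T : M -> 'rV[R]_N) : Prop :=
  smooth_field S setT T /\
  forall p, ev (T p) (theta p) = 1 /\ forall v, extd S theta p (T p) v = 0.

Section Structure.
(* Only the restriction of [v |-> v *m J p] to [Hplane H p] is meaningful. *)
Variable J : M -> 'M[R]_N.

Record compatible_almost_CR : Prop := {
  CR_stable : forall p v, Hplane H p v -> Hplane H p (v *m J p);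
  CR_square : forall p v, Hplane H p v -> v *m J p *m J p = - v;
  CR_smooth : forall (U : set M) (X : M -> 'rV[R]_N), open U ->
    (forall q, U q -> Hplane H q (X q)) -> smooth_field S U X ->
    smooth_field S U (fun q => X q *m J q);
  CR_compatible : forall theta p, contact_form theta ->
    let h v w := extd S theta p v (w *m J p) in
    forall v w, Hplane H p v -> Hplane H p w ->
      [/\ h v w = h w v, h (v *m J p) (w *m J p) = h v w &
          v != 0 -> 0 < h v v]
}.

Definition CH (p : M) (V : 'rV[C]_N) : Prop :=
  Hplane H p (mxRe V) /\ Hplane H p (mxIm V).

Definition H10 (p : M) (V : 'rV[C]_N) : Prop :=
  CH p V /\ V *m mxC (J p) = 'i%C *: V.

Definition H01 (p : M) (V : 'rV[C]_N) : Prop :=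
  CH p V /\ V *m mxC (J p) = - 'i%C *: V.

Definition levi (theta : M -> 'cV[R]_N) (p : M) : 'rV[C]_N -> 'rV[C]_N -> C :=
  bilinC (fun v w => extd S theta p v (w *m J p)).

(* The rows of [Z] form a basis of [H10 p] and the columns of [th] are the dual
   admissible coframe; independence of the rows follows from [Z *m th = 1]. *)
Definition admissible_at (T : M -> 'rV[R]_N) (p : M)
    (Z : 'M[C]_(n, N)) (th : 'M[C]_(N, n)) : Prop :=
  [/\ forall V, H10 p V <-> (V <= Z)%MS,
      Z *m th = 1%:M, mxconj Z *m th = 0 & mxC (T p) *m th = 0].

(* [h_{a bbar}] in the frame [Z]. *)
Definition levi_mx (theta : M -> 'cV[R]_N) (p : M) (Z : 'M[C]_(n, N)) : 'M[C]_n :=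
  \matrix_(a, b) levi theta p (row a Z) (mxconj (row b Z)).

Definition admissible_frame (T : M -> 'rV[R]_N) (U : set M)
    (Z : M -> 'M[C]_(n, N)) (th : M -> 'M[C]_(N, n)) : Prop :=
  [/\ open U, forall a, smooth_fieldC S U (fun q => row a (Z q)),
      forall a, smooth_formC S U (fun q => col a (th q)) &
      forall p, U p -> admissible_at T p (Z p) (th p)].

(* The columns of [B] form a basis of [(H^{0,1})^\perp] at [p]; the
   wedge product of the columns is then a nonzero element of the fibre of
   [K = /\^{n+1} (H^{0,1})^\perp], and all of them arise this way. *)
Definition K_frame_at (p : M) (B : 'M[C]_(N, 1 + n)) : Prop :=
  \rank B = (1 + n)%N /\ forall V, H01 p V -> V *m B = 0.

(* An element of [Re E(1,1)] at [p] is a real function [s] on the nonzero [k] in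
   [K_p] with [s (c k) = |c|^{2/(n+2)} s k]: with [l^{n+2} = k], it is
   [l |-> s k], which is homogeneous of bidegree [(1,1)] in the root [l], i.e.
   an element of [E(1,0) (x) conj E(1,0)], where [E(1,0)] is the dual of [L] and
   [L^{n+2} = K]. Such an [s] is here a function of the basis [B], with [c = \det G] for the basis
   [B *m G]. *)
Record real_density11 (f : M -> 'M[C]_(N, 1 + n) -> R) : Prop := {
  density_weight : forall p (B : 'M[C]_(N, 1 + n)) (G : 'M[C]_(1 + n)),
    K_frame_at p B -> G \in unitmx ->
    f p (B *m G) =
      (complex.Re `|\det G|) `^ (2%:R / (n.+2)%:R) * f p B;
  density_smooth : forall (U : set M) (B : M -> 'M[C]_(N, 1 + n)), open U ->
    (forall j, smooth_formC S U (fun q => col j (B q))) ->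
    (forall q, U q -> K_frame_at q (B q)) ->
    smooth_fun S U (fun q => f q (B q))
}.

(* [g] is [f] divided by [|xi|^2], where [xi^{-n-2} = theta /\ theta^1 /\ ...]
   for a unitary admissible coframe. *)
Definition trivialization (theta : M -> 'cV[R]_N) (T : M -> 'rV[R]_N)
    (f : M -> 'M[C]_(N, 1 + n) -> R) (g : M -> R) : Prop :=
  forall p, exists (Z : 'M[C]_(n, N)) (th : 'M[C]_(N, n)),
    [/\ admissible_at T p Z th, levi_mx theta p Z = 1%:M &
        g p = f p (row_mx (mxC (theta p)) th)].

Definition contact_hamiltonian (f : M -> 'M[C]_(N, 1 + n) -> R)
    (X : M -> 'rV[R]_N) : Prop :=
  smooth_field S setT X /\
  exists (theta : M -> 'cV[R]_N) (T : M -> 'rV[R]_N) (g : M -> R),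
    [/\ contact_form theta, reeb_field theta T, trivialization theta T f g &
      forall p, ev (X p) (theta p) = g p /\
        forall v, Hplane H p v -> extd S theta p (X p) v = - dir S p v g].

(* [J_t = (Fl_t^{-1})_* o J o (Fl_t)_*] at [p], acting on row vectors. *)
Definition pulled_J (Fl : R -> M -> M) (t : R) (p : M) : 'M[R]_N :=
  let dF := dmap S (Fl t) p in dF *m J (Fl t p) *m invmx dF.

Definition graph_deformation (Fl : R -> M -> M) (phi : R -> M -> 'M[C]_N) : Prop :=
  forall p, \forall t \near (0 : R),
    (forall Z, H10 p Z -> H01 p (Z *m phi t p)) /\
    forall V, (CH p V /\ V *m mxC (pulled_J Fl t p) = 'i%C *: V) <->
              exists2 Z, H10 p Z & V = Z + Z *m phi t p.

Definition derivableC (c : R -> C) (t : R) : Prop :=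
  derivable (fun s => complex.Re (c s)) t (1 : R) /\
  derivable (fun s => complex.Im (c s)) t (1 : R).

Definition deriveC (c : R -> C) (t : R) : C :=
  ('D_1 (fun s => complex.Re (c s)) t +i* 'D_1 (fun s => complex.Im (c s)) t)%C.

Definition infinitesimal_deformation (phi : R -> M -> 'M[C]_N)
    (p : M) (Z : 'rV[C]_N) : 'rV[C]_N :=
  \row_j deriveC (fun t => (Z *m phi t p) 0 j) 0.

(* The structure equations of the Tanaka-Webster connection over [U]:
   [om p a c] is [omega_a^c], [A p a c] is [A_{abar}^c] and [Nij p c a b] is
   [N^c_{abar bbar}]. *)
Record tanaka_webster (theta : M -> 'cV[R]_N) (U : set M)
    (Z : M -> 'M[C]_(n, N)) (th : M -> 'M[C]_(N, n))
    (om : M -> 'I_n -> 'I_n -> 'cV[C]_N) (A : M -> 'I_n -> 'I_n -> C)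
    (Nij : M -> 'I_n -> 'I_n -> 'I_n -> C) : Prop := {
  TW_smooth : forall a c, smooth_formC S U (fun q => om q a c);
  TW_metric : forall p a b (V : 'rV[C]_N), U p ->
    \sum_c levi_mx theta p (Z p) c b * ev V (om p a c) +
    \sum_c levi_mx theta p (Z p) a c * ev V (mxconj (om p b c)) =
    dirC S p V (fun q => levi_mx theta q (Z q) a b);
  TW_structure : forall p c (V W : 'rV[C]_N), U p ->
    extdC S (fun q => col c (th q)) p V W =
    \sum_a wedge (col a (th p)) (om p a c) V W +
    \sum_a A p a c * wedge (mxC (theta p)) (mxconj (col a (th p))) V W +
    2%:R^-1 * \sum_a \sum_b Nij p c a b *
      wedge (mxconj (col a (th p))) (mxconj (col b (th p))) V W;
  TW_Nijenhuis_skew : forall p c a b, U p ->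
    2%:R^-1 * (Nij p c a b + Nij p c b a) = 0
}.

(* Here [g] is the trivialization of the density with respect to [theta]. The trivializing density [|xi|^2] is parallel
   for the Tanaka-Webster connection, so [nabla] acts on [g] as on functions. *)
Section Components.
Variables (theta : M -> 'cV[R]_N) (g : M -> R).
Variables (Z : M -> 'M[C]_(n, N)) (th : M -> 'M[C]_(N, n)).
Variables (om : M -> 'I_n -> 'I_n -> 'cV[C]_N) (A : M -> 'I_n -> 'I_n -> C).
Variable Nij : M -> 'I_n -> 'I_n -> 'I_n -> C.

Local Notation h p := (levi_mx theta p (Z p)).
Local Notation hinv p := (invmx (levi_mx theta p (Z p))).
Local Notation Zc q := (mxconj (Z q)).
Local Notation gC := (fun q : M => (g q)%:C%C).

Definition nab (a : 'I_n) (p : M) : C := dirC S p (row a (Z p)) gC.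
Definition nabbar (a : 'I_n) (p : M) : C := dirC S p (row a (Zc p)) gC.

Definition nab2 (a b : 'I_n) (p : M) : C :=
  dirC S p (row a (Z p)) (nab b) -
  \sum_c ev (row a (Z p)) (om p b c) * nab c p.

Definition nabbar2 (a b : 'I_n) (p : M) : C :=
  dirC S p (row a (Zc p)) (nabbar b) -
  \sum_c ev (row a (Zc p)) (mxconj (om p b c)) * nabbar c p.

(* [nabla^a g = h^{a bbar} nabla_bbar g] and [nabla^abar g = h^{b abar} nabla_b g],
   where [h^{a bbar} h_{c bbar} = delta_c^a]. *)
Definition nab_up (a : 'I_n) (p : M) : C := \sum_b hinv p b a * nabbar b p.
Definition nabbar_up (a : 'I_n) (p : M) : C := \sum_b hinv p a b * nab b p.

(* [A_{ab}], [A_{abar bbar}], [N_{cab}] and [N_{cbar abar bbar}]. *)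
Definition A_low (a b : 'I_n) (p : M) : C := \sum_c h p b c * (A p a c)^*%C.
Definition Abar_low (a b : 'I_n) (p : M) : C := \sum_c h p c b * A p a c.
Definition N_low (c a b : 'I_n) (p : M) : C :=
  \sum_s h p c s * (Nij p s a b)^*%C.
Definition Nbar_low (c a b : 'I_n) (p : M) : C :=
  \sum_s h p s c * Nij p s a b.

Definition sym2 (t : 'I_n -> 'I_n -> C) (a b : 'I_n) : C :=
  2%:R^-1 * (t a b + t b a).

Definition CR_Killing (p : M) (a b : 'I_n) : C * C :=
  ('i%C * sym2 (fun a b => nab2 a b p) a b - A_low a b p * gC p
     + 'i%C * \sum_c sym2 (fun a b => N_low a b c p) a b * nab_up c p,
   - 'i%C * sym2 (fun a b => nabbar2 a b p) a b - Abar_low a b p * gC p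
     - 'i%C * \sum_c sym2 (fun a b => Nbar_low a b c p) a b * nabbar_up c p).

(* For [psi : H10 -> H01] at [p]: [psi_a^{bbar}], and then the pair
   [(psi_{ab}, psi_{abar bbar})] of components of the real tensor. *)
Definition mixed_component (psi : 'rV[C]_N -> 'rV[C]_N) (p : M) (a b : 'I_n) : C :=
  ev (psi (row a (Z p))) (mxconj (col b (th p))).

Definition lowered_components (psi : 'rV[C]_N -> 'rV[C]_N) (p : M)
    (a b : 'I_n) : C * C :=
  (\sum_c h p b c * mixed_component psi p a c,
   \sum_c h p c b * (mixed_component psi p a c)^*%C).

End Components.
End Structure.
End CR.

(* Main.v *)
(* Let [L_t] be the differential of the flow read in a chart. The graph condition
   says [(Z + phi_t Z) (L_t (J - i)) = 0], with [J] taken along the flow line;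
   solving for [phi_t] and differentiating at [t = 0] gives
   [psi Z = (2i)^-1 (- [X, Z]) (J - i)], hence [psi_a^{cbar} = theta^{cbar}([X, Z_a])].
   That [L_t] preserves the contact planes comes from [L_X theta = (T g) theta] and
   a Gronwall argument. Cartan's formula for [d theta^{cbar}] and the
   Tanaka-Webster structure equations, with [X^c = i nabla^c g], then give
   [psi_{ab} = i nabla_a nabla_b g - A_{ab} g + i N_{bac} nabla^c g]. Since [X] is
   an infinitesimal contact transformation, [psi_{ab}] is symmetric; for the Reeb
   field ([g = 1]) the formula reads [psi_{ab} = - A_{ab}], so [A] is symmetric too,
   and symmetrizing the formula in [a, b] yields the theorem. *)

(* [Cinfty] is stated through iterated directional derivatives, and tangent vectors at [q] are read
   in the chart of index [q]. The calculus is therefore rebuilt from directional derivatives, and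
   each local argument is carried into the single chart of index [p], at whose base point intrinsic
   and chart components agree. Nothing is known beforehand about the dependence of [phi] on [t]; its
   differentiability has to come out of the graph equation. The matrix multiplying [phi] there is
   [J - i] at time 0, which kills [H^{1,0}] and cannot be inverted. Since it is [- 2i] on [H^{0,1}],
   where [phi] takes its values, it may be replaced by a matrix equal to [- 2i] at time 0, which is
   invertible for small [t]. [contact_hamiltonian] gives the equations of [X] for some contact form,
   whereas the formula is claimed for every one. The exponent [2 / (n+2)] in the weight of the
   density settles this: the change of coframe has a determinant with [|det|^2 = lam^(n+2)], so the
   trivialization is multiplied by [lam]. The symmetry of [psi] is the vanishing of [L_X (d theta)]
   on [H x H], applied to sections of [H^{1,0}], which is isotropic for [d theta]. *)
Require Import Defs.
From HB Require Import structures.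
From mathcomp Require Import all_boot all_order all_algebra.
From mathcomp Require Import all_classical all_reals topology normedtype derive exp.
From mathcomp Require Import landau sequences.
From mathcomp Require Import complex.
From mathcomp Require Import ring lra.

Set Implicit Arguments.
Unset Strict Implicit.
Unset Printing Implicit Defensive.

Import Order.TTheory GRing.Theory Num.Theory.
Import numFieldNormedType.Exports.

Local Open Scope classical_set_scope.
Local Open Scope ring_scope.

(** * Directional derivatives and smooth functions *)

(* [dd] and [dable] are locked because unification unfolds ['D_v] and [derivable]
   down to limits of filters. *)
HB.lock Definition dd (R : realType) (V : normedModType R) (v : V) (f : V -> R)
  (x : V) : R := 'D_v f x.
HB.lock Definition dable (R : realType) (V : normedModType R) (f : V -> R)
  (x v : V) : Prop := derivable f x v.

(** Existence and value are bundled because [dd] has a default value where the limit does not exist,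
    so that an equation on [dd] alone carries no information about differentiability. *)
Definition isdd (R : realType) (V : normedModType R) (f : V -> R) (x v : V) (l : R) :=
  dable f x v /\ dd v f x = l.

Section Isdd.
Variables (R : realType) (V : normedModType R).
Implicit Types (f g : V -> R) (x v : V).

Lemma isddE f x v l : isdd f x v l <-> is_derive x v f l.
Proof. by rewrite /isdd dd.unlock dable.unlock; split=> -[]. Qed.

Lemma dableP f x v : dable f x v -> isdd f x v (dd v f x).
Proof. by []. Qed.

Lemma isdd_dd f x v l : isdd f x v l -> dd v f x = l.
Proof. by case. Qed.

Lemma isdd_dable f x v l : isdd f x v l -> dable f x v.
Proof. by case. Qed.

Lemma isdd_eq f x v l l' : isdd f x v l -> l = l' -> isdd f x v l'.
Proof. by move=> ? <-. Qed.

Lemma isdd_cst (c : R) x v : isdd (fun=> c) x v 0.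
Proof. apply/isddE; exact: is_derive_cst. Qed.

Lemma isddD f g x v l m :
  isdd f x v l -> isdd g x v m -> isdd (fun y => f y + g y) x v (l + m).
Proof. by move=> /isddE ? /isddE ?; apply/isddE; apply: is_deriveD. Qed.

Lemma isddN f x v l : isdd f x v l -> isdd (fun y => - f y) x v (- l).
Proof. by move=> /isddE ?; apply/isddE; apply: is_deriveN. Qed.

Lemma isddB f g x v l m :
  isdd f x v l -> isdd g x v m -> isdd (fun y => f y - g y) x v (l - m).
Proof. by move=> ? /isddN; apply: isddD. Qed.

Lemma isddM f g x v l m :
  isdd f x v l -> isdd g x v m -> isdd (fun y => f y * g y) x v (l * g x + f x * m).
Proof.
move=> /isddE df /isddE dg; apply/isddE; apply: is_derive_eq.
by rewrite addrC mulrC.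
Qed.

Lemma isdd_sum (I : Type) (r : seq I) (P : pred I) (F : I -> V -> R) x v l :
  (forall i, P i -> isdd (F i) x v (l i)) ->
  isdd (fun y => \sum_(i <- r | P i) F i y) x v (\sum_(i <- r | P i) l i).
Proof.
move=> H; elim: r => [|a r IH].
  by rewrite big_nil; under eq_fun do rewrite big_nil; exact: isdd_cst.
rewrite big_cons; under eq_fun do rewrite big_cons.
by case: ifP => // Pa; apply: isddD => //; exact: H.
Qed.

Lemma isdd_near f g x v l :
  (\forall y \near x, f y = g y) -> isdd f x v l -> isdd g x v l.
Proof. by move=> fg /isddE ?; apply/isddE; apply: near_eq_is_derive fg _. Qed.

Lemma dd_near f g x v : (\forall y \near x, f y = g y) -> dd v f x = dd v g x.
Proof. by move=> fg; rewrite dd.unlock; exact: near_eq_derive. Qed.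

Lemma isddV f x v l : f x != 0 -> isdd f x v l ->
  isdd (fun y => (f y)^-1) x v (- (f x) ^- 2 * l).
Proof.
move=> fx0 /isddE [df <-]; apply/isddE; split; first exact: derivableV.
by rewrite deriveV.
Qed.

End Isdd.

Lemma isdd_line (R : realType) (V : normedModType R) (f : V -> R) (a u : V) (s : R) l :
  isdd f (a + s *: u) u l -> isdd (fun r : R => f (a + r *: u)) s 1 l.
Proof.
move=> /isddE [df dl]; apply/isddE.
have E : (fun h : R => h^-1 *: ((f \o shift (a + s *: u)) (h *: u) - f (a + s *: u)))
   = (fun h : R => h^-1 *: (((fun r => f (a + r *: u)) \o shift s) (h *: 1) - f (a + s *: u))).
  apply/funext => h /=.
  by rewrite scalerDl addrCA [h *: 1]mulr1.
by split; rewrite -?dl /derivable /derive -E.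
Qed.

Lemma isdd_continuous (R : realType) (f : R -> R) (x l : R) :
  isdd f x 1 l -> {for x, continuous f}.
Proof.
by move=> /isddE[df _]; apply/differentiable_continuous/derivable1_diffP.
Qed.

Lemma isdd_MVT (R : realType) (f df : R -> R) (a b : R) : a < b ->
  (forall x, a <= x <= b -> isdd f x 1 (df x)) ->
  exists2 c, a < c < b & f b - f a = df c * (b - a).
Proof.
move=> ab H.
have dP s : s \in `]a, b[ -> is_derive s 1 f (df s).
  by rewrite in_itv /= => /andP[s0 sh]; apply/isddE; apply: H; rewrite !ltW.
have cf : {within `[a, b], continuous f}.
  apply: derivable_within_continuous => s; rewrite in_itv /= => sh.
  by have /isddE[] := H s sh.
by have [c] := MVT ab dP cf; rewrite in_itv /= => ? ?; exists c.
Qed.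

(** The mean value theorem is used twice: along [u] for the increment of [f] in the direction [v],
    and then along [v] for [dd u f]. *)
Lemma second_difference (R : realType) (V : normedModType R) (f : V -> R)
    (x u v : V) (h : R) : 0 < h ->
  (forall s t : R, 0 <= s <= h -> 0 <= t <= h ->
    let y := x + s *: u + t *: v in
    dable f y u /\ dable (dd u f) y v) ->
  exists s t : R, [/\ 0 <= s <= h, 0 <= t <= h &
   f (x + h *: u + h *: v) - f (x + h *: u) - f (x + h *: v) + f x =
   h * h * dd v (dd u f) (x + s *: u + t *: v)].
Proof.
move=> h0 H.
have hh : 0 <= h <= h by rewrite lexx ltW.
have zh : 0 <= (0 : R) <= h by rewrite lexx ltW.
pose phi s := f ((x + h *: v) + s *: u) - f (x + s *: u).
pose dphi s := dd u f ((x + h *: v) + s *: u) - dd u f (x + s *: u).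
have dP (s : R) : 0 <= s <= h -> isdd phi s 1 (dphi s).
  move=> sh; apply: isddB; apply: isdd_line; apply: dableP.
    by have [] := H s h sh hh; rewrite addrAC.
  by have [] := H s 0 sh zh; rewrite scale0r addr0.
have [c /andP[c0 ch] E1] := isdd_MVT h0 dP.
have ch' : 0 <= c <= h by rewrite !ltW.
pose psi t := dd u f ((x + c *: u) + t *: v).
have dQ (t : R) : 0 <= t <= h -> isdd psi t 1 (dd v (dd u f) (x + c *: u + t *: v)).
  by move=> th; apply: isdd_line; apply: dableP; case: (H c t ch' th).
have [d /andP[d0 dh] E2] := isdd_MVT h0 dQ.
exists c, d; split; [by []|by rewrite !ltW|].
move: E1 E2; rewrite /phi /dphi /psi !subr0 !scale0r !addr0 => E1 E2.
rewrite (addrAC x) in E1 *.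
have -> : h * h * dd v (dd u f) (x + c *: u + d *: v) =
   (dd u f (x + c *: u + h *: v) - dd u f (x + c *: u)) * h.
  by rewrite E2; ring.
by rewrite (addrAC x (c *: u)) -E1; ring.
Qed.

(** The second difference is symmetric in [u] and [v], so the two mixed derivatives agree at two
    points of a small parallelogram; continuity at [x] carries the equality to [x] up to [e]. *)
Lemma Schwarz_dd (R : realType) (V : normedModType R) (f : V -> R) (x u v : V) :
  (\forall y \near x, [/\ dable f y u, dable f y v,
     dable (dd u f) y v & dable (dd v f) y u]) ->
  {for x, continuous (dd v (dd u f))} -> {for x, continuous (dd u (dd v f))} ->
  dd v (dd u f) x = dd u (dd v f) x.
Proof.
move=> Hd c1 c2.
suff H (e : R) : 0 < e -> `|dd v (dd u f) x - dd u (dd v f) x| <= e.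
  apply/eqP; rewrite -subr_eq0 -normr_le0.
  by apply/ler_addgt0Pl => e e0; rewrite addr0 H.
move=> e0; have e20 : 0 < e / 2 by rewrite divr_gt0.
have n1 : \forall y \near x, `|dd v (dd u f) x - dd v (dd u f) y| < e / 2.
  by move/cvgrPdist_lt: c1; apply.
have n2 : \forall y \near x, `|dd u (dd v f) x - dd u (dd v f) y| < e / 2.
  by move/cvgrPdist_lt: c2; apply.
have /nbhs_ballP[r /= r0 Hr] : \forall y \near x, [/\ dable f y u, dable f y v,
     dable (dd u f) y v & dable (dd v f) y u] /\
     (`|dd v (dd u f) x - dd v (dd u f) y| < e / 2 /\
     `|dd u (dd v f) x - dd u (dd v f) y| < e / 2).
  exact: filterI Hd (filterI n1 n2).
have K0 : 0 < `|u| + `|v| + 1 by rewrite ltr_wpDl ?addr_ge0.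
(* Small enough for the parallelogram with sides [h *: u] and [h *: v] to stay in the ball of radius
   [r]; the [+ 1] keeps the denominator positive when [u] and [v] vanish. *)
pose h := r / 2 / (`|u| + `|v| + 1).
have h0 : 0 < h by rewrite !divr_gt0.
have Hb (s t : R) : 0 <= s <= h -> 0 <= t <= h -> ball x r (x + s *: u + t *: v).
  move=> /andP[s0 sh] /andP[t0 th]; rewrite -ball_normE /= -addrA opprD addrA subrr sub0r normrN.
  apply: (le_lt_trans (ler_normD _ _)); rewrite !normrZ !ger0_norm//.
  apply: (@le_lt_trans _ _ (h * (`|u| + `|v| + 1))).
    rewrite !mulrDr mulr1 -[leLHS]addr0 lerD ?(ltW h0) //.
    by apply: lerD; apply: ler_wpM2r.
  by rewrite /h divfK ?gt_eqF // gtr_pMr // invf_lt1 // ltr1n.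
have [|s [t [sh th E1]]] := @second_difference _ _ f x u v h h0.
  by move=> s t sh th; have [[? _ ? _] _] := Hr _ (Hb s t sh th); split.
have [|s' [t' [sh' th' E2]]] := @second_difference _ _ f x v u h h0.
  move=> s' t' sh' th' /=; rewrite addrAC.
  by have [[_ ? _ ?] _] := Hr _ (Hb _ _ th' sh'); split.
rewrite [x + h *: v + _]addrAC [x + s' *: v + _]addrAC in E2.
(* Both mixed derivatives are the same second difference divided by [h * h]. *)
have E : dd v (dd u f) (x + s *: u + t *: v) = dd u (dd v f) (x + t' *: u + s' *: v).
  have hh : h * h != 0 by rewrite mulf_neq0 // gt_eqF.
  by apply: (mulfI hh); rewrite -E1 -E2; ring.
have [_ [A1 _]] := Hr _ (Hb _ _ sh th).
have [_ [_ A2]] := Hr _ (Hb _ _ th' sh').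
rewrite E in A1.
rewrite (splitr e) (le_trans (ler_distD (dd u (dd v f) (x + t' *: u + s' *: v)) _ _)) //.
by rewrite lerD ?ltW // distrC.
Qed.

Lemma isdd_comp1 (R : realType) (f g : R -> R) (x l m : R) :
  isdd f (g x) 1 l -> isdd g x 1 m -> isdd (fun y => f (g y)) x 1 (l * m).
Proof.
move=> /isddE [df <-] /isddE [dg <-]; apply/isddE; split.
  have /derivable1_diffP Df := df; have /derivable1_diffP Dg := dg.
  exact/derivable1_diffP/(differentiable_comp Dg Df).
by have := derive1_comp dg df; rewrite !derive1E.
Qed.

(** Restriction to a line turns a directional derivative into a derivative in one real variable,
    where the one-variable chain rule applies. *)
Lemma isdd_line0 (R : realType) (V : normedModType R) (f : V -> R) (x v : V) l :
  isdd f x v l <-> isdd (fun r : R => f (x + r *: v)) 0 1 l.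
Proof.
split=> [H|/isddE [df dl]].
  by apply: isdd_line; rewrite scale0r addr0.
apply/isddE.
have E : (fun h : R => h^-1 *: ((f \o shift x) (h *: v) - f x))
   = (fun h : R => h^-1 *: (((fun r => f (x + r *: v)) \o shift (0 : R)) (h *: 1) -
      f (x + (0 : R) *: v))).
  apply/funext => h /=.
  by rewrite scale0r !addr0 [h *: 1]mulr1 [x + _]addrC.
by split; rewrite -?dl /derivable /derive E.
Qed.

Lemma isdd_id (R : realType) (x : R) : isdd (fun y : R => y) x 1 1.
Proof. by apply/isddE; exact: is_derive_id. Qed.

Lemma isddZdir (R : realType) (V : normedModType R) (f : V -> R) (x v : V) c l :
  isdd f x v l -> isdd f x (c *: v) (c * l).
Proof.
move=> /isdd_line0 H; apply/isdd_line0.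
have -> : (fun r : R => f (x + r *: (c *: v))) = (fun r => f (x + (r * c) *: v)).
  by apply/funext => r; rewrite scalerA.
rewrite mulrC; apply: (@isdd_comp1 _ (fun r => f (x + r *: v)) (fun r => r * c)).
  by rewrite mul0r.
apply: isdd_eq; first exact: (isddM (isdd_id _) (isdd_cst _ _ _)).
by rewrite mul1r mulr0 addr0.
Qed.

(** * Continuous partial derivatives and first-order expansion *)

Section C1.
Variables (R : realType) (N : nat).
Local Notation E := 'rV[R]_N.
Definition ebase (k : 'I_N) : E := delta_mx 0 k.

Lemma rV_ballP (x y : E) (r : R) : 0 < r ->
  ball x r y <-> forall k, `|x 0 k - y 0 k| < r.
Proof.
move=> r0; split=> [[_ H] k|H]; first exact: H.
by split=> // i j; rewrite ord1; exact: H.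
Qed.

(** From [a] to [b] one coordinate is changed at a time, and the mean value theorem is applied to
    each of the [N] steps. The estimate is uniform in [a] and [b], which is what the chain rule
    needs. *)
Lemma C1_increment (f : E -> R) (x : E) (r e : R) : 0 < r ->
  (forall y, ball x r y -> forall k, dable f y (ebase k) /\
     `|dd (ebase k) f x - dd (ebase k) f y| <= e) ->
  forall a b, ball x r a -> ball x r b ->
  `|f b - f a - \sum_k (b - a) 0 k * dd (ebase k) f x| <=
    e * \sum_k `|(b - a) 0 k|.
Proof.
move=> r0 H a b /rV_ballP-/(_ r0) xa /rV_ballP-/(_ r0) xb.
(* [c j] has its first [j] coordinates from [b] and the others from [a], so consecutive points
   differ along one basis vector. *)
pose c (j : nat) : E := \row_(i < N) (if (i < j)%N then b 0 i else a 0 i).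
have c0 : c 0%N = a by apply/rowP => i; rewrite mxE.
have cN : c N = b by apply/rowP => i; rewrite mxE ltn_ord.
have cS (j : 'I_N) : c j.+1 = c j + (b - a) 0 j *: ebase j.
  apply/rowP => i; rewrite !mxE eqxx /= ltnS leq_eqVlt.
  have [->|ij] := eqVneq i j.
    by rewrite eqxx /= ltnn mulr1 addrC subrK.
  by rewrite (_ : (i == j :> nat) = false) ?mulr0 ?addr0 //; apply: negbTE.
have -> : f b - f a = \sum_(j < N) (f (c j.+1) - f (c j)).
  by rewrite -(big_mkord predT (fun j => f (c j.+1) - f (c j))) telescope_sumr // cN c0.
rewrite -sumrB mulr_sumr; apply: (le_trans (ler_norm_sum _ _ _)).
apply: ler_sum => j _.
(* The ball of the sup norm is a product of intervals, so only the moving coordinate matters, and it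
   is a convex combination of [a 0 j] and [b 0 j]. *)
have inb (s : R) : 0 <= s <= 1 -> ball x r (c j + s *: ((b - a) 0 j *: ebase j)).
  move=> /andP[s0 s1]; apply/rV_ballP => // i; rewrite !mxE eqxx /=.
  have [->|ij] := eqVneq i j; last first.
    by rewrite !mulr0 addr0; case: ifP.
  rewrite ltnn mulr1.
  have -> : x 0 j - (a 0 j + s * (b 0 j - a 0 j)) =
    (1 - s) * (x 0 j - a 0 j) + s * (x 0 j - b 0 j) by ring.
  apply: (le_lt_trans (ler_normD _ _)); rewrite !normrM (ger0_norm s0) ger0_norm ?subr_ge0 //.
  have [-> | sn] := eqVneq s 0; first by rewrite subr0 mul1r mul0r addr0.
  have sp : 0 < s by rewrite lt_neqAle eq_sym sn.
  have : s * `|x 0 j - b 0 j| < s * r by rewrite ltr_pM2l.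
  have : (1 - s) * `|x 0 j - a 0 j| <= (1 - s) * r.
    by apply: ler_wpM2l; [rewrite subr_ge0|apply: ltW].
  by lra.
have [|s s01] := @isdd_MVT _ (fun s => f (c j + s *: ((b - a) 0 j *: ebase j)))
   (fun s => (b - a) 0 j * dd (ebase j) f (c j + s *: ((b - a) 0 j *: ebase j))) 0 1 ltr01.
  move=> s s01; apply: isdd_line; apply: isddZdir; apply: dableP.
  exact: (H _ (inb _ s01) j).1.
rewrite scale1r scale0r addr0 -cS subr0 mulr1 => ->.
rewrite -mulrBr normrM mulrC; apply: ler_wpM2r => //.
rewrite distrC; apply: (H _ (inb _ _) j).2.
by case/andP: s01 => ? ?; rewrite !ltW.
Qed.

End C1.

Lemma cvg_bigsum (R : realType) (T : Type) (F : set_system T) (FF : Filter F)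
    (I : Type) (r : seq I) (f : I -> T -> R) (l : I -> R) :
  (forall i, f i x @[x --> F] --> l i) ->
  \sum_(i <- r) f i x @[x --> F] --> \sum_(i <- r) l i.
Proof.
move=> H; elim: r => [|a r IH].
  by rewrite big_nil; under eq_fun do rewrite big_nil; exact: cvg_cst.
by rewrite big_cons; under eq_fun do rewrite big_cons; exact: cvgD.
Qed.

Lemma isdd_cvgE (R : realType) (V : normedModType R) (f : V -> R) x v l :
  isdd f x v l <-> h^-1 * (f (x + h *: v) - f x) @[h --> 0^'] --> l.
Proof.
have E : (fun h : R => h^-1 *: ((f \o shift x) (h *: v) - f x))
   = (fun h : R => h^-1 * (f (x + h *: v) - f x)).
  by apply/funext => h /=; rewrite [x + _]addrC.
rewrite isddE; split=> [[df <-]|H].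
  by move: df; rewrite /derivable /derive E => df.
by split; rewrite /derivable /derive E; [apply/cvg_ex; exists l|apply: cvg_lim].
Qed.

(** Along the curve [r |-> g (x + r *: v)] the increment of [f] is compared by [C1_increment] with
    its linear part; the difference quotients of the curve are bounded, so the error divided by [h]
    tends to zero. *)
Lemma isdd_chain (R : realType) (V : normedModType R) N (f : 'rV[R]_N -> R)
    (g : V -> 'rV[R]_N) (x v : V) (w : 'rV[R]_N) :
  (\forall y \near g x, forall k, dable f y (ebase _ k)) ->
  (forall k, {for g x, continuous (dd (ebase _ k) f)}) ->
  (forall k, isdd (fun y => g y 0 k) x v (w 0 k)) ->
  isdd (fun y => f (g y)) x v (\sum_k w 0 k * dd (ebase _ k) f (g x)).
Proof.
move=> Hd Hc Hg; apply/isdd_line0.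
have {}Hg k : isdd (fun r : R => g (x + r *: v) 0 k) 0 1 (w 0 k).
  exact/(isdd_line0 (fun y => g y 0 k)).
pose ga (r : R) := g (x + r *: v).
have ga0 : g x = ga 0 by rewrite /ga scale0r addr0.
rewrite ga0 in Hd Hc *; rewrite -/(fun r => f (ga r)).
pose q k (h : R) := h^-1 * (ga h 0 k - ga 0 0 k).
have Hq k : q k h @[h --> 0^'] --> w 0 k.
  have /isdd_cvgE := Hg k; apply: cvg_trans; apply: near_eq_cvg.
  by apply: nearW => h; rewrite /q add0r [h *: 1]mulr1.
pose c k := dd (ebase _ k) f (ga 0).
apply/isdd_cvgE.
have lin : \sum_k q k h * c k @[h --> 0^'] --> \sum_k w 0 k * c k.
  apply: cvg_bigsum => k; apply: cvgM; [exact: Hq|exact: cvg_cst].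
pose rho h := h^-1 * (f (ga h) - f (ga 0)) - \sum_k q k h * c k.
suff Hrho : rho h @[h --> 0^'] --> 0.
  rewrite -[X in _ --> X]addr0.
  apply: cvg_trans (cvgD lin Hrho); apply: near_eq_cvg; apply: nearW => h /=.
  by rewrite /rho !add0r [h *: 1]mulr1 addrC subrK.
(* An eventual bound for the [l^1] norm of the difference quotients; requiring the partial
   derivatives to vary by at most [e / K] leaves a final error of at most [e]. *)
pose K := \sum_k `|w 0 k| + 1.
have K0 : 0 < K by rewrite ltr_wpDl // sumr_ge0.
have HK : \forall h \near 0^', \sum_k `|q k h| < K.
  have : \sum_k `|q k h| @[h --> 0^'] --> \sum_k `|w 0 k|.
    by apply: cvg_bigsum => k; apply: cvg_norm; exact: Hq.
  by move/cvgr_lt; apply; rewrite /K ltrDl.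
apply/cvgr0Pnorm_le => e e0.
have eK : 0 < e / K by rewrite divr_gt0.
have /nbhs_ballP[r /= r0 Hr] : \forall y \near ga 0, forall k,
    dable f y (ebase _ k) /\ `|c k - dd (ebase _ k) f y| <= e / K.
  near=> y => k; split; first by move: k; near: y.
  move: k; near: y; apply: filter_forall => k.
  by move/cvgrPdist_le: (Hc k); apply.
have Hb : \forall h \near 0^', ball (ga 0) r (ga h).
  apply: nbhs_dnbhs; near=> h; apply/rV_ballP => //.
  near: h; apply: filter_forall => k.
  by have /isdd_continuous/cvgrPdist_lt := Hg k; apply.
near=> h.
have h0 : h != 0 by near: h; exact: nbhs_dnbhs_neq.
have hb : ball (ga 0) r (ga h) by near: h.
have := C1_increment r0 Hr (ballxx _ r0) hb.
have -> : \sum_k (ga h - ga 0) 0 k * dd (ebase _ k) f (ga 0) = h * \sum_k q k h * c k.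
  by rewrite mulr_sumr; apply: eq_bigr => k _; rewrite /q !mxE !mulrA mulfV // mul1r.
have -> : \sum_k `|(ga h - ga 0) 0 k| = `|h| * \sum_k `|q k h|.
  rewrite mulr_sumr; apply: eq_bigr => k _.
  by rewrite -normrM /q !mxE mulrA mulfV // mul1r.
have -> : f (ga h) - f (ga 0) - h * \sum_k q k h * c k = h * rho h.
  by rewrite /rho mulrBr mulrA mulfV // mul1r.
rewrite normrM mulrCA ler_pM2l ?normr_gt0 //.
move=> /le_trans; apply.
rewrite mulrAC ler_pdivrMr // ler_pM2l //.
by apply: ltW; near: h.
Unshelve. all: by end_near. Qed.

(** * Smooth functions: algebra, composition, symmetry of second derivatives *)

Section Smooth.
Variable R : realType.

Fixpoint smk (V : normedModType R) k (f : V -> R) (A : set V) : Prop :=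
  (forall x, A x -> {for x, continuous f}) /\
  match k with
  | 0 => True
  | k'.+1 => forall v, (forall x, A x -> dable f x v) /\ smk k' (dd v f) A
  end.

Definition sm (V : normedModType R) (f : V -> R) (A : set V) := forall k, smk k f A.

Lemma CkE (V : normedModType R) k (f : V -> R) A : Ck k f A <-> smk k f A.
Proof.
elim: k f => [|k IH] f //=; split=> -[cf H]; split=> // v; have [H1 /IH H2] := H v.
  by rewrite dable.unlock dd.unlock; split.
by move: H1 H2; rewrite dable.unlock dd.unlock; split.
Qed.

Lemma CinftyE (V : normedModType R) (f : V -> R) A : Cinfty f A <-> sm f A.
Proof. by split=> H k; apply/CkE. Qed.

Section Closure.
Variable V : normedModType R.
Implicit Types (f g : V -> R) (A B : set V).

Lemma smk_sub k f A B : B `<=` A -> smk k f A -> smk k f B.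
Proof.
move=> BA; elim: k f => [|k IH] f /= [c H]; (split; first by move=> x Bx; exact/c/BA) => // v.
by have [H1 H2] := H v; split=> [x Bx|]; [exact/H1/BA|exact: IH].
Qed.

Lemma sm_sub f A B : B `<=` A -> sm f A -> sm f B.
Proof. by move=> BA H k; exact: smk_sub (H k). Qed.

Lemma smk_continuous k f A x : smk k f A -> A x -> {for x, continuous f}.
Proof. by case: k => [|k] /= [H _]; apply: H. Qed.

Lemma smkW k f A : smk k.+1 f A -> smk k f A.
Proof.
elim: k f => [|k IH] f [c H]; split=> // v; have [H1 H2] := H v.
by split=> //; exact: IH.
Qed.

Lemma sm_dd f A v : sm f A -> sm (dd v f) A.
Proof. by move=> H k; have [_ /(_ v)[]] := H k.+1. Qed.

Lemma sm_dable f A x v : sm f A -> A x -> dable f x v.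
Proof. by move=> H Ax; have [_ /(_ v)[+ _]] := H 1%N; apply. Qed.

Lemma sm_continuous f A x : sm f A -> A x -> {for x, continuous f}.
Proof. by move=> H; apply: smk_continuous (H 0%N). Qed.

Lemma near_eq_continuous f g x : (\forall y \near x, f y = g y) ->
  {for x, continuous f} -> {for x, continuous g}.
Proof.
move=> fg c; rewrite /prop_for /continuous_at -(nbhs_singleton fg).
by apply: cvg_trans c; exact: near_eq_cvg.
Qed.

Lemma smk_eq k f g A : open A -> (forall x, A x -> f x = g x) ->
  smk k f A -> smk k g A.
Proof.
move=> oA; elim: k f g => [|k IH] f g fg /=.
  move=> [H _]; split=> // x Ax.
  have nfg : \forall y \near x, f y = g y by apply: filterS (open_nbhs_nbhs (conj oA Ax)).
  exact: near_eq_continuous nfg (H x Ax).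
move=> [H1 H2]; split=> [x Ax|v].
  have nfg : \forall y \near x, f y = g y by apply: filterS (open_nbhs_nbhs (conj oA Ax)).
  exact: near_eq_continuous nfg (H1 x Ax).
have [D S] := H2 v; split=> [x Ax|].
  apply: isdd_dable; apply: isdd_near; last exact: dableP (D x Ax).
  by apply: filterS (open_nbhs_nbhs (conj oA Ax)).
apply: IH S => x Ax; apply: dd_near.
by apply: filterS (open_nbhs_nbhs (conj oA Ax)).
Qed.

Lemma sm_eq f g A : open A -> (forall x, A x -> f x = g x) -> sm f A -> sm g A.
Proof. by move=> oA fg H k; exact: smk_eq fg (H k). Qed.

Lemma sm_cst c A : sm (fun=> c) A.
Proof.
move=> k; elim: k c => [|k IH] c /=; (split; first by move=> x _; exact: cvg_cst) => // v.
split=> [x _|]; first exact: isdd_dable (isdd_cst _ _ _).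
have -> : dd v (fun=> c) = (fun=> 0 : R); last exact: IH.
by apply/funext => x; exact: isdd_dd (isdd_cst _ _ _).
Qed.

Lemma smkD k f g A : open A -> smk k f A -> smk k g A -> smk k (fun x => f x + g x) A.
Proof.
move=> oA; elim: k f g => [|k IH] f g /= [cf Hf] [cg Hg].
  by split=> // x Ax; apply: cvgD; [exact: cf|exact: cg].
split=> [x Ax|v]; first by apply: cvgD; [exact: cf|exact: cg].
have [Df Sf] := Hf v; have [Dg Sg] := Hg v; split=> [x Ax|].
  exact: isdd_dable (isddD (dableP (Df x Ax)) (dableP (Dg x Ax))).
apply: smk_eq (IH _ _ Sf Sg) => // x Ax.
by rewrite (isdd_dd (isddD (dableP (Df x Ax)) (dableP (Dg x Ax)))).
Qed.

Lemma smkM k f g A : open A -> smk k f A -> smk k g A -> smk k (fun x => f x * g x) A.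
Proof.
move=> oA; elim: k f g => [|k IH] f g.
  by move=> /= [cf _] [cg _]; split=> // x Ax; apply: cvgM; [exact: cf|exact: cg].
move=> Kf Kg; have [cf Hf] := Kf; have [cg Hg] := Kg.
split=> [x Ax|v]; first by apply: cvgM; [exact: cf|exact: cg].
have [Df Sf] := Hf v; have [Dg Sg] := Hg v; split=> [x Ax|].
  exact: isdd_dable (isddM (dableP (Df x Ax)) (dableP (Dg x Ax))).
apply: (@smk_eq _ (fun x => dd v f x * g x + f x * dd v g x)) => // [x Ax|].
  by rewrite (isdd_dd (isddM (dableP (Df x Ax)) (dableP (Dg x Ax)))).
by apply: smkD => //; apply: IH => //; exact: smkW.
Qed.

Lemma smD f g A : open A -> sm f A -> sm g A -> sm (fun x => f x + g x) A.
Proof. by move=> oA Hf Hg k; exact: smkD. Qed.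

Lemma smM f g A : open A -> sm f A -> sm g A -> sm (fun x => f x * g x) A.
Proof. by move=> oA Hf Hg k; exact: smkM. Qed.

Lemma smN f A : open A -> sm f A -> sm (fun x => - f x) A.
Proof.
move=> oA Hf; apply: (@sm_eq (fun x => -1 * f x)) => // [x _|].
  by rewrite mulN1r.
by apply: smM => //; exact: sm_cst.
Qed.

Lemma smB f g A : open A -> sm f A -> sm g A -> sm (fun x => f x - g x) A.
Proof. by move=> oA Hf Hg; apply: smD => //; exact: smN. Qed.

Lemma smk_sum k (I : Type) (r : seq I) (F : I -> V -> R) A : open A ->
  (forall i, smk k (F i) A) -> smk k (fun x => \sum_(i <- r) F i x) A.
Proof.
move=> oA H; elim: r => [|a r IH].
  by under eq_fun do rewrite big_nil; exact: sm_cst.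
by under eq_fun do rewrite big_cons; exact: smkD.
Qed.

Lemma sm_sum (I : Type) (r : seq I) (F : I -> V -> R) A : open A ->
  (forall i, sm (F i) A) -> sm (fun x => \sum_(i <- r) F i x) A.
Proof. by move=> oA H k; apply: smk_sum => // i; exact: H. Qed.

Lemma Schwarz_sm f A x u v : open A -> sm f A -> A x ->
  dd u (dd v f) x = dd v (dd u f) x.
Proof.
move=> oA H Ax; apply: Schwarz_dd.
- apply: filterS (open_nbhs_nbhs (conj oA Ax)) => y Ay.
  by split; apply: sm_dable Ay => //; exact: sm_dd.
- by apply: sm_continuous Ax; do 2 apply: sm_dd.
- by apply: sm_continuous Ax; do 2 apply: sm_dd.
Qed.

End Closure.

Lemma rV_continuous (T : topologicalType) N (g : T -> 'rV[R]_N) (x : T) :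
  (forall j, {for x, continuous (fun y => g y 0 j)}) -> {for x, continuous g}.
Proof.
move=> H; apply/cvg_ballP => e e0.
near=> y; apply/rV_ballP => //.
near: y; apply: filter_forall => k.
by have /cvgrPdist_lt := H k; apply.
Unshelve. all: by end_near. Qed.

(** The chain rule expresses a derivative of the composite through derivatives of [g] and partial
    derivatives of [f] composed with [g]. Smoothness of [f] to all orders lets the induction on [k]
    apply to these partial derivatives. *)
Lemma smk_comp (V : normedModType R) k N (f : 'rV[R]_N -> R) (g : V -> 'rV[R]_N)
    (A : set V) (B : set 'rV[R]_N) : open A -> open B -> (forall x, A x -> B (g x)) ->
  sm f B -> (forall j, smk k (fun x => g x 0 j) A) -> smk k (fun x => f (g x)) A.
Proof.
move=> oA oB AB; elim: k f => [|k IH] f Sf Sg.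
  split=> // x Ax; apply: (@continuous_comp _ _ _ g f).
    by apply: rV_continuous => j; exact: (Sg j).1.
  exact: sm_continuous (AB _ Ax).
have D x v : A x -> isdd (fun x => f (g x)) x v
    (\sum_j dd v (fun x => g x 0 j) x * dd (ebase _ j) f (g x)).
  move=> Ax.
  have := @isdd_chain _ _ _ f g x v (\row_j dd v (fun x => g x 0 j) x).
  under eq_bigr do rewrite mxE; apply.
  - apply: filterS (open_nbhs_nbhs (conj oB (AB _ Ax))) => y By j.
    exact: sm_dable By.
  - by move=> j; apply: sm_continuous (AB _ Ax); exact: sm_dd.
  - by move=> j; rewrite mxE; apply: dableP; have [_ /(_ v)[+ _]] := Sg j; apply.
split=> [x Ax|v].
  apply: (@continuous_comp _ _ _ g f).
    by apply: rV_continuous => j; exact: (Sg j).1.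
  exact: sm_continuous (AB _ Ax).
split=> [x Ax|]; first exact: isdd_dable (D x v Ax).
apply: (@smk_eq _ _ (fun x => \sum_j dd v (fun x => g x 0 j) x * dd (ebase _ j) f (g x))) => //.
  by move=> x Ax; rewrite (isdd_dd (D x v Ax)).
apply: smk_sum => // j; apply: smkM => //.
  by have [_ /(_ v)[]] := Sg j.
by apply: IH => [|i]; [exact: sm_dd|exact: smkW].
Qed.

Lemma sm_comp (V : normedModType R) N (f : 'rV[R]_N -> R) (g : V -> 'rV[R]_N)
    (A : set V) (B : set 'rV[R]_N) : open A -> open B -> (forall x, A x -> B (g x)) ->
  sm f B -> (forall j, sm (fun x => g x 0 j) A) -> sm (fun x => f (g x)) A.
Proof. by move=> oA oB AB Sf Sg k; apply: smk_comp AB Sf _ => // j; exact: Sg. Qed.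

Lemma isdd_comp_sm (V : normedModType R) N (f : 'rV[R]_N -> R) (g : V -> 'rV[R]_N)
    (B : set 'rV[R]_N) (x v : V) (w : 'rV[R]_N) : open B -> sm f B -> B (g x) ->
  (forall k, isdd (fun y => g y 0 k) x v (w 0 k)) ->
  isdd (fun y => f (g y)) x v (\sum_k w 0 k * dd (ebase _ k) f (g x)).
Proof.
move=> oB Sf Bg; apply: isdd_chain.
  by apply: filterS (open_nbhs_nbhs (conj oB Bg)) => y By j; exact: sm_dable By.
by move=> j; apply: sm_continuous Bg; exact: sm_dd.
Qed.

Lemma isdd_coord N (j : 'I_N) (x v : 'rV[R]_N) :
  isdd (fun y : 'rV[R]_N => y 0 j) x v (v 0 j).
Proof.
apply/isdd_cvgE; apply: cvg_near_cst; near=> h.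
rewrite !mxE [x 0 j + _]addrC addrK mulrA mulVf ?mul1r //.
by near: h; exact: nbhs_dnbhs_neq.
Unshelve. all: by end_near. Qed.

Lemma dd_sum N (f : 'rV[R]_N -> R) (B : set 'rV[R]_N) (x v : 'rV[R]_N) :
  open B -> sm f B -> B x -> dd v f x = \sum_k v 0 k * dd (ebase _ k) f x.
Proof.
move=> oB Sf Bx; apply: isdd_dd.
exact: (@isdd_comp_sm _ _ f id B x v v oB Sf Bx (fun k => isdd_coord k x v)).
Qed.

End Smooth.

(** * Complex matrix-valued functions, Cartan calculus *)

Section ComplexCalculus.
Variable R : realType.
Local Notation C := R[i].
Local Notation Re := (@complex.Re R).
Local Notation Im := (@complex.Im R).

Lemma ReD (x y : C) : Re (x + y) = Re x + Re y. Proof. by case: x y => [? ?] []. Qed.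
Lemma ImD (x y : C) : Im (x + y) = Im x + Im y. Proof. by case: x y => [? ?] []. Qed.
Lemma ReN (x : C) : Re (- x) = - Re x. Proof. by case: x. Qed.
Lemma ImN (x : C) : Im (- x) = - Im x. Proof. by case: x. Qed.
Lemma ReM (x y : C) : Re (x * y) = Re x * Re y - Im x * Im y.
Proof. by case: x y => [? ?] []. Qed.
Lemma ImM (x y : C) : Im (x * y) = Re x * Im y + Im x * Re y.
Proof. by case: x y => [? ?] []. Qed.
Lemma ReJ (x : C) : Re (x^*%C) = Re x. Proof. by case: x. Qed.
Lemma ImJ (x : C) : Im (x^*%C) = - Im x. Proof. by case: x. Qed.
Lemma Re_sum I (r : seq I) (P : pred I) (F : I -> C) :
  Re (\sum_(i <- r | P i) F i) = \sum_(i <- r | P i) Re (F i).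
Proof. by apply: (big_morph _ ReD). Qed.
Lemma Im_sum I (r : seq I) (P : pred I) (F : I -> C) :
  Im (\sum_(i <- r | P i) F i) = \sum_(i <- r | P i) Im (F i).
Proof. by apply: (big_morph _ ImD). Qed.
Lemma complex_eq (x y : C) : Re x = Re y -> Im x = Im y -> x = y.
Proof. by case: x y => [? ?] [? ?] /= -> ->. Qed.

Section Generic.
Variable V : normedModType R.

Definition isdC (f : V -> C) (x v : V) (l : C) :=
  isdd (fun y => Re (f y)) x v (Re l) /\ isdd (fun y => Im (f y)) x v (Im l).

Definition isdmx a b (F : V -> 'M[C]_(a, b)) (x v : V) (L : 'M[C]_(a, b)) :=
  forall i j, isdC (fun y => F y i j) x v (L i j).

Definition dmx a b (v : V) (F : V -> 'M[C]_(a, b)) (x : V) : 'M[C]_(a, b) :=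
  \matrix_(i, j) (dd v (fun y => Re (F y i j)) x +i* dd v (fun y => Im (F y i j)) x)%C.

Implicit Types (f g : V -> C) (x v : V).

Lemma isdC_eq f x v l l' : isdC f x v l -> l = l' -> isdC f x v l'.
Proof. by move=> ? <-. Qed.

Lemma isdC_cst (c : C) x v : isdC (fun=> c) x v 0.
Proof. by split; apply: isdd_cst. Qed.

Lemma isdCD f g x v l m :
  isdC f x v l -> isdC g x v m -> isdC (fun y => f y + g y) x v (l + m).
Proof.
move=> [fr fi] [gr gi]; split.
  by rewrite ReD; under eq_fun do rewrite ReD; exact: isddD.
by rewrite ImD; under eq_fun do rewrite ImD; exact: isddD.
Qed.

Lemma isdCM f g x v l m : isdC f x v l -> isdC g x v m ->
  isdC (fun y => f y * g y) x v (l * g x + f x * m).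
Proof.
move=> [fr fi] [gr gi]; split.
  under eq_fun do rewrite ReM.
  apply: isdd_eq (isddB (isddM fr gr) (isddM fi gi)) _.
  by rewrite ReD !ReM; ring.
under eq_fun do rewrite ImM.
apply: isdd_eq (isddD (isddM fr gi) (isddM fi gr)) _.
by rewrite ImD !ImM; ring.
Qed.

Lemma isdCJ f x v l : isdC f x v l -> isdC (fun y => (f y)^*%C) x v (l^*)%C.
Proof.
move=> [fr fi]; split; first by rewrite ReJ; under eq_fun do rewrite ReJ.
by rewrite ImJ; under eq_fun do rewrite ImJ; exact: isddN.
Qed.

Lemma isdC_real (f : V -> R) x v l :
  isdd f x v l -> isdC (fun y => (f y)%:C%C) x v (l%:C)%C.
Proof. by move=> H; split => //=; exact: isdd_cst. Qed.

Lemma isdC_sum I (r : seq I) (F : I -> V -> C) x v l :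
  (forall i, isdC (F i) x v (l i)) ->
  isdC (fun y => \sum_(i <- r) F i y) x v (\sum_(i <- r) l i).
Proof.
move=> H; split.
  by rewrite Re_sum; under eq_fun do rewrite Re_sum; apply: isdd_sum => i _; case: (H i).
by rewrite Im_sum; under eq_fun do rewrite Im_sum; apply: isdd_sum => i _; case: (H i).
Qed.

Lemma isdC_near f g x v l :
  (\forall y \near x, f y = g y) -> isdC f x v l -> isdC g x v l.
Proof.
move=> fg [fr fi]; split.
  by apply: isdd_near fr; apply: filterS fg => y ->.
by apply: isdd_near fi; apply: filterS fg => y ->.
Qed.

Lemma isdmx_dmx a b (F : V -> 'M[C]_(a, b)) x v L : isdmx F x v L -> dmx v F x = L.
Proof.
move=> H; apply/matrixP => i j; rewrite mxE.
by have [/isdd_dd -> /isdd_dd ->] := H i j; case: (L i j).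
Qed.

Lemma isdmx_eq a b (F : V -> 'M[C]_(a, b)) x v L L' :
  isdmx F x v L -> L = L' -> isdmx F x v L'.
Proof. by move=> ? <-. Qed.

Lemma isdmx_cst a b (c : 'M[C]_(a, b)) x v : isdmx (fun=> c) x v 0.
Proof. by move=> i j; rewrite mxE; exact: isdC_cst. Qed.

Lemma isdmxD a b (F G : V -> 'M[C]_(a, b)) x v L K : isdmx F x v L -> isdmx G x v K ->
  isdmx (fun y => F y + G y) x v (L + K).
Proof.
move=> HF HG i j; rewrite mxE; under eq_fun do rewrite mxE.
exact: isdCD.
Qed.

Lemma isdmxM a b c (F : V -> 'M[C]_(a, b)) (G : V -> 'M[C]_(b, c)) x v L K :
  isdmx F x v L -> isdmx G x v K ->
  isdmx (fun y => F y *m G y) x v (L *m G x + F x *m K).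
Proof.
move=> HF HG i j; under eq_fun do rewrite mxE.
apply: isdC_eq.
  by apply: isdC_sum => k; exact: (isdCM (HF i k) (HG k j)).
by rewrite big_split !mxE.
Qed.

Lemma isdmx_tr a b (F : V -> 'M[C]_(a, b)) x v L :
  isdmx F x v L -> isdmx (fun y => (F y)^T) x v L^T.
Proof. by move=> H i j; rewrite mxE; under eq_fun do rewrite mxE; exact: H. Qed.

Lemma isdmxJ a b (F : V -> 'M[C]_(a, b)) x v L :
  isdmx F x v L -> isdmx (fun y => mxconj (F y)) x v (mxconj L).
Proof. by move=> H i j; rewrite mxE; under eq_fun do rewrite mxE; exact: isdCJ. Qed.

Lemma isdmxZ a b (F : V -> 'M[C]_(a, b)) c x v L :
  isdmx F x v L -> isdmx (fun y => c *: F y) x v (c *: L).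
Proof.
move=> H i j; rewrite mxE; under eq_fun do rewrite mxE.
apply: isdC_eq; first exact: (isdCM (isdC_cst c _ _) (H i j)).
by rewrite mul0r add0r.
Qed.

Lemma isdmxN a b (F : V -> 'M[C]_(a, b)) x v L :
  isdmx F x v L -> isdmx (fun y => - F y) x v (- L).
Proof.
move=> H; have -> : (fun y => - F y) = (fun y => -1 *: F y).
  by apply/funext => y; rewrite scaleN1r.
by rewrite -(scaleN1r L); exact: isdmxZ.
Qed.

Lemma isdmxB a b (F G : V -> 'M[C]_(a, b)) x v L K : isdmx F x v L -> isdmx G x v K ->
  isdmx (fun y => F y - G y) x v (L - K).
Proof. by move=> HF HG; apply: isdmxD => //; exact: isdmxN. Qed.

Lemma isdmx_near a b (F G : V -> 'M[C]_(a, b)) x v L :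
  (\forall y \near x, F y = G y) -> isdmx F x v L -> isdmx G x v L.
Proof.
by move=> FG H i j; apply: isdC_near (H i j); apply: filterS FG => y ->.
Qed.

Lemma dmx_near a b (F G : V -> 'M[C]_(a, b)) x v :
  (\forall y \near x, F y = G y) -> dmx v F x = dmx v G x.
Proof.
move=> FG; apply/matrixP => i j; rewrite !mxE.
by congr (_ +i* _)%C; apply: dd_near; apply: filterS FG => y ->.
Qed.

End Generic.

Section Coordinates.
Variable N : nat.
Local Notation E := 'rV[R]_N.

Definition smx a b (F : E -> 'M[C]_(a, b)) (A : set E) :=
  forall i j, sm (fun y => Re (F y i j)) A /\ sm (fun y => Im (F y i j)) A.

(** A complex direction has no difference quotient, so the derivative is extended complex-linearly
    from the coordinate basis. *)
Definition dV a b (W : 'rV[C]_N) (F : E -> 'M[C]_(a, b)) (x : E) : 'M[C]_(a, b) :=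
  \sum_k W 0 k *: dmx (ebase R k) F x.

Variable A : set E.
Hypothesis oA : open A.

Lemma smx_isdmx a b (F : E -> 'M[C]_(a, b)) x v :
  smx F A -> A x -> isdmx F x v (dmx v F x).
Proof.
move=> H Ax i j; rewrite mxE; have [Hr Hi] := H i j.
by split; apply: dableP; [exact: sm_dable Hr _|exact: sm_dable Hi _].
Qed.

Lemma smx_cst a b (c : 'M[C]_(a, b)) : smx (fun=> c) A.
Proof. by move=> i j; split; exact: sm_cst. Qed.

Lemma smxD a b (F G : E -> 'M[C]_(a, b)) :
  smx F A -> smx G A -> smx (fun y => F y + G y) A.
Proof.
move=> HF HG i j; have [? ?] := HF i j; have [? ?] := HG i j.
by split; under eq_fun do rewrite mxE ?ReD ?ImD; exact: smD.
Qed.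

Lemma smxM a b c (F : E -> 'M[C]_(a, b)) (G : E -> 'M[C]_(b, c)) :
  smx F A -> smx G A -> smx (fun y => F y *m G y) A.
Proof.
move=> HF HG i j; split; under eq_fun do rewrite mxE ?Re_sum ?Im_sum;
  apply: sm_sum => // k; have [? ?] := HF i k; have [? ?] := HG k j;
  under eq_fun do rewrite ?ReM ?ImM; [apply: smB|apply: smD] => //; exact: smM.
Qed.

Lemma smx_tr a b (F : E -> 'M[C]_(a, b)) : smx F A -> smx (fun y => (F y)^T) A.
Proof. by move=> H i j; split; under eq_fun do rewrite mxE; case: (H j i). Qed.

Lemma smxJ a b (F : E -> 'M[C]_(a, b)) : smx F A -> smx (fun y => mxconj (F y)) A.
Proof.
move=> H i j; have [? ?] := H i j.
by split; under eq_fun do rewrite mxE ?ReJ ?ImJ; last exact: smN.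
Qed.

Lemma smxZ a b (F : E -> 'M[C]_(a, b)) c : smx F A -> smx (fun y => c *: F y) A.
Proof.
move=> H i j; have [? ?] := H i j.
split; under eq_fun do rewrite mxE ?ReM ?ImM; [apply: smB|apply: smD] => //;
 by apply: smM => //; exact: sm_cst.
Qed.

Lemma smxC a b (F : E -> 'M[R]_(a, b)) :
  (forall i j, sm (fun y => F y i j) A) -> smx (fun y => mxC (F y)) A.
Proof.
move=> H i j; split; under eq_fun do rewrite mxE /=; [exact: H|exact: sm_cst].
Qed.

Lemma smx_row a b (F : E -> 'M[C]_(a, b)) i : smx F A -> smx (fun y => row i (F y)) A.
Proof. by move=> H k j; split; under eq_fun do rewrite mxE; case: (H i j). Qed.

Lemma smx_col a b (F : E -> 'M[C]_(a, b)) j : smx F A -> smx (fun y => col j (F y)) A.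
Proof. by move=> H k i; split; under eq_fun do rewrite mxE; case: (H k j). Qed.

Lemma smx_dmx a b (F : E -> 'M[C]_(a, b)) v : smx F A -> smx (dmx v F) A.
Proof.
move=> H i j; have [? ?] := H i j.
by split; under eq_fun do rewrite mxE /=; exact: sm_dd.
Qed.

Lemma smx_eq a b (F G : E -> 'M[C]_(a, b)) :
  (forall x, A x -> F x = G x) -> smx F A -> smx G A.
Proof.
move=> FG H i j; have [Hr Hi] := H i j.
by split; [apply: sm_eq Hr|apply: sm_eq Hi] => // x /FG ->.
Qed.

Lemma dVM a b c (F : E -> 'M[C]_(a, b)) (G : E -> 'M[C]_(b, c)) W x :
  smx F A -> smx G A -> A x ->
  dV W (fun y => F y *m G y) x = dV W F x *m G x + F x *m dV W G x.
Proof.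
move=> HF HG Ax; rewrite /dV mulmx_suml mulmx_sumr -big_split; apply: eq_bigr => k _.
rewrite (isdmx_dmx (isdmxM (smx_isdmx _ HF Ax) (smx_isdmx _ HG Ax))).
by rewrite scalerDr -scalemxAl -scalemxAr.
Qed.

Lemma dV_tr a b (F : E -> 'M[C]_(a, b)) W x : smx F A -> A x ->
  dV W (fun y => (F y)^T) x = (dV W F x)^T.
Proof.
move=> HF Ax; rewrite /dV linear_sum; apply: eq_bigr => k _.
by rewrite (isdmx_dmx (isdmx_tr (smx_isdmx _ HF Ax))) linearZ.
Qed.

Lemma mxconjZ a b (c : C) (F : 'M[C]_(a, b)) : mxconj (c *: F) = (c^*)%C *: mxconj F.
Proof. by apply/matrixP => i j; rewrite !mxE rmorphM. Qed.

Lemma mxconj_sum a b I (r : seq I) (F : I -> 'M[C]_(a, b)) :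
  mxconj (\sum_(i <- r) F i) = \sum_(i <- r) mxconj (F i).
Proof.
apply: (big_morph (@mxconj R a b)); last by apply/matrixP => i j; rewrite !mxE conjc0.
by move=> X Y; apply/matrixP => i j; rewrite !mxE rmorphD.
Qed.

Lemma dVJ a b (F : E -> 'M[C]_(a, b)) W x : smx F A -> A x ->
  dV (mxconj W) (fun y => mxconj (F y)) x = mxconj (dV W F x).
Proof.
move=> HF Ax; rewrite /dV mxconj_sum; apply: eq_bigr => k _.
by rewrite (isdmx_dmx (isdmxJ (smx_isdmx _ HF Ax))) mxconjZ mxE.
Qed.

Lemma dVZ a b (F : E -> 'M[C]_(a, b)) c W x : smx F A -> A x ->
  dV W (fun y => c *: F y) x = c *: dV W F x.
Proof.
move=> HF Ax; rewrite /dV scaler_sumr; apply: eq_bigr => k _.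
by rewrite (isdmx_dmx (isdmxZ c (smx_isdmx _ HF Ax))) !scalerA mulrC.
Qed.

Lemma dV_add a b (F G : E -> 'M[C]_(a, b)) W x : smx F A -> smx G A -> A x ->
  dV W (fun y => F y + G y) x = dV W F x + dV W G x.
Proof.
move=> HF HG Ax; rewrite /dV -big_split; apply: eq_bigr => k _.
by rewrite (isdmx_dmx (isdmxD (smx_isdmx _ HF Ax) (smx_isdmx _ HG Ax))) scalerDr.
Qed.

Lemma dV_near a b (F G : E -> 'M[C]_(a, b)) W x :
  (\forall y \near x, F y = G y) -> dV W F x = dV W G x.
Proof. by move=> FG; apply: eq_bigr => k _; rewrite (dmx_near _ FG). Qed.

Lemma dV_eq a b (F G : E -> 'M[C]_(a, b)) W x : A x ->
  (forall y, A y -> F y = G y) -> dV W F x = dV W G x.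
Proof.
by move=> Ax FG; apply: dV_near; apply: filterS (open_nbhs_nbhs (conj oA Ax)).
Qed.

Lemma dV_cst a b (c : 'M[C]_(a, b)) W x : dV W (fun=> c) x = 0.
Proof.
by rewrite /dV big1 // => k _; rewrite (isdmx_dmx (isdmx_cst _ _ _)) scaler0.
Qed.

Lemma dmx_comm a b (F : E -> 'M[C]_(a, b)) (u v : E) x : smx F A -> A x ->
  dmx u (dmx v F) x = dmx v (dmx u F) x.
Proof.
move=> HF Ax; apply/matrixP => i j; rewrite !mxE.
have [Hr Hi] := HF i j.
have H (w z : E) : dd w (fun y => Re ((dmx z F) y i j)) x =
  dd w (dd z (fun y => Re (F y i j))) x.
  by congr (dd _ _ _); apply/funext => y; rewrite mxE.
have H' (w z : E) : dd w (fun y => Im ((dmx z F) y i j)) x =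
  dd w (dd z (fun y => Im (F y i j))) x.
  by congr (dd _ _ _); apply/funext => y; rewrite mxE.
rewrite !H !H'.
by congr (_ +i* _)%C; exact: (Schwarz_sm _ _ oA).
Qed.

End Coordinates.
End ComplexCalculus.

(** * Exterior derivative, Lie bracket and Cartan's formula in coordinates *)

Section Exterior.
Variables (R : realType) (N : nat).
Local Notation C := R[i].
Local Notation E := 'rV[R]_N.
Implicit Types (theta eta : E -> 'cV[C]_N) (X Y : E -> 'rV[C]_N).

(** The matrix of [d theta], indexed so that [bform V (extm theta x) W] is [d theta (V, W)] with the
    normalization of [extd]. *)
Definition extm theta (x : E) : 'M[C]_N :=
  \matrix_(k, l) (dmx (ebase R k) theta x l 0 - dmx (ebase R l) theta x k 0).

Definition bform (V : 'rV[C]_N) (M : 'M[C]_N) (W : 'rV[C]_N) : C :=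
  (V *m M *m W^T) 0 0.

Definition lieb X Y (x : E) : 'rV[C]_N := dV (X x) Y x - dV (Y x) X x.

Lemma bformDl V V' M W : bform (V + V') M W = bform V M W + bform V' M W.
Proof. by rewrite /bform !mulmxDl mxE. Qed.
Lemma bformNl V M W : bform (- V) M W = - bform V M W.
Proof. by rewrite /bform !mulNmx mxE. Qed.
Lemma bformZl c V M W : bform (c *: V) M W = c * bform V M W.
Proof. by rewrite /bform -!scalemxAl mxE. Qed.
Lemma bformBl V V' M W : bform (V - V') M W = bform V M W - bform V' M W.
Proof. by rewrite bformDl bformNl. Qed.
Lemma bformDr V M W W' : bform V M (W + W') = bform V M W + bform V M W'.
Proof. by rewrite /bform linearD mulmxDr mxE. Qed.
Lemma bformNr V M W : bform V M (- W) = - bform V M W.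
Proof. by rewrite /bform linearN mulmxN mxE. Qed.
Lemma bformBr V M W W' : bform V M (W - W') = bform V M W - bform V M W'.
Proof. by rewrite bformDr bformNr. Qed.
Lemma bformZr c V M W : bform V M (c *: W) = c * bform V M W.
Proof. by rewrite /bform linearZ -scalemxAr mxE. Qed.
Lemma bform_suml I (r : seq I) (F : I -> 'rV[C]_N) M W :
  bform (\sum_(i <- r) F i) M W = \sum_(i <- r) bform (F i) M W.
Proof. by rewrite /bform !mulmx_suml summxE. Qed.
Lemma bform_anti V M W : M^T = - M -> bform V M W = - bform W M V.
Proof.
move=> HM; rewrite /bform.
have -> : V *m M *m W^T = (W *m M^T *m V^T)^T by rewrite !trmx_mul !trmxK mulmxA.
by rewrite HM mulmxN mulNmx !mxE.
Qed.

Lemma evB V W (e : 'cV[C]_N) : ev (V - W) e = ev V e - ev W e.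
Proof. by rewrite /ev mulmxBl !mxE. Qed.
Lemma evZ c V (e : 'cV[C]_N) : ev (c *: V) e = c * ev V e.
Proof. by rewrite /ev -scalemxAl mxE. Qed.

Lemma extm_tr theta x : (extm theta x)^T = - extm theta x.
Proof. by apply/matrixP => k l; rewrite !mxE opprB. Qed.

Lemma bform_extm V W theta x :
  bform V (extm theta x) W = ev W (dV V theta x) - ev V (dV W theta x).
Proof.
have H A B : ev B (dV A theta x) = \sum_k \sum_l A 0 k * B 0 l * dmx (ebase R k) theta x l 0.
  rewrite /ev mulmx_sumr summxE; apply: eq_bigr => k _.
  rewrite mxE; apply: eq_bigr => l _; rewrite mxE; ring.
rewrite !H /bform -mulmxA mxE.
rewrite [in X in _ = _ - X]exchange_big -sumrB; apply: eq_bigr => k _.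
rewrite mxE mulr_sumr -sumrB; apply: eq_bigr => l _.
by rewrite !mxE; ring.
Qed.

Variable A : set E.
Hypothesis oA : open A.

Lemma smx_extm theta : smx theta A -> smx (extm theta) A.
Proof.
move=> H i j; have [Hr Hi] := smx_dmx (ebase R i) H j 0.
have [Kr Ki] := smx_dmx (ebase R j) H i 0.
by split; under eq_fun do rewrite mxE ?(ReD, ImD) ?(ReN, ImN); exact: smB.
Qed.

Lemma dV_ev V X eta x : smx X A -> smx eta A -> A x ->
  dV V (fun y => X y *m eta y) x 0 0 = ev (dV V X x) (eta x) + ev (X x) (dV V eta x).
Proof. by move=> HX He Ax; rewrite (@dVM _ _ A) // mxE. Qed.

(** The product rule splits [X (eta Y)] into a derivative of [Y] and one of [eta]; antisymmetrizing,
    the former give the bracket and the latter [d eta]. *)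
Lemma Cartan X Y eta x : smx X A -> smx Y A -> smx eta A -> A x ->
  ev (lieb X Y x) (eta x) = dV (X x) (fun y => Y y *m eta y) x 0 0 -
    dV (Y x) (fun y => X y *m eta y) x 0 0 - bform (X x) (extm eta x) (Y x).
Proof.
move=> HX HY He Ax; rewrite !dV_ev // bform_extm /lieb evB; ring.
Qed.

Lemma dV_sum a b I (r : seq I) (F : I -> E -> 'M[C]_(a, b)) W x :
  (forall i, smx (F i) A) -> A x ->
  dV W (fun y => \sum_(i <- r) F i y) x = \sum_(i <- r) dV W (F i) x.
Proof.
move=> H Ax; elim: r => [|i r IH].
  by rewrite big_nil; under eq_fun do rewrite big_nil; exact: dV_cst.
rewrite big_cons; under eq_fun do rewrite big_cons.
rewrite (@dV_add _ _ A) ?IH //.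
elim: r {IH} => [|j r IH]; first by under eq_fun do rewrite big_nil; exact: smx_cst.
by under eq_fun do rewrite big_cons; exact: smxD.
Qed.

Lemma dV_comm a b (F : E -> 'M[C]_(a, b)) U V x : smx F A -> A x ->
  dV U (dV V F) x = dV V (dV U F) x.
Proof.
move=> HF Ax.
have H W W' : dV W (dV W' F) x =
    \sum_l \sum_k W' 0 l *: (W 0 k *: dmx (ebase R k) (dmx (ebase R l) F) x).
  rewrite dV_sum //; last by move=> i; apply: smxZ => //; exact: smx_dmx.
  apply: eq_bigr => l _; rewrite (@dVZ _ _ A) //; last exact: smx_dmx.
  by rewrite /dV scaler_sumr.
rewrite !H exchange_big; apply: eq_bigr => k _; apply: eq_bigr => l _.
by rewrite (dmx_comm oA _ _ HF Ax) !scalerA mulrC.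
Qed.

Lemma smx_dV a b (F : E -> 'M[C]_(a, b)) W : smx F A -> smx (dV W F) A.
Proof.
move=> H i j; split; under eq_fun do rewrite /dV summxE ?Re_sum ?Im_sum;
 apply: (sm_sum _ oA) => k; have [? ?] := smxZ oA (W 0 k) (smx_dmx (ebase R k) H) i j; done.
Qed.

Lemma dV_bform U V W (M : E -> 'M[C]_N) x : smx M A -> A x ->
  bform V (dV U M x) W = dV U (fun y => (bform V (M y) W)%:M : 'M[C]_1) x 0 0.
Proof.
move=> HM Ax.
have -> : (fun y => (bform V (M y) W)%:M : 'M[C]_1) = (fun y => V *m M y *m W^T).
  by apply/funext => y; rewrite [RHS]mx11_scalar.
rewrite (@dVM _ _ A) ?dV_cst ?mulmx0 ?addr0 //; last 2 first.
- by apply: smxM => //; exact: smx_cst.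
- exact: smx_cst.
rewrite (@dVM _ _ A) // ?dV_cst ?mul0mx ?add0r //; exact: smx_cst.
Qed.

(** This is [d (d theta) = 0] on constant fields: six second derivatives of [theta] cancel in pairs
    by Schwarz. *)
Lemma extm_closed U V W theta x : smx theta A -> A x ->
  bform V (dV U (extm theta) x) W + bform W (dV V (extm theta) x) U +
  bform U (dV W (extm theta) x) V = 0.
Proof.
move=> Ht Ax.
have H P Q S : bform Q (dV P (extm theta) x) S =
    ev S (dV P (dV Q theta) x) - ev Q (dV P (dV S theta) x).
  rewrite dV_bform //; last exact: smx_extm.
  have -> : (fun y => (bform Q (extm theta y) S)%:M : 'M[C]_1) =
      (fun y => S *m dV Q theta y + (- Q) *m dV S theta y).
    apply/funext => y; rewrite bform_extm [RHS]mx11_scalar; congr (_%:M).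
    by rewrite mulNmx mxE [X in _ = _ + X]mxE.
  rewrite (@dV_add _ _ A) ?(@dVM _ _ A) ?dV_cst ?mul0mx ?add0r ?mulNmx // ?[LHS]mxE;
    try by [exact: smx_cst|exact: smx_dV|apply: smxM => //; [exact: smx_cst|exact: smx_dV]].
  by rewrite [X in _ + X]mxE.
rewrite !H (dV_comm W U) // (dV_comm W V) // (dV_comm V U) //; ring.
Qed.

(* [L_X (d theta) = d (L_X theta)] vanishes on [H x H] because [L_X theta] is a
   multiple of [theta]. *)
Lemma contact_lie_symmetric theta eta X a b x :
  smx theta A -> smx eta A -> smx X A -> smx a A -> smx b A -> A x ->
  (forall y, A y -> ev (a y) (theta y) = 0) ->
  (forall y, A y -> ev (b y) (theta y) = 0) ->
  (forall y, A y -> bform (a y) (extm theta y) (b y) = 0) ->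
  (forall y V, A y -> ev V (theta y) = 0 ->
     bform (X y) (extm theta y) V = - ev V (eta y)) ->
  extm eta x = 0 ->
  bform (lieb X a x) (extm theta x) (b x) = bform (lieb X b x) (extm theta x) (a x).
Proof.
move=> Ht He HX Ha Hb Ax Ka Kb Kab KX Ee.
have dz (F : E -> 'M[C]_1) W : (forall y, A y -> F y = 0) -> dV W F x = 0.
  by move=> F0; rewrite (dV_eq oA W Ax F0) dV_cst.
have scal (M : 'M[C]_1) : M 0 0 = 0 -> M = 0 by move=> H; rewrite [M]mx11_scalar H raddf0.
have L3 (U V W : E -> 'rV[C]_N) : smx U A -> smx V A -> smx W A ->
   dV (W x) (fun y => U y *m extm theta y *m (V y)^T) x 0 0 =
     bform (dV (W x) U x) (extm theta x) (V x) +
     bform (U x) (dV (W x) (extm theta) x) (V x) +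
     bform (U x) (extm theta x) (dV (W x) V x).
  move=> HU HV HW; have Hext := smx_extm Ht.
  rewrite (@dVM _ _ A) ?(@dVM _ _ A) ?(@dV_tr _ _ A) //; last 2 first.
  - exact: smxM.
  - exact: smx_tr.
  by rewrite mulmxDl /bform !mxE.
(* [e1], [e2], [e3] are the product rule for [X (d theta (a, b))], [a (d theta (X, b))] and
   [b (d theta (X, a))]. The first derivative vanishes by isotropy and the other two are given by
   the Hamiltonian equation. *)
have e1 := L3 a b X Ha Hb HX.
rewrite dz ?mxE in e1; last by move=> y Ay; apply: scal; exact: Kab.
have cg U V : smx U A -> smx V A -> (forall y, A y -> ev (V y) (theta y) = 0) ->
   dV (U x) (fun y => X y *m extm theta y *m (V y)^T) x 0 0 =
   - dV (U x) (fun y => V y *m eta y) x 0 0.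
  move=> HU HV KV.
  rewrite (@dV_eq _ _ _ oA _ _ _ (fun y => -1 *: (V y *m eta y)) _ _ Ax); last first.
    move=> y Ay; rewrite [LHS]mx11_scalar [RHS]mx11_scalar; congr (_%:M).
    by have := KX y (V y) Ay (KV y Ay); rewrite /bform => ->; rewrite mxE mulN1r.
  by rewrite (@dVZ _ _ A) ?scaleN1r ?mxE //; exact: smxM.
have e2 := L3 X b a HX Hb Ha; rewrite cg // in e2.
have e3 := L3 X a b HX Ha Hb; rewrite cg // in e3.
have e4 := Cartan Ha Hb He Ax; rewrite Ee in e4.
have e4' : bform (a x) 0 (b x) = 0 by rewrite /bform mulmx0 mul0mx mxE.
(* Since [d theta (a, b) = 0], the bracket [[a, b]] stays in the kernel of [theta], so the
   Hamiltonian equation may be applied to it. *)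
have lab : ev (lieb a b x) (theta x) = 0.
  rewrite Cartan // Kab // !dz ?mxE ?subrr //.
    by move=> y Ay; apply: scal; exact: Ka.
  by move=> y Ay; apply: scal; exact: Kb.
have e5 := KX x _ Ax lab.
have e6 := extm_closed (X x) (a x) (b x) Ht Ax.
have anti (U V W : 'rV[C]_N) :
    bform U (dV W (extm theta) x) V = - bform V (dV W (extm theta) x) U.
  apply: bform_anti; rewrite -(@dV_tr _ _ A) //; last exact: smx_extm.
  under eq_fun do rewrite extm_tr -scaleN1r.
  by rewrite (@dVZ _ _ A) ?scaleN1r //; exact: smx_extm.
rewrite (anti (b x) (X x)) in e6.
rewrite /lieb bformBr in e5.
rewrite /lieb !bformBl.
rewrite (bform_anti (dV (X x) b x) (a x) (extm_tr theta x)).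
apply/eqP; rewrite -subr_eq0; apply/eqP.
rewrite e4' in e4; rewrite /lieb in e4.
rewrite /lieb e4 in e5.
move: e1 e2 e3 e5 e6 => {}e1 {}e2 {}e3 {}e5 {}e6.
set p1 := bform (dV (X x) a x) _ _ in e1 *.
set p2 := bform (dV (a x) X x) _ _ in e2 *.
set p3 := bform (a x) _ (dV (X x) b x) in e1 *.
set p4 := bform (dV (b x) X x) _ _ in e3 *.
set q1 := bform (a x) (dV (X x) _ x) _ in e1 e6 *.
set q2 := bform (X x) (dV (a x) _ x) _ in e2 e6 *.
set q3 := bform (X x) (dV (b x) _ x) _ in e3 e6 *.
set r1 := bform (X x) _ (dV (a x) b x) in e2 e5 *.
set r2 := bform (X x) _ (dV (b x) a x) in e3 e5 *.
set s1 := dV (a x) _ x 0 0 in e2 e5 *.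
set s2 := dV (b x) _ x 0 0 in e3 e5 *.
have -> : p1 - p2 - (- p3 - p4) = (p1 + q1 + p3) - (p2 + q2 + r1) + (p4 + q3 + r2)
    - (q1 - q2 + q3) + (r1 - r2) by ring.
rewrite -e1 -e2 -e3 e6 e5; ring.
Qed.

End Exterior.

(** * Charts and coordinate representatives *)

Section VectorValued.
Variables (R : realType) (V : normedModType R).

Lemma dd_mx n (f : V -> 'rV[R]_n) x v j : derivable f x v ->
  ('D_v f x) 0 j = dd v (fun y => f y 0 j) x.
Proof. by move=> df; rewrite (derive_mx df) mxE dd.unlock. Qed.

Lemma derivable_dable n (f : V -> 'rV[R]_n) x v j : derivable f x v ->
  dable (fun y => f y 0 j) x v.
Proof. by rewrite dable.unlock => /derivable_mxP. Qed.

Lemma dable_derivable n (f : V -> 'rV[R]_n) x v :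
  (forall j, dable (fun y => f y 0 j) x v) -> derivable f x v.
Proof.
move=> H; apply/derivable_mxP => i j; have := H j.
by rewrite dable.unlock (ord1 i).
Qed.

Lemma Ck_coord k n (f : V -> 'rV[R]_n) (A B : set V) j : open B -> B `<=` A ->
  Ck k f A -> smk k (fun y => f y 0 j) B.
Proof.
move=> oB BA; elim: k f => [|k IH] f [cf Hf].
  split=> // x Bx; apply: (@continuous_comp _ _ _ f (fun M : 'rV[R]_n => M 0 j)).
    exact/cf/BA.
  exact: coord_continuous.
split=> [x Bx|v].
  apply: (@continuous_comp _ _ _ f (fun M : 'rV[R]_n => M 0 j)).
    exact/cf/BA.
  exact: coord_continuous.
have [D S] := Hf v; split=> [x Bx|]; first exact/derivable_dable/D/BA.
by apply: smk_eq (IH _ S) => // x Bx; rewrite dd_mx //; exact/D/BA.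
Qed.

Lemma Cinfty_coord n (f : V -> 'rV[R]_n) (A B : set V) j : open B -> B `<=` A ->
  Cinfty f A -> sm (fun y => f y 0 j) B.
Proof. by move=> oB BA H k; exact: Ck_coord (H k). Qed.

End VectorValued.

Lemma open_near (T : topologicalType) (A : set T) (P : T -> Prop) x :
  open A -> A x -> (forall y, A y -> P y) -> \forall y \near x, P y.
Proof. by move=> oA Ax H; apply: filterS H _; exact: open_nbhs_nbhs. Qed.

Definition transition (R : realType) m (M : topologicalType)
    (S : smooth_atlas R m M) (p q : M) : 'rV[R]_m.+1 -> 'rV[R]_m.+1 :=
  chart S q \o chart_inv S p.

(** Indexed by a point of [M] rather than by its coordinates, so that the chain rule [Jac_comp]
    multiplies Jacobians taken at one and the same [s]. *)
HB.lock Definition Jacobian (R : realType) m (M : topologicalType)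
    (S : smooth_atlas R m M) (p q s : M) : 'M[R]_m.+1 :=
  lin1_mx (fun v => 'D_v (transition S p q) (chart S p s)).

Section Charts.
Variables (R : realType) (m : nat) (M : topologicalType) (S : smooth_atlas R m M).
Local Notation N := m.+1.
Local Notation E := 'rV[R]_N.
Implicit Types (p q s : M) (U : set M).
Local Notation tau := (transition S).
Local Notation Jac := (Jacobian S).

(* The part of the image of the chart of index [p] that represents [U]. *)
Definition cdom p U : set E := chart S p @` (dom S p `&` U).

Lemma cdomP p U x : cdom p U x ->
  [/\ dom S p (chart_inv S p x), U (chart_inv S p x) & chart S p (chart_inv S p x) = x].
Proof. by case=> q [dq Uq] <-; rewrite chartK. Qed.

Lemma cdom_chart p q U : dom S p q -> U q -> cdom p U (chart S p q).
Proof. by move=> dq Uq; exists q. Qed.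

Lemma cdom_open p U : open U -> open (cdom p U).
Proof.
move=> oU; rewrite openE => x cx; have [dx Ux ex] := cdomP cx.
have ix : (chart S p @` dom S p) x by exists (chart_inv S p x).
have n1 : nbhs x (chart S p @` dom S p).
  by apply: open_nbhs_nbhs; split; [exact: chart_image_open|].
have n2 : nbhs x (chart_inv S p @^-1` U).
  by apply: (chart_inv_continuous ix); apply: open_nbhs_nbhs.
apply: filterS (filterI n1 n2) => y [[q dq <-]] /=.
by rewrite chartK // => Uq; exists q.
Qed.

Lemma cdom_sub p U U' : U `<=` U' -> cdom p U `<=` cdom p U'.
Proof. by move=> UU' x [q [dq Uq] <-]; exists q => //; split=> //; exact: UU'. Qed.

Lemma sm_tau p q j : sm (fun x => tau p q x 0 j) (cdom p (dom S q)).
Proof.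
apply: Cinfty_coord (chart_transition S p q) => //.
exact/cdom_open/dom_open.
Qed.

Lemma tau_comp a b c x : cdom a (dom S b) x -> tau b c (tau a b x) = tau a c x.
Proof. by move=> /cdomP[_ db _]; rewrite /transition /= chartK. Qed.

Lemma cdom_tau a b U x : cdom a (dom S b `&` U) x -> cdom b U (tau a b x).
Proof. by move=> /cdomP[_ [db Ux] _]; exists (chart_inv S a x). Qed.

Lemma derivable_tau p q s v : dom S p s -> dom S q s ->
  derivable (tau p q) (chart S p s) v.
Proof.
move=> dp dq; apply: dable_derivable => j.
exact: sm_dable (@sm_tau p q j) (cdom_chart dp dq).
Qed.

Lemma JacE p q s k j : dom S p s -> dom S q s ->
  Jac p q s k j = dd (ebase R k) (fun x => tau p q x 0 j) (chart S p s).
Proof. by move=> dp dq; rewrite Jacobian.unlock mxE dd_mx //; exact: derivable_tau. Qed.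

Lemma mul_Jac p q s v j : dom S p s -> dom S q s ->
  (v *m Jac p q s) 0 j = dd v (fun x => tau p q x 0 j) (chart S p s).
Proof.
move=> dp dq.
rewrite (dd_sum v (cdom_open (dom_open S q)) (@sm_tau p q j) (cdom_chart dp dq)) mxE.
by apply: eq_bigr => k _; rewrite JacE.
Qed.

Lemma Jac_comp a b c s : dom S a s -> dom S b s -> dom S c s ->
  Jac a b s *m Jac b c s = Jac a c s.
Proof.
move=> da db dc; apply/matrixP => k j; rewrite JacE // mxE.
have oU : open (cdom a (dom S b `&` dom S c)).
  by apply/cdom_open/openI; exact: dom_open.
have Ux : cdom a (dom S b `&` dom S c) (chart S a s) by exact: cdom_chart.
have ts : tau a b (chart S a s) = chart S b s by rewrite /transition /= chartK.
apply/esym/isdd_dd.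
apply: (@isdd_near _ _ (fun x => tau b c (tau a b x) 0 j)).
  apply: (open_near oU Ux) => y Uy.
  by rewrite tau_comp //; apply: cdom_sub Uy => ? [].
apply: isdd_eq.
  apply: (@isdd_comp_sm _ _ _ (fun y => tau b c y 0 j) (tau a b) (cdom b (dom S c)) _ _
      (\row_l Jac a b s k l)); first exact/cdom_open/dom_open.
  - exact: sm_tau.
  - by rewrite ts; exact: cdom_chart.
  - move=> l; rewrite mxE JacE //; apply: dableP.
    exact: sm_dable (@sm_tau a b l) (cdom_chart da db).
by apply: eq_bigr => l _; rewrite mxE ts (JacE _ _ db dc).
Qed.

Lemma Jac_id p s : dom S p s -> Jac p p s = 1%:M.
Proof.
move=> dp; apply/matrixP => k j; rewrite JacE // mxE.
apply: isdd_dd; apply: (@isdd_near _ _ (fun y : E => y 0 j)).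
  apply: (open_near (cdom_open (dom_open S p)) (cdom_chart dp dp)).
  by move=> y /cdomP[_ _ yy]; rewrite /transition /= yy.
apply: isdd_eq; first exact: isdd_coord.
by rewrite mxE eqxx /= eq_sym.
Qed.

(* At [q], [tc p q] maps intrinsic components of vectors (those of the chart of
   index [q]) to components in the chart of index [p], and [fc p q] is its inverse. *)
Definition tc p q : 'M[R]_N := Jac q p q.
Definition fc p q : 'M[R]_N := Jac p q q.

Lemma from_chartE p q : from_chart S p q = fc p q.
Proof. by rewrite /fc Jacobian.unlock. Qed.

Lemma fc_tc p q : dom S p q -> fc p q *m tc p q = 1%:M.
Proof.
by move=> dp; rewrite /fc Jac_comp ?Jac_id //; exact: dom_self.
Qed.

Lemma tc_fc p q : dom S p q -> tc p q *m fc p q = 1%:M.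
Proof.
by move=> dp; rewrite /fc Jac_comp ?Jac_id //; exact: dom_self.
Qed.

Lemma tc_id p : tc p p = 1%:M. Proof. by apply: Jac_id; exact: dom_self. Qed.
Lemma fc_id p : fc p p = 1%:M. Proof. by apply: Jac_id; exact: dom_self. Qed.

Definition formloc p (eta : M -> 'cV[R]_N) (x : E) : 'cV[R]_N :=
  fc p (chart_inv S p x) *m eta (chart_inv S p x).
Definition fieldloc p (X : M -> 'rV[R]_N) (x : E) : 'rV[R]_N :=
  X (chart_inv S p x) *m tc p (chart_inv S p x).

Lemma cdomI p U : cdom p (U `&` dom S p) = cdom p U.
Proof.
apply/seteqP; split; first by apply: cdom_sub => ? [].
by move=> x [q [dq Uq] <-]; exists q.
Qed.

Lemma sm_formloc U eta p i : smooth_form S U eta ->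
  sm (fun x => formloc p eta x i 0) (cdom p U).
Proof.
move=> /(_ p (ebase R i) p) /CinftyE; rewrite -/(cdom p _) cdomI.
congr (sm _ _); apply/funext => x /=.
by rewrite from_chartE /ev -mulmxA /ebase -rowE mxE.
Qed.

Lemma dirE q v (g : M -> R) : dir S q v g = dd v (g \o chart_inv S q) (chart S q q).
Proof. by rewrite dd.unlock. Qed.

Lemma dir_chart p q v j : dom S p q ->
  dir S q v (fun r => chart S p r 0 j) = (v *m tc p q) 0 j.
Proof.
by move=> dp; rewrite /tc mul_Jac ?/dir ?dd.unlock //; exact: dom_self.
Qed.

Lemma sm_fieldloc U X p j : open U -> smooth_field S U X ->
  sm (fun x => fieldloc p X x 0 j) (cdom p U).
Proof.
move=> oU /(_ p j p) /CinftyE; rewrite -/(cdom p _) cdomI => H.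
apply: sm_eq H; first exact: cdom_open.
by move=> x /cdomP[dx Ux ex] /=; rewrite dir_chart.
Qed.

(** [smooth_field] quantifies over all charts. Over a set contained in one chart domain, the
    components in another chart are those in the chart of [p] times the Jacobian of a smooth
    transition. *)
Lemma smooth_field_loc U X p : open U -> U `<=` dom S p ->
  (forall j, sm (fun x => fieldloc p X x 0 j) (cdom p U)) -> smooth_field S U X.
Proof.
move=> oU Up H p' j p''; apply/CinftyE; rewrite -/(cdom p'' _).
have oW : open (U `&` dom S p') by apply: openI => //; exact: dom_open.
apply: (@sm_eq _ _ (fun x => \sum_k fieldloc p X (tau p'' p x) 0 k *
    dd (ebase R k) (fun y => tau p p' y 0 j) (tau p'' p x))).
- exact: cdom_open.
- move=> x /cdomP[dx [Ux dx'] ex] /=.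
  rewrite dir_chart //; set q := chart_inv S p'' x in dx Ux dx' ex *.
  have dp := Up _ Ux.
  rewrite /tc -(@Jac_comp q p p') //; last exact: dom_self.
  rewrite mulmxA mxE; apply: eq_bigr => k _.
  by rewrite JacE // /fieldloc /transition /= chartK.
pose h y := \sum_k fieldloc p X y 0 k * dd (ebase R k) (fun y => tau p p' y 0 j) y.
apply: (@sm_comp _ _ _ h (tau p'' p) _ (cdom p (U `&` dom S p'))).
- exact: cdom_open.
- exact: cdom_open.
- move=> x cx; apply: cdom_tau; apply: cdom_sub cx => q [Uq dq]; split=> //.
  exact: Up.
- apply: sm_sum => [|k]; first exact: cdom_open.
  apply: smM; first exact: cdom_open.
    by apply: sm_sub (H k); apply: cdom_sub => ? [].
  by apply: sm_dd; apply: sm_sub (@sm_tau p p' j); apply: cdom_sub => ? [].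
- move=> k; apply: sm_sub (@sm_tau p'' p k); apply: cdom_sub => q [Uq _].
  exact: Up.
Qed.

Definition rext (theta : E -> 'cV[R]_N) (x : E) : 'M[R]_N :=
  \matrix_(k, l) (dd (ebase R k) (fun y => theta y l 0) x -
                  dd (ebase R l) (fun y => theta y k 0) x).

Lemma formloc_tau p q eta x : cdom q (dom S p) x ->
  formloc q eta x = Jac q p (chart_inv S q x) *m formloc p eta (tau q p x).
Proof.
move=> /cdomP[dq dp ex]; rewrite /formloc /transition /= chartK // mulmxA /fc Jac_comp //.
exact: dom_self.
Qed.

(** Naturality of [d] under a change of chart: differentiating the transformed components produces
    second derivatives of the transition map, which the antisymmetrization removes. *)
Lemma rext_tau U eta p q : open U -> U q -> dom S p q -> smooth_form S U eta ->
  rext (formloc q eta) (chart S q q) =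
  tc p q *m rext (formloc p eta) (chart S p q) *m (tc p q)^T.
Proof.
move=> oU Uq dp He.
have dq := dom_self S q.
have oW : open (cdom q (dom S p `&` U)) by apply/cdom_open/openI => //; exact: dom_open.
have Wq : cdom q (dom S p `&` U) (chart S q q) by exact: cdom_chart.
have tq : tau q p (chart S q q) = chart S p q by rewrite /transition /= chartK.
pose y0 := chart S q q.
pose t (l : 'I_N) y : R := tau q p y 0 l.
pose e (l : 'I_N) y : R := formloc p eta y l 0.
have st l : sm (t l) (cdom q (dom S p `&` U)).
  by apply: sm_sub (@sm_tau q p l); apply: cdom_sub => ? [].
have De i l : isdd (fun y => e l (tau q p y)) y0 (ebase R i)
    (\sum_k dd (ebase R i) (t k) y0 * dd (ebase R k) (e l) (chart S p q)).
  apply: isdd_eq.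
    apply: (@isdd_comp_sm _ _ _ (e l) (tau q p) (cdom p U) _ _
      (\row_k dd (ebase R i) (t k) y0)); first exact: cdom_open.
    - exact: sm_formloc.
    - by rewrite tq; exact: cdom_chart.
    - by move=> k; rewrite mxE; apply: dableP; exact: sm_dable (st k) _.
  by apply: eq_bigr => k _; rewrite mxE tq.
have D i j : dd (ebase R i) (fun y => formloc q eta y j 0) y0 =
   \sum_l (dd (ebase R i) (dd (ebase R j) (t l)) y0 * e l (chart S p q) +
     dd (ebase R j) (t l) y0 *
     \sum_k dd (ebase R i) (t k) y0 * dd (ebase R k) (e l) (chart S p q)).
  apply: isdd_dd; apply: (@isdd_near _ _
      (fun y => \sum_l dd (ebase R j) (t l) y * e l (tau q p y))).
    apply: (open_near oW Wq) => y Wy.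
    have [dy [dpy Uy] ey] := cdomP Wy.
    rewrite (@formloc_tau p q) //; last by apply: cdom_sub Wy => ? [].
    by rewrite mxE; apply: eq_bigr => l _; rewrite JacE // ey.
  apply: isdd_eq.
    apply: isdd_sum => l _; apply: isddM (De i l); apply: dableP.
    by apply: sm_dable (Wq); apply: sm_dd.
  by apply: eq_bigr => l _; rewrite tq.
apply/matrixP => i j; rewrite [LHS]mxE !D.
have -> : forall (a b c d : 'I_N -> R),
   \sum_l (a l + b l) - \sum_l (c l + d l) =
   \sum_l (a l - c l) + (\sum_l b l - \sum_l d l).
  by move=> a b c d; rewrite -!sumrB -big_split /=; apply: eq_bigr => l _; ring.
(* The terms containing second derivatives of the transition cancel by Schwarz. *)
rewrite big1 ?add0r; last first.
  move=> l _; rewrite (Schwarz_sm _ _ oW (st l) Wq) subrr //.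
have tcE k l : tc p q k l = dd (ebase R k) (t l) y0 by rewrite /tc JacE.
rewrite -mulmxA mxE.
under [in LHS]eq_bigr do rewrite mulr_sumr.
rewrite [X in X - _]exchange_big -sumrB; apply: eq_bigr => k _.
rewrite mulr_sumr -sumrB mxE mulr_sumr; apply: eq_bigr => l _.
rewrite !mxE !tcE -/(e l) -/(e k); ring.
Qed.

(** [extd] at [q] is computed in the chart of index [q], which moves with the point; in the fixed
    chart of [p] the result can be differentiated in [q]. *)
Lemma extdE U eta p q v w : open U -> U q -> dom S p q -> smooth_form S U eta ->
  extd S eta q v w =
  (v *m tc p q *m rext (formloc p eta) (chart S p q) *m (w *m tc p q)^T) 0 0.
Proof.
move=> oU Uq dp He.
have dq := dom_self S q.
have -> : v *m tc p q *m rext (formloc p eta) (chart S p q) *m (w *m tc p q)^T =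
   v *m rext (formloc q eta) (chart S q q) *m w^T.
  by rewrite (rext_tau oU Uq dp He) trmx_mul !mulmxA.
have oW : open (cdom q U) by exact: cdom_open.
have Wq : cdom q U (chart S q q) by exact: cdom_chart.
have D (a b : E) : dir S q a (fun r => ev (b *m from_chart S q r) (eta r)) =
    \sum_k \sum_l a 0 k * b 0 l * dd (ebase R k) (fun y => formloc q eta y l 0) (chart S q q).
  rewrite dirE.
  have -> : (fun r : M => ev (b *m from_chart S q r) (eta r)) \o chart_inv S q =
     (fun y => \sum_l b 0 l * formloc q eta y l 0).
    by apply/funext => y /=; rewrite from_chartE /ev -mulmxA mxE.
  have Dl l : isdd (fun y => b 0 l * formloc q eta y l 0) (chart S q q) a
      (b 0 l * dd a (fun y => formloc q eta y l 0) (chart S q q)).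
    apply: isdd_eq.
      apply: isddM; first exact: isdd_cst.
      exact: dableP (sm_dable _ (sm_formloc q l He) Wq).
    by rewrite mul0r add0r.
  rewrite (isdd_dd (isdd_sum _ (fun l _ => Dl l))).
  under eq_bigr do rewrite (dd_sum a oW (sm_formloc q _ He) Wq) mulr_sumr.
  rewrite exchange_big; apply: eq_bigr => k _; apply: eq_bigr => l _.
  by rewrite mulrA (mulrC (b 0 l)).
rewrite /extd !D -mulmxA mxE [in X in _ - X]exchange_big -sumrB.
apply: eq_bigr => k _; rewrite mxE mulr_sumr -sumrB; apply: eq_bigr => l _.
by rewrite !mxE; ring.
Qed.

End Charts.

(** * Pointwise CR algebra *)

Section ComplexMatrix.
Variable R : realType.
Local Notation C := R[i].

Lemma mxRe_real a b (V : 'M[C]_(a, b)) : V = mxC (mxRe V) + 'i%C *: mxC (mxIm V).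
Proof.
apply/matrixP => i j; rewrite !mxE; case: (V i j) => x y.
by apply: complex_eq; rewrite ?ReD ?ImD ?ReM ?ImM /= !(mul0r, mul1r, mulr0, subr0, addr0, add0r).
Qed.

Lemma mxRe_mul a b c (V : 'M[C]_(a, b)) (B : 'M[R]_(b, c)) :
  mxRe (V *m mxC B) = mxRe V *m B.
Proof.
apply/matrixP => i j; rewrite !mxE Re_sum; apply: eq_bigr => k _.
by rewrite !mxE ReM /= mulr0 subr0.
Qed.

Lemma mxIm_mul a b c (V : 'M[C]_(a, b)) (B : 'M[R]_(b, c)) :
  mxIm (V *m mxC B) = mxIm V *m B.
Proof.
apply/matrixP => i j; rewrite !mxE Im_sum; apply: eq_bigr => k _.
by rewrite !mxE ImM /= mulr0 add0r.
Qed.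

Lemma mxC_mul a b c (A : 'M[R]_(a, b)) (B : 'M[R]_(b, c)) :
  mxC (A *m B) = mxC A *m mxC B.
Proof. exact: map_mxM. Qed.

Lemma mxCD a b (A B : 'M[R]_(a, b)) : mxC (A + B) = mxC A + mxC B.
Proof. exact: map_mxD. Qed.
Lemma mxCN a b (A : 'M[R]_(a, b)) : mxC (- A) = - mxC A.
Proof. exact: map_mxN. Qed.
Lemma mxCZ a b c (A : 'M[R]_(a, b)) : mxC (c *: A) = (c%:C)%C *: mxC A.
Proof. exact: map_mxZ. Qed.
Lemma mxC_tr a b (A : 'M[R]_(a, b)) : mxC A^T = (mxC A)^T.
Proof. by rewrite /mxC map_trmx. Qed.
Lemma mxC1 a : mxC (1%:M : 'M[R]_a) = 1%:M.
Proof. exact: map_mx1. Qed.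
Lemma mxC0 a b : mxC (0 : 'M[R]_(a, b)) = 0.
Proof. exact: map_mx0. Qed.

Lemma mxconj_mul a b c (A : 'M[C]_(a, b)) (B : 'M[C]_(b, c)) :
  mxconj (A *m B) = mxconj A *m mxconj B.
Proof. exact: map_mxM. Qed.
Lemma mxconjD a b (A B : 'M[C]_(a, b)) : mxconj (A + B) = mxconj A + mxconj B.
Proof. exact: map_mxD. Qed.
Lemma mxconjN a b (A : 'M[C]_(a, b)) : mxconj (- A) = - mxconj A.
Proof. exact: map_mxN. Qed.
Lemma mxconj_tr a b (A : 'M[C]_(a, b)) : mxconj A^T = (mxconj A)^T.
Proof. by rewrite /mxconj map_trmx. Qed.
Lemma mxconj0 a b : mxconj (0 : 'M[C]_(a, b)) = 0.
Proof. exact: map_mx0. Qed.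
Lemma mxconj1 a : mxconj (1%:M : 'M[C]_a) = 1%:M.
Proof. exact: map_mx1. Qed.
Lemma mxconjK a b (A : 'M[C]_(a, b)) : mxconj (mxconj A) = A.
Proof. by apply/matrixP => i j; rewrite !mxE conjcK. Qed.
Lemma mxconj_real a b (A : 'M[R]_(a, b)) : mxconj (mxC A) = mxC A.
Proof. by apply/matrixP => i j; rewrite !mxE conjc_real. Qed.
Lemma conji : (('i : C)^*)%C = - 'i%C.
Proof. by apply: complex_eq => /=; rewrite ?oppr0. Qed.

Lemma conjM (x y : C) : conjc (x * y) = conjc x * conjc y.
Proof. exact: rmorphM. Qed.
Lemma conjD (x y : C) : conjc (x + y) = conjc x + conjc y.
Proof. exact: rmorphD. Qed.
Lemma conjN (x : C) : conjc (- x) = - conjc x.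
Proof. exact: rmorphN. Qed.
Lemma conj_sum I (r : seq I) (F : I -> C) :
  conjc (\sum_(i <- r) F i) = \sum_(i <- r) conjc (F i).
Proof. exact: rmorph_sum. Qed.

Lemma i_neq0 : ('i%C : C) != 0.
Proof. by apply/eqP => -[] /eqP; rewrite oner_eq0. Qed.

Lemma ii : ('i%C : C) * 'i%C = -1.
Proof. by rewrite -expr2 sqr_i. Qed.

Lemma bform_ReIm N (B : 'M[C]_N) (a b c d : 'rV[C]_N) :
  bform (a + 'i%C *: b) B (c + 'i%C *: d) =
  bform a B c + 'i%C * bform a B d + 'i%C * bform b B c + 'i%C * 'i%C * bform b B d.
Proof. by rewrite !(bformDl, bformDr, bformZl, bformZr); ring. Qed.

Lemma bilinC_form N (B : 'M[R]_N) (b : 'rV[R]_N -> 'rV[R]_N -> R) (V W : 'rV[C]_N) :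
  (forall v w, b v w = (v *m B *m w^T) 0 0) -> bilinC b V W = bform V (mxC B) W.
Proof.
move=> Hb; rewrite /bilinC !Hb.
have H (v w : 'rV[R]_N) : bform (mxC v) (mxC B) (mxC w) = ((v *m B *m w^T) 0 0)%:C%C.
  by rewrite /bform -mxC_tr -!mxC_mul mxE.
rewrite [V in RHS]mxRe_real [W in RHS]mxRe_real bform_ReIm !H.
apply: complex_eq; rewrite ?ReD ?ImD ?ReM ?ImM /=; ring.
Qed.

Lemma bform_conj N (B : 'M[R]_N) (V W : 'rV[C]_N) :
  ((bform V (mxC B) W)^*)%C = bform (mxconj V) (mxC B) (mxconj W).
Proof.
by rewrite /bform -mxconj_tr -[mxC B in RHS]mxconj_real -!mxconj_mul [RHS]mxE.
Qed.

End ComplexMatrix.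

(** With [i] a coordinate where [a] does not vanish, each vector [e_k - (a_k / a_i) e_i] is in the
    kernel of [a]; evaluating [b] on it gives [b_k = (b_i / a_i) a_k]. *)
Lemma proportional_covector (K : fieldType) N (a b : 'cV[K]_N) : a != 0 ->
  (forall v, ev v a = 0 -> ev v b = 0) -> exists c, b = c *: a.
Proof.
move=> a0 H.
have /matrix0Pn[i [j ai]] := a0; rewrite (ord1 j) in ai.
exists (b i 0 / a i 0); apply/colP => k; rewrite mxE.
have := H (delta_mx 0 k - (a k 0 / a i 0) *: delta_mx 0 i).
have evl (c : 'cV[K]_N) : ev (delta_mx 0 k - (a k 0 / a i 0) *: delta_mx 0 i) c =
   c k 0 - a k 0 / a i 0 * c i 0.
  by rewrite /ev mulmxBl -scalemxAl -!rowE !mxE.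
rewrite !evl divfK // subrr => /(_ erefl)/eqP; rewrite subr_eq0 => /eqP ->.
by rewrite mulrAC [RHS]mulrAC [a k 0 * _]mulrC.
Qed.

Section Pointwise.
Variables (R : realType) (n : nat) (M : topologicalType).
Variables (S : smooth_atlas R n.*2 M) (H : contact_structure S).
Local Notation C := R[i].
Local Notation N := n.*2.+1.

(** [contact_form] only states an inclusion of planes and positivity on [Hpos]. Comparison with a
    local defining form gives the plane exactly and a positive factor; the sign is tested on a
    vector [w] where [eta] takes the value of a nonzero square. *)
Lemma contact_form_eta theta q : contact_form H theta ->
  exists (eta : 'cV[R]_N) (c : R), [/\ eta != 0, 0 < c, theta q = c *: eta,
   Hplane H q = [set v | ev v eta = 0] & Hpos H q = [set v | 0 < ev v eta]].
Proof.
move=> [_ /(_ q)[t0 tH tP]].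
have [U [eta [_ Uq _ /(_ _ Uq)[e0 eH eP _]]]] := contact_local H q.
have [v ev0 | c tc] := @proportional_covector _ _ (eta q) (theta q) e0.
  by apply: tH; rewrite eH.
exists (eta q), c; split => //.
have /matrix0Pn[i [j ei]] := e0; rewrite (ord1 j) in ei.
pose w : 'rV[R]_N := eta q i 0 *: delta_mx 0 i.
have wP : 0 < ev w (eta q).
  by rewrite /ev -scalemxAl -rowE !mxE -expr2 lt_neqAle eq_sym sqr_ge0 sqrf_eq0 ei.
have : 0 < ev w (theta q) by apply: tP; rewrite eP.
by rewrite tc /ev -scalemxAr mxE pmulr_lgt0.
Qed.

Lemma HplaneE theta q : contact_form H theta ->
  forall v, Hplane H q v <-> ev v (theta q) = 0.
Proof.
move=> /(contact_form_eta q)[eta [c [_ c0 -> -> _]]] v /=.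
have -> : ev v (c *: eta) = c * ev v eta by rewrite /ev -scalemxAr mxE.
split=> [->|/eqP]; first by rewrite mulr0.
by rewrite mulf_eq0 gt_eqF //= => /eqP.
Qed.

Lemma contact_form_ratio theta theta' q : contact_form H theta -> contact_form H theta' ->
  exists2 c : R, 0 < c & theta' q = c *: theta q.
Proof.
move=> ht ht'.
have [eta [c [e0 c0 tc He Hp]]] := contact_form_eta q ht.
have [eta' [c' [e0' c0' tc' He' Hp']]] := contact_form_eta q ht'.
have [v ev0|d de] := @proportional_covector _ _ eta eta' e0.
  have : Hplane H q v by rewrite He.
  by rewrite He'.
have d0 : 0 < d.
  have /matrix0Pn[i [j ei]] := e0; rewrite (ord1 j) in ei.
  pose w : 'rV[R]_N := eta i 0 *: delta_mx 0 i.
  have wP : 0 < ev w eta.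
    by rewrite /ev -scalemxAl -rowE !mxE -expr2 lt_neqAle eq_sym sqr_ge0 sqrf_eq0 ei.
  have : Hpos H q w by rewrite Hp.
  by rewrite Hp' /= de /ev -scalemxAr mxE pmulr_lgt0.
exists (c' * d / c); first by rewrite divr_gt0 // mulr_gt0.
by rewrite tc' tc de !scalerA divfK ?gt_eqF.
Qed.

Definition dtheta (theta : M -> 'cV[R]_N) q : 'M[R]_N :=
  rext (formloc S q theta) (chart S q q).

Lemma extd_dtheta theta q v w : contact_form H theta ->
  extd S theta q v w = (v *m dtheta theta q *m w^T) 0 0.
Proof.
move=> [ht _]; rewrite (@extdE _ _ _ _ setT theta q q) //; last exact: dom_self.
  by rewrite tc_id !mulmx1.
exact: openT.
Qed.

Lemma dtheta_tr theta q : (dtheta theta q)^T = - dtheta theta q.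
Proof. by apply/matrixP => i j; rewrite !mxE opprB. Qed.

Section WithJ.
Variable J : M -> 'M[R]_N.
Hypothesis hJ : compatible_almost_CR H J.
Variables (theta : M -> 'cV[R]_N) (T : M -> 'rV[R]_N).
Hypothesis (ht : contact_form H theta) (hT : reeb_field S theta T).
Variable q : M.
Local Notation Om := (mxC (dtheta theta q)).
Local Notation JC := (mxC (J q)).
Local Notation thC := (mxC (theta q)).

Lemma OmC_tr : Om^T = - Om.
Proof. by rewrite -mxC_tr dtheta_tr mxCN. Qed.

Lemma bformA (V W : 'rV[C]_N) (B K : 'M[C]_N) :
  bform V B (W *m K) = bform V (B *m K^T) W.
Proof. by rewrite /bform trmx_mul !mulmxA. Qed.

Lemma leviE V W : levi S J theta q V W = bform V Om (W *m JC).
Proof.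
rewrite /levi (@bilinC_form _ _ (dtheta theta q *m (J q)^T)); last first.
  by move=> v w; rewrite extd_dtheta // trmx_mul !mulmxA.
by rewrite bformA mxC_mul mxC_tr.
Qed.

Lemma CHE V : CH H q V <-> V *m thC = 0.
Proof.
rewrite /CH !(HplaneE q ht) /ev; split=> [[r i]|h].
  rewrite [V]mxRe_real mulmxDl -scalemxAl -!mxC_mul.
  rewrite [mxRe V *m _]mx11_scalar r [mxIm V *m _]mx11_scalar i.
  by rewrite !raddf0 mxC0 scaler0 addr0.
by rewrite -mxRe_mul -mxIm_mul h !mxE.
Qed.

Lemma CH_J V : CH H q V -> CH H q (V *m JC).
Proof.
by move=> [r i]; split; rewrite ?mxRe_mul ?mxIm_mul; exact: (CR_stable hJ).
Qed.

Lemma CH_JJ V : CH H q V -> V *m JC *m JC = - V.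
Proof.
move=> [r i]; rewrite [V]mxRe_real !mulmxDl -!scalemxAl -!mxC_mul !(CR_square hJ) //.
by rewrite !mxCN opprD scalerN.
Qed.

Lemma CH_D V W : CH H q V -> CH H q W -> CH H q (V + W).
Proof. by rewrite !CHE mulmxDl => -> ->; rewrite addr0. Qed.
Lemma CH_Z c V : CH H q V -> CH H q (c *: V).
Proof. by rewrite !CHE -scalemxAl => ->; rewrite scaler0. Qed.
Lemma CH_conj V : CH H q V -> CH H q (mxconj V).
Proof. by rewrite !CHE => h; rewrite -mxconj_real -mxconj_mul h mxconj0. Qed.

(** The invariance [h (J v, J w) = h (v, w)] reads [d theta (J v, J (J w)) = d theta (v, J w)], and
    [J (J w) = - w] on the contact plane; bilinearity extends it to complex vectors. *)
Lemma Om_J V W : CH H q V -> CH H q W ->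
  bform (V *m JC) Om W = - bform V Om (W *m JC).
Proof.
move=> hV hW.
have real (v w : 'rV[R]_N) : Hplane H q v -> Hplane H q w ->
   bform (mxC v *m JC) Om (mxC w) = - bform (mxC v) Om (mxC w *m JC).
  move=> hv hw.
  have [_ h2 _] := CR_compatible hJ ht hv hw.
  rewrite /= !extd_dtheta // (CR_square hJ hw) linearN mulmxN /= mxE in h2.
  rewrite /bform -!mxC_mul -!mxC_tr -!mxC_mul.
  by rewrite [LHS]mxE [X in _ = - X]mxE -rmorphN /= -h2 opprK.
case: hV hW => [vr vi] [wr wi].
rewrite [V]mxRe_real [W]mxRe_real !mulmxDl -!scalemxAl.
rewrite !bform_ReIm (real _ _ vr wr) (real _ _ vr wi) (real _ _ vi wr) (real _ _ vi wi).
by rewrite !mulrN !opprD.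
Qed.

Lemma T_theta : mxC (T q) *m thC = 1%:M.
Proof.
have [_ /(_ q)[h _]] := hT.
by rewrite -mxC_mul [_ *m _]mx11_scalar -/(ev _ _) h mxC1.
Qed.

Lemma T_Om W : bform (mxC (T q)) Om W = 0.
Proof.
have [_ /(_ q)[_ h]] := hT.
have h' v : bform (mxC (T q)) Om (mxC v) = 0.
  by rewrite /bform -mxC_tr -!mxC_mul mxE -extd_dtheta // h.
by rewrite [W]mxRe_real bformDr bformZr !h' mulr0 addr0.
Qed.

Section Frame.
Variables (Z : 'M[C]_(n, N)) (th : 'M[C]_(N, n)).
Hypothesis hZ : admissible_at H J T q Z th.

Lemma Z_H10 a : H10 H J q (row a Z).
Proof. by case: hZ => h _ _ _; apply/h/row_sub. Qed.

Lemma Z_J : Z *m JC = 'i%C *: Z.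
Proof.
by apply/row_matrixP => a; rewrite row_mul linearZ; case: (Z_H10 a).
Qed.

Lemma Zc_J : mxconj Z *m JC = - 'i%C *: mxconj Z.
Proof. by rewrite -mxconj_real -mxconj_mul Z_J mxconjZ conji. Qed.

Lemma Z_theta : Z *m thC = 0.
Proof.
by apply/row_matrixP => a; rewrite row_mul linear0; apply/CHE; case: (Z_H10 a).
Qed.

Lemma Zc_theta : mxconj Z *m thC = 0.
Proof. by rewrite -mxconj_real -mxconj_mul Z_theta mxconj0. Qed.

Lemma Z_th : Z *m th = 1%:M. Proof. by case: hZ. Qed.
Lemma Zc_th : mxconj Z *m th = 0. Proof. by case: hZ. Qed.
Lemma T_th : mxC (T q) *m th = 0. Proof. by case: hZ. Qed.
Lemma Zc_thc : mxconj Z *m mxconj th = 1%:M.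
Proof. by rewrite -mxconj_mul Z_th mxconj1. Qed.
Lemma Z_thc : Z *m mxconj th = 0.
Proof. by rewrite -[Z]mxconjK -mxconj_mul Zc_th mxconj0. Qed.
Lemma T_thc : mxC (T q) *m mxconj th = 0.
Proof. by rewrite -mxconj_real -mxconj_mul T_th mxconj0. Qed.

Lemma H10_coord V : H10 H J q V -> V = V *m th *m Z.
Proof.
case: hZ => h zt _ _ /h/submxP[D ->].
by rewrite -(mulmxA D Z th) zt mulmx1.
Qed.

Lemma H10_P10 V : CH H q V -> H10 H J q (V - 'i%C *: (V *m JC)).
Proof.
move=> hV; split.
  by rewrite -scaleNr; apply: CH_D => //; apply: CH_Z; exact: CH_J.
rewrite mulmxBl -scalemxAl CH_JJ // scalerN opprK scalerBr scalerA ii scaleN1r opprK.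
by rewrite addrC.
Qed.

(** Twice [V] is the sum of [V - i J V], which is in [H^{1,0}], and [V + i J V], the conjugate of
    the same expression for the conjugate of [V]. Each half is then expanded in [Z] or its
    conjugate. *)
Lemma CH_coord V : CH H q V -> V = V *m th *m Z + V *m mxconj th *m mxconj Z.
Proof.
move=> hV.
have e1 := H10_coord (H10_P10 hV).
have e2 := H10_coord (H10_P10 (CH_conj hV)).
move/(congr1 (@mxconj _ _ _)): e2.
rewrite !mxconj_mul !mxconjD !mxconjN !mxconjZ !mxconj_mul !mxconjK mxconj_real conji.
rewrite scaleNr opprK => e2.
have e3 : (V + 'i%C *: (V *m JC)) *m th = 0.
  by rewrite e2 -mulmxA Zc_th mulmx0.
have e4 : (V - 'i%C *: (V *m JC)) *m mxconj th = 0.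
  by rewrite e1 -mulmxA Z_thc mulmx0.
have f3 : ('i%C *: (V *m JC)) *m th = - (V *m th).
  by apply/eqP; rewrite -addr_eq0 addrC -mulmxDl e3.
have f4 : ('i%C *: (V *m JC)) *m mxconj th = V *m mxconj th.
  by apply/eqP; rewrite eq_sym -subr_eq0 -mulmxBl e4.
have two : (2%:R : C) != 0 by rewrite pnatr_eq0.
apply: (scalerI two); rewrite scalerDr -!scalerMnl !scale1r.
rewrite -[in LHS](subrK ('i%C *: (V *m JC)) V) mulr2n.
have -> : V - 'i%C *: (V *m JC) + 'i%C *: (V *m JC) + (V - 'i%C *: (V *m JC) + 'i%C *: (V *m JC)) =
  (V - 'i%C *: (V *m JC)) + (V + 'i%C *: (V *m JC)) by rewrite !subrK addrACA addNr addr0.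
rewrite e1 e2 mulmxBl [(V + _) *m mxconj th]mulmxDl f3 f4 opprK.
by rewrite !mulmxDl !mulr2n.
Qed.

(** A resolution of the identity, with which vectors and covectors alike are expanded in [T], [Z]
    and the conjugate of [Z]; removing [theta (V) T] from [V] leaves a vector covered by
    [CH_coord]. *)
Lemma frame_decomposition :
  thC *m mxC (T q) + th *m Z + mxconj th *m mxconj Z = 1%:M.
Proof.
apply/row_matrixP => k; rewrite !rowE mulmx1; set V := delta_mx 0 k.
have hV : CH H q (V - V *m thC *m mxC (T q)).
  by apply/CHE; rewrite mulmxBl -[X in _ - X]mulmxA T_theta mulmx1 subrr.
have := CH_coord hV.
rewrite [_ *m th]mulmxBl -(mulmxA _ (mxC (T q)) th) T_th mulmx0 subr0.
rewrite [_ *m mxconj th]mulmxBl -(mulmxA _ (mxC (T q)) (mxconj th)) T_thc mulmx0 subr0 => e.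
rewrite !mulmxDr !mulmxA -addrA -e addrC subrK.
by [].
Qed.

Lemma levi_mxE a b : levi_mx S J theta q Z a b =
  - 'i%C * bform (row a Z) Om (mxconj (row b Z)).
Proof.
rewrite mxE leviE -bformZr; congr (bform _ _ _).
have -> : mxconj (row b Z) = row b (mxconj Z) by apply/matrixP => i j; rewrite !mxE.
by rewrite -row_mul Zc_J linearZ.
Qed.

(** On [H^{1,0}] the identity [Om_J] becomes [i d theta (Z_a, Z_b) = - i d theta (Z_a, Z_b)]. This
    is the isotropy needed by [contact_lie_symmetric]. *)
Lemma Om_Z_Z a b : bform (row a Z) Om (row b Z) = 0.
Proof.
have [hV1 hV2] := Z_H10 a; have [hW1 hW2] := Z_H10 b.
have := Om_J hV1 hW1; rewrite hV2 hW2 bformZl bformZr => /eqP.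
rewrite -addr_eq0 -mulrDl mulf_eq0 => /orP[|/eqP //].
by rewrite -mulr2n mulrn_eq0 /= (negbTE (i_neq0 R)).
Qed.

Lemma levi_hermitian a b :
  ((levi_mx S J theta q Z a b)^*)%C = levi_mx S J theta q Z b a.
Proof.
rewrite !levi_mxE conjM conjN conji bform_conj mxconjK opprK.
by rewrite (bform_anti _ _ OmC_tr) mulrN mulNr.
Qed.

Lemma levi_mx_mul :
  levi_mx S J theta q Z = - 'i%C *: (Z *m Om *m (mxconj Z)^T).
Proof.
apply/matrixP => a b; rewrite levi_mxE mxE; congr (_ * _).
rewrite /bform -row_mul mxE [RHS]mxE; apply: eq_bigr => k _.
by rewrite !mxE.
Qed.

(** A row [v] killed by the Levi matrix gives [W = v *m Z] with
    [h (Re W, Re W) + h (Im W, Im W) = 0]; positivity forces [W = 0], and pairing with the coframe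
    gives [v = 0]. *)
Lemma levi_unit : levi_mx S J theta q Z \in unitmx.
Proof.
rewrite -row_free_unit -kermx_eq0; apply/eqP/row_matrixP => k; rewrite linear0.
set v := row k _.
have hv : v *m levi_mx S J theta q Z = 0 by rewrite /v -row_mul mulmx_ker linear0.
pose W := v *m Z.
have [hr hi] : CH H q W by apply/CHE; rewrite -mulmxA Z_theta mulmx0.
have Wz : levi S J theta q W (mxconj W) = 0.
  have -> : levi S J theta q W (mxconj W) = (v *m levi_mx S J theta q Z *m (mxconj v)^T) 0 0.
    rewrite leviE levi_mx_mul mxconj_mul -mulmxA Zc_J -scalemxAr bformZr.
    by rewrite /bform trmx_mul -scalemxAr -scalemxAl [RHS]mxE !mulmxA.
  by rewrite hv mul0mx mxE.
have [_ _ pr] := CR_compatible hJ ht hr hr.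
have [_ _ pi] := CR_compatible hJ ht hi hi.
have [hs _ _] := CR_compatible hJ ht hr hi.
have Rz : extd S theta q (mxRe W) (mxRe W *m J q) + extd S theta q (mxIm W) (mxIm W *m J q) = 0.
  have /(congr1 (@complex.Re R)) := Wz; rewrite /levi /bilinC /=.
  have -> : mxRe (mxconj W) = mxRe W by apply/matrixP => i j; rewrite !mxE ReJ.
  have -> : mxIm (mxconj W) = - mxIm W by apply/matrixP => i j; rewrite !mxE ImJ.
  by rewrite mulNmx [extd _ _ _ _ (- _)]extd_dtheta // linearN mulmxN mxE opprK -extd_dtheta.
have pos (w : 'rV[R]_N) : (w != 0 -> 0 < extd S theta q w (w *m J q)) ->
    0 <= extd S theta q w (w *m J q).
  have [->|_ /(_ isT)/ltW //] := eqVneq w 0.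
  by rewrite extd_dtheta // !mul0mx mxE.
have W0 : W = 0.
  move/eqP: Rz; rewrite paddr_eq0 ?pos // => /andP[/eqP zr /eqP zi].
  have r0 : mxRe W = 0.
    by apply/eqP; apply: contraT => /pr; rewrite zr ltxx.
  have i0 : mxIm W = 0.
    by apply/eqP; apply: contraT => /pi; rewrite zi ltxx.
  by rewrite [W]mxRe_real r0 i0 !mxC0 scaler0 addr0.
by rewrite -[v]mulmx1 -Z_th mulmxA -/W W0 mul0mx.
Qed.

End Frame.
End WithJ.
End Pointwise.

Lemma ev_scaler (K : comNzRingType) N (v : 'rV[K]_N) c (eta : 'cV[K]_N) :
  ev v (c *: eta) = c * ev v eta.
Proof. by rewrite /ev -scalemxAr mxE. Qed.

(** * Change of contact form *)

Section LocalFunctions.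
Variables (R : realType) (m : nat) (M : topologicalType) (S : smooth_atlas R m M).
Local Notation N := m.+1.
Local Notation E := 'rV[R]_N.
Implicit Types (p q : M) (U : set M).

Lemma ev_loc p (X : M -> E) (eta : M -> 'cV[R]_N) x : cdom S p setT x ->
  ev (X (chart_inv S p x)) (eta (chart_inv S p x)) =
  (fieldloc S p X x *m formloc S p eta x) 0 0.
Proof.
move=> /cdomP[dx _ _]; rewrite /fieldloc /formloc mulmxA -(mulmxA (X _)).
by rewrite tc_fc // mulmx1.
Qed.

Lemma sm_ev p U (X : M -> E) (eta : M -> 'cV[R]_N) : open U ->
  smooth_field S U X -> smooth_form S U eta ->
  sm (fun x => ev (X (chart_inv S p x)) (eta (chart_inv S p x))) (cdom S p U).
Proof.
move=> oU HX He; have oW : open (cdom S p U) by exact: cdom_open.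
apply: (@sm_eq _ _ (fun x => \sum_k fieldloc S p X x 0 k * formloc S p eta x k 0)) => //.
  move=> x cx; rewrite ev_loc ?mxE //; exact: cdom_sub cx.
apply: sm_sum => // k; apply: smM => //; [exact: sm_fieldloc|exact: sm_formloc].
Qed.

Lemma fieldloc_chart p q (X : M -> E) : dom S p q ->
  fieldloc S p X (chart S p q) = X q *m tc S p q.
Proof. by move=> dq; rewrite /fieldloc chartK. Qed.

Lemma formloc_chart p q (eta : M -> 'cV[R]_N) : dom S p q ->
  formloc S p eta (chart S p q) = fc S p q *m eta q.
Proof. by move=> dq; rewrite /formloc chartK. Qed.

Lemma chart_cdom q : cdom S q setT (chart S q q).
Proof. by apply: cdom_chart => //; exact: dom_self. Qed.

Lemma cdomT_open p : open (cdom S p setT).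
Proof. exact/cdom_open/openT. Qed.

(* [d (l theta) = dl /\ theta + l d theta] *)
Lemma rext_scale (l : E -> R) (th th' : E -> 'cV[R]_N) (A : set E) x v w : open A -> A x ->
  sm l A -> (forall j, sm (fun y => th y j 0) A) ->
  (forall y, A y -> th' y = l y *: th y) ->
  (v *m rext th' x *m w^T) 0 0 = l x * (v *m rext th x *m w^T) 0 0 +
    dd v l x * (w *m th x) 0 0 - dd w l x * (v *m th x) 0 0.
Proof.
move=> oA Ax sl sth E'.
have D i j : dd (ebase R i) (fun y => th' y j 0) x =
   dd (ebase R i) l x * th x j 0 + l x * dd (ebase R i) (fun y => th y j 0) x.
  apply: isdd_dd; apply: (@isdd_near _ _ (fun y => l y * th y j 0)).
    by apply: (open_near oA Ax) => y Ay; rewrite E' // mxE.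
  by apply: isddM; apply: dableP; [exact: sm_dable sl _|exact: sm_dable (sth j) _].
have X (B : 'M[R]_N) : (v *m B *m w^T) 0 0 = \sum_k \sum_j v 0 k * w 0 j * B k j.
  rewrite -mulmxA mxE; apply: eq_bigr => k _; rewrite mxE mulr_sumr.
  by apply: eq_bigr => j _; rewrite mxE; ring.
rewrite !X (dd_sum v oA sl Ax) (dd_sum w oA sl Ax) [(w *m _) 0 0]mxE [(v *m _) 0 0]mxE.
rewrite [X in _ - X]mulrC !big_distrlr /= mulr_sumr -big_split -sumrB /=.
apply: eq_bigr => k _; rewrite mulr_sumr -big_split -sumrB /=; apply: eq_bigr => j _.
by rewrite 2![rext _ _ _ _]mxE !D; ring.
Qed.

End LocalFunctions.

Section ChangeOfContactForm.
Variables (R : realType) (n : nat) (M : topologicalType).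
Variables (S : smooth_atlas R n.*2 M) (H : contact_structure S).
Variable J : M -> 'M[R]_(n.*2.+1).
Hypothesis hJ : compatible_almost_CR H J.
Local Notation C := R[i].
Local Notation N := n.*2.+1.

Variables (theta : M -> 'cV[R]_N) (T : M -> 'rV[R]_N).
Variables (theta' : M -> 'cV[R]_N) (T' : M -> 'rV[R]_N).
Hypothesis (ht : contact_form H theta) (hT : reeb_field S theta T).
Hypothesis (ht' : contact_form H theta') (hT' : reeb_field S theta' T').

(** The factor [e^u] between the two contact forms. [contact_form_ratio] only produces it pointwise;
    written as [theta' (T)] it is smooth as a pairing of smooth tensors. *)
Let lam q := ev (T q) (theta' q).

Lemma theta_scale q : theta' q = lam q *: theta q.
Proof.
have [c c0 E] := contact_form_ratio q ht ht'.
rewrite /lam E /ev -scalemxAr mxE.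
by have [_ /(_ q)[+ _]] := hT; rewrite /ev => ->; rewrite mulr1.
Qed.

Lemma lam_gt0 q : 0 < lam q.
Proof.
have [c c0 E] := contact_form_ratio q ht ht'.
rewrite /lam E /ev -scalemxAr mxE.
by have [_ /(_ q)[+ _]] := hT; rewrite /ev => ->; rewrite mulr1.
Qed.

Lemma sm_lam p : sm (lam \o chart_inv S p) (cdom S p setT).
Proof. by apply: sm_ev; [exact: openT|case: hT|case: ht']. Qed.

Lemma extd_scale q v w : extd S theta' q v w = lam q * extd S theta q v w +
  dir S q v lam * ev w (theta q) - dir S q w lam * ev v (theta q).
Proof.
have hq := dom_self S q.
rewrite !(@extd_dtheta _ _ _ _ H) // /dtheta !dirE.
rewrite (@rext_scale _ _ (lam \o chart_inv S q) (formloc S q theta) _ (cdom S q setT)).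
- by rewrite /= chartK // formloc_chart // fc_id mul1mx.
- exact: cdomT_open.
- exact: chart_cdom.
- exact: sm_lam.
- by move=> j; apply: sm_formloc; case: ht.
- by move=> y _; rewrite /formloc theta_scale /= scalemxAr.
Qed.

Lemma K_frame_theta q Z th : admissible_at H J T q Z th ->
  K_frame_at H J q (row_mx (mxC (theta q)) th).
Proof.
move=> hZ; split.
  apply/eqP; rewrite -/(row_full _); apply/row_fullP; exists (col_mx (mxC (T q)) Z).
  rewrite mul_col_row (T_theta hT) (T_th hZ) (Z_theta ht hZ) (Z_th hZ).
  by rewrite -scalar_mx_block.
move=> V [hV VJ].
have hcV : H10 H J q (mxconj V).
  split; first exact: (CH_conj ht hV).
  by rewrite -mxconj_real -mxconj_mul VJ mxconjZ conjN conji opprK.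
rewrite mul_mx_row (CHE ht q V).1 //.
have := H10_coord hZ hcV; move/(congr1 (@mxconj _ _ _)).
rewrite mxconjK mxconj_mul => ->; rewrite -mulmxA (Zc_th hZ) mulmx0.
by rewrite row_mx0.
Qed.

(** Let [Q] be the matrix of [Z] in the frame [Z']. Unitarity of each frame for its own contact form
    gives [Q *m (mxconj Q)^T = c], hence [|\det Q|^2 = c^n]. The coframe bases differ by [G] with
    [\det G = c * \det Q], so [|\det G|^2 = c^(n+2)], and the density weight takes the power
    [2 / (n+2)] of [|\det G|], namely [c]. *)
Lemma trivialization_scale f g g' q : real_density11 H J f ->
  trivialization H J theta T f g -> trivialization H J theta' T' f g' ->
  g' q = lam q * g q.
Proof.
move=> hf /(_ q)[Z [th [hZ lZ ->]]] /(_ q)[Z' [th' [hZ' lZ' ->]]].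
set c := lam q; have c0 : 0 < c := lam_gt0 q.
pose Q := Z *m th'.
have ZQ : Z = Q *m Z'.
  apply/row_matrixP => a; rewrite !row_mul.
  exact: (H10_coord hZ' (Z_H10 hZ a)).
have QQ' : Q *m (Z' *m th) = 1%:M by rewrite mulmxA -ZQ (Z_th hZ).
have Zcth' : mxconj Z *m th' = 0.
  by rewrite ZQ mxconj_mul -mulmxA (Zc_th hZ') mulmx0.
have th'E : th' = mxC (theta q) *m (mxC (T q) *m th') + th *m Q.
  rewrite -[LHS]mul1mx -(frame_decomposition hJ ht hT hZ) !mulmxDl -!mulmxA Zcth'.
  by rewrite mulmx0 addr0.
(* Block triangular because [th'] may have a component along [theta] while [theta'] is a multiple of
   [theta]; the off-diagonal block does not enter the determinant. *)
pose G : 'M[C]_(1 + n) := block_mx ((c%:C)%C%:M) (mxC (T q) *m th') 0 Q.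
have BG : row_mx (mxC (theta' q)) th' = row_mx (mxC (theta q)) th *m G.
  rewrite mul_row_block mulmx0 addr0 -th'E; congr row_mx.
  by rewrite theta_scale mxCZ -scalemx1 -scalemxAr mulmx1.
have detG : \det G = (c%:C)%C * \det Q by rewrite det_ublock det_scalar1.
have Qu : Q \in unitmx by case/mulmx1_unit: QQ'.
have Gu : G \in unitmx.
  rewrite unitmxE detG unitrM unitfE -unitmxE Qu andbT.
  by apply/eqP => -[] /eqP; rewrite gt_eqF.
rewrite BG (density_weight hf (K_frame_theta hZ) Gu); congr (_ * _).
have leviQ : levi_mx S J theta' q Z' = (c%:C)%C *: levi_mx S J theta q Z'.
  apply/matrixP => a b; rewrite [LHS]mxE [RHS]mxE [levi_mx _ _ _ _ _ _ _]mxE.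
  have [[hr hi] _] := Z_H10 hZ' a; have [[kr ki] _] := Z_H10 hZ' b.
  have [krc kic] := CH_conj ht (conj kr ki).
  have H0 (v w : 'rV[R]_N) : Hplane H q v -> Hplane H q w ->
      extd S theta' q v (w *m J q) = c * extd S theta q v (w *m J q).
    move=> hv /(CR_stable hJ) hw; rewrite extd_scale.
    by move/(HplaneE q ht): hv => ->; move/(HplaneE q ht): hw => ->; rewrite !mulr0 addr0 subr0.
  rewrite /levi /bilinC.
  rewrite !H0 //; move: (extd S theta q) => e.
  by apply: complex_eq; rewrite ?ReM ?ImM /=; ring.
have QQ : Q *m (mxconj Q)^T = ((c%:C)%C)%:M.
  have cu : (c%:C)%C != 0 by apply/eqP => -[] /eqP; rewrite gt_eqF.
  apply: (scalerI (invr_neq0 cu)).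
  rewrite -[in RHS]scalemx1 scalerA mulVf // scale1r -lZ.
  have l1 : levi_mx S J theta q Z' = (c%:C)%C^-1 *: 1%:M.
    by rewrite -lZ' leviQ scalerA mulVf // scale1r.
  rewrite (levi_mx_mul ht hZ) ZQ mxconj_mul trmx_mul.
  have -> : - 'i%C *: (Q *m Z' *m mxC (dtheta S theta q) *m ((mxconj Z')^T *m (mxconj Q)^T)) =
     Q *m levi_mx S J theta q Z' *m (mxconj Q)^T.
    by rewrite (levi_mx_mul ht hZ') -scalemxAr -scalemxAl !mulmxA.
  by rewrite l1 -scalemxAr -scalemxAl mulmx1.
have dQ : \det Q * conjc (\det Q) = ((c ^+ n)%:C)%C.
  have := congr1 determinant QQ.
  by rewrite det_mulmx det_tr det_map_mx det_scalar => ->; rewrite rmorphXn.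
pose r := complex.Re `|\det G|.
have r0 : 0 <= r.
  by have := normr_ge0 (\det G); rewrite lecE => /andP[_].
have rE : `|\det G| = (r%:C)%C.
  by rewrite /r normc_def.
have r2 : r ^+ 2 = c ^+ n.+2.
  apply: complexI; rewrite rmorphXn /= -rE sqr_normc detG conjM conjc_real.
  have -> : (c%:C)%C * \det Q * ((c%:C)%C * conjc (\det Q)) =
     (c%:C)%C * (c%:C)%C * (\det Q * conjc (\det Q)) by ring.
  by rewrite dQ !exprS 2!rmorphM /= mulrA.
rewrite -/r mulrC [_ ^-1 * _]mulrC powRrM powR_mulrn // r2 -powR_mulrn ?ltW // -powRrM.
by rewrite mulfV ?pnatr_eq0 // powRr1 // ltW.
Qed.

End ChangeOfContactForm.

(** With [theta = lam theta0] and [g = lam g0], on contact vectors [d theta (X, v) = lam d theta0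
    (X, v) - d lam (v) theta0 (X)], which is [- lam d g0 (v) - g0 d lam (v) = - d g (v)]. *)
Lemma hamiltonian_equations (R : realType) n (M : topologicalType)
    (S : smooth_atlas R n.*2 M) (H : contact_structure S) J f X theta T g :
  compatible_almost_CR H J -> real_density11 H J f -> contact_hamiltonian H J f X ->
  contact_form H theta -> reeb_field S theta T -> trivialization H J theta T f g ->
  forall p, ev (X p) (theta p) = g p /\
    forall v, Hplane H p v -> extd S theta p (X p) v = - dir S p v g.
Proof.
move=> hJ hf [sX [theta0 [T0 [g0 [ht0 hT0 tr0 HX]]]]] ht hT tr p.
pose lam q := ev (T0 q) (theta q).
have gE q : g q = lam q * g0 q by apply: trivialization_scale hf tr0 tr.
have tE := theta_scale ht0 hT0 ht.
have [Xg Xd] := HX p.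
have XgE q : ev (X q) (theta q) = g q.
  by rewrite tE ev_scaler (HX q).1 gE.
split=> // v hv.
rewrite (extd_scale ht0 hT0 ht) (HplaneE p ht0 v).1 // mulr0 addr0 Xd // Xg.
have px := chart_cdom S p.
have s0 : sm (g0 \o chart_inv S p) (cdom S p setT).
  have -> : g0 = (fun q => ev (X q) (theta0 q)) by apply/funext => q; rewrite (HX q).1.
  by apply: sm_ev => //; [exact: openT|case: ht0].
have sl : sm (lam \o chart_inv S p) (cdom S p setT).
  by apply: sm_ev; [exact: openT|case: hT0|case: ht].
have -> : g = (fun q => lam q * g0 q) by apply/funext.
rewrite !dirE.
have -> := isdd_dd (isddM (dableP (sm_dable v sl px)) (dableP (sm_dable v s0 px))).
rewrite /= chartK; last exact: dom_self.
by rewrite -/lam -/(lam p); ring.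
Qed.

(** For positive times [y^2 e^(- 2 K s)] has derivative [(2 m - 2 K) y^2 e^(- 2 K s) <= 0] and
    starts at 0, so the nonnegative [y^2] stays 0. *)
Lemma gronwall0 (R : realType) (y m : R -> R) (d K : R) :
  (forall t, `|t| < d -> isdd y t 1 (m t * y t) /\ `|m t| <= K) ->
  y 0 = 0 -> forall t, `|t| < d -> y t = 0.
Proof.
have pos (y' m' : R -> R) :
    (forall t, `|t| < d -> isdd y' t 1 (m' t * y' t) /\ `|m' t| <= K) ->
    y' 0 = 0 -> forall t, 0 < t < d -> y' t = 0.
  move=> H y0 t /andP[t0 td].
  pose z s := y' s * y' s * expR (s * (- (2 * K))).
  have Hz s : 0 <= s <= t ->
      isdd z s 1 ((2 * m' s - 2 * K) * (y' s * y' s) * expR (s * (- (2 * K)))).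
    move=> /andP[s0 st]; have [|Hy _] := H s; first by rewrite ger0_norm // (le_lt_trans st).
    apply: isdd_eq.
      apply: isddM; first exact: (isddM Hy Hy).
      apply: (@isdd_comp1 _ expR (fun s => s * (- (2 * K)))).
        by apply/isddE; exact: is_derive_expR.
      exact: (isddM (isdd_id _) (isdd_cst _ _ _)).
    by rewrite mulr0 /=; ring.
  have [c /andP[c0 ct] E] := isdd_MVT t0 Hz.
  have [|_ mc] := H c; first by rewrite gtr0_norm // (lt_trans ct).
  have le0 : z t <= 0.
    have -> : z t = (z t - z 0) by rewrite {3}/z y0 !mul0r subr0.
    rewrite E subr0; apply: mulr_le0_ge0 (ltW t0); apply: mulr_le0_ge0 (expR_ge0 _).
    apply: mulr_le0_ge0; last by rewrite -expr2 sqr_ge0.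
    have := ler_norm (m' c); lra.
  apply/eqP; rewrite -sqrf_eq0 eq_le sqr_ge0 andbT expr2.
  by rewrite -(pmulr_lle0 _ (expR_gt0 (t * (- (2 * K))))).
move=> H y0 t td; have [t0|t0|<-] := ltgtP 0 t; last by [].

  by apply: (pos y m) => //; rewrite t0; move: td; rewrite gtr0_norm.
(* Negative times follow by reversing time, which changes the sign of [m] but not the bound on
   it. *)
have := pos (fun s => y (- s)) (fun s => - m (- s)) _ _ (- t).
rewrite opprK; apply.
- move=> s sd; have [|Hy Hm] := H (- s); first by rewrite normrN.
  split; last by rewrite normrN.
  apply: isdd_eq; first exact: (@isdd_comp1 _ y (fun s => - s) _ _ _ Hy (isddN (isdd_id _))).
  by ring.
- by rewrite oppr0.
- by rewrite oppr_gt0 t0; move: td; rewrite ltr0_norm.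
Qed.

(** * The contact Hamiltonian flow *)

Section DirTransport.
Variables (R : realType) (m : nat) (M : topologicalType) (S : smooth_atlas R m M).

Lemma dir_transport (U : set M) p q v (g : M -> R) : open U -> U q -> dom S p q ->
  sm (g \o chart_inv S p) (cdom S p U) ->
  dir S q v g = dd (v *m tc S p q) (g \o chart_inv S p) (chart S p q).
Proof.
move=> oU Uq dp sg; rewrite dirE; apply: isdd_dd.
have dq := dom_self S q.
have oW : open (cdom S q (dom S p `&` U)) by apply/cdom_open/openI => //; exact: dom_open.
have Wq : cdom S q (dom S p `&` U) (chart S q q) by exact: cdom_chart.
have tq : transition S q p (chart S q q) = chart S p q by rewrite /transition /= chartK.
apply: (@isdd_near _ _ (fun y => (g \o chart_inv S p) (transition S q p y))).
  apply: (open_near oW Wq) => y /cdomP[_ [dy _] _].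
  by rewrite /transition /= chartK.
apply: isdd_eq.
  apply: (@isdd_comp_sm _ _ _ (g \o chart_inv S p) (transition S q p) (cdom S p U) _ _
    (v *m tc S p q)).
  - exact: cdom_open.
  - exact: sg.
  - by rewrite tq; exact: cdom_chart.
  - move=> k; rewrite /tc mul_Jac //; apply: dableP.
    by apply: sm_dable (@sm_tau _ _ _ S q p k) _; exact: cdom_chart.
rewrite (dd_sum (v *m tc S p q) (@cdom_open _ _ _ S p _ oU) sg) ?tq //.
exact: cdom_chart.
Qed.

End DirTransport.

Section LieDerivative.
Variables (R : realType) (n : nat) (M : topologicalType).
Variables (S : smooth_atlas R n.*2 M) (H : contact_structure S).
Local Notation N := n.*2.+1.
Variables (theta : M -> 'cV[R]_N) (T X : M -> 'rV[R]_N) (g : M -> R).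
Hypothesis (ht : contact_form H theta) (hT : reeb_field S theta T).
Hypothesis sX : smooth_field S setT X.
Hypothesis hX : forall p, ev (X p) (theta p) = g p /\
    forall v, Hplane H p v -> extd S theta p (X p) v = - dir S p v g.

Lemma sm_g p : sm (g \o chart_inv S p) (cdom S p setT).
Proof.
have -> : g = (fun q => ev (X q) (theta q)) by apply/funext => q; rewrite (hX q).1.
by apply: sm_ev => //; [exact: openT|case: ht].
Qed.

(** The Hamiltonian equation is given on contact vectors only; the part of [v] along [T] contributes
    nothing to the left side and is compensated by [(T g) theta] on the right. *)
Lemma extd_X q v :
  extd S theta q (X q) v = - dir S q v g + dir S q (T q) g * ev v (theta q).
Proof.
have dirD a w w' : dir S q (w + a *: w') g = dir S q w g + a * dir S q w' g.
  rewrite !dirE !(dd_sum _ (@cdomT_open _ _ _ S q) (sm_g q) (chart_cdom S q)).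
  rewrite mulr_sumr -big_split; apply: eq_bigr => k _.
  by rewrite !mxE mulrDl mulrA.
pose w := v + (- ev v (theta q)) *: T q.
have [_ /(_ q)[Tt Te]] := hT.
have wH : Hplane H q w.
  apply/(HplaneE q ht); move: Tt; rewrite /w /ev mulmxDl -scalemxAl !mxE => ->.
  by rewrite mulr1 subrr.
have [_ /(_ w wH)] := hX q.
rewrite /w dirD !(@extd_dtheta _ _ _ _ H) // linearD linearZ mulmxDr -scalemxAr.
rewrite [LHS]mxE [X in _ + X]mxE.
have -> : (X q *m dtheta S theta q *m (T q)^T) 0 0 = 0.
  have := Te (X q); rewrite (@extd_dtheta _ _ _ _ H) // => e.
  rewrite -[LHS]opprK -[in RHS]oppr0 -e; congr (- _).
  have -> : - (X q *m dtheta S theta q *m (T q)^T) 0 0 =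
    ((T q *m dtheta S theta q *m (X q)^T)^T) 0 0; last by rewrite mxE.
  by rewrite !trmx_mul trmxK dtheta_tr mulNmx mulmxN mulmxA [RHS]mxE.
rewrite mulr0 addr0 => ->; ring.
Qed.

Definition mu p x := dd (fieldloc S p T x) (g \o chart_inv S p) x.

(* [L_X theta = mu theta] with [mu = T g], in coordinates. *)
Lemma lie_theta p x (l : 'I_N) : cdom S p setT x ->
  \sum_k (fieldloc S p X x 0 k * dd (ebase R k) (fun y => formloc S p theta y l 0) x +
     dd (ebase R l) (fun y => fieldloc S p X y 0 k) x * formloc S p theta x k 0) =
  mu p x * formloc S p theta x l 0.
Proof.
move=> Ax; have [dx _ ex] := cdomP Ax; set q := chart_inv S p x in dx ex.
have oA := @cdomT_open _ _ _ S p.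
have oT : open (setT : set M) by exact: openT.
have sth i : sm (fun y => formloc S p theta y i 0) (cdom S p setT).
  by apply: sm_formloc; case: ht.
have sXl i : sm (fun y => fieldloc S p X y 0 i) (cdom S p setT).
  by apply: sm_fieldloc => //; exact: openT.
have := extd_X q (ebase R l *m fc S p q).
rewrite (@extdE _ _ _ _ setT theta p q) //; last by case: ht.
  rewrite -(mulmxA (ebase R l)) fc_tc // mulmx1.
  rewrite !(@dir_transport _ _ _ _ setT p q) //; try exact: sm_g.
  rewrite -(mulmxA (ebase R l)) fc_tc // mulmx1 ex.
  rewrite -[X q *m tc S p q]/(fieldloc S p X x) -[T q *m tc S p q]/(fieldloc S p T x).
  rewrite -/(mu p x) /ev -(mulmxA (ebase R l)) -[fc S p q *m theta q]/(formloc S p theta x).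
  rewrite /ebase -rowE [row l _ _ _]mxE trmx_delta -colE [col l _ _ _]mxE => E1.
  (* Since [g = theta (X)], the product rule for [d g] added to [d theta (X, _)] gives the Lie
     derivative, as in [L_X = i_X d + d i_X]. *)
  have E2 : dd (ebase R l) (g \o chart_inv S p) x = \sum_k
     (dd (ebase R l) (fun y => fieldloc S p X y 0 k) x * formloc S p theta x k 0 +
      fieldloc S p X x 0 k * dd (ebase R l) (fun y => formloc S p theta y k 0) x).
    apply: isdd_dd; apply: (@isdd_near _ _
       (fun y => \sum_k fieldloc S p X y 0 k * formloc S p theta y k 0)).
      by apply: (open_near oA Ax) => y Ay; rewrite /= -(hX _).1 ev_loc // mxE.
    apply: isdd_sum => k _; apply: isddM; apply: dableP.
      exact: sm_dable (sXl k) _.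
    exact: sm_dable (sth k) _.
  transitivity ((fieldloc S p X x *m rext (formloc S p theta) x) 0 l +
      dd (ebase R l) (g \o chart_inv S p) x); last by rewrite E1; ring.
  rewrite E2 mxE -big_split; apply: eq_bigr => k _.
  by rewrite [rext _ _ _ _]mxE /=; ring.
Qed.

End LieDerivative.

(** * The flow and its differential in a fixed chart *)

Section FlowInChart.
Variables (R : realType) (m : nat) (M : topologicalType) (S : smooth_atlas R m M).
Local Notation N := m.+1.
Local Notation E := 'rV[R]_N.
Variables (X : M -> E) (D : set (R * M)) (Fl : R -> M -> M).
Hypothesis (sX : smooth_field S setT X) (hFl : is_flow S X D Fl).
Variable p : M.
Local Notation x0 := (chart S p p).

Definition flow_chart (y : R * E) : E := chart S p (Fl y.1 (chart_inv S p y.2)).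

Definition flow_set : set (R * E) :=
  [set y | [/\ (chart S p @` dom S p) y.2, D (y.1, chart_inv S p y.2) &
               dom S p (Fl y.1 (chart_inv S p y.2))]].

Lemma chart_inv0 : chart_inv S p x0 = p.
Proof. by rewrite chartK //; exact: dom_self. Qed.

Lemma x0_image : (chart S p @` dom S p) x0.
Proof. by exists p => //; exact: dom_self. Qed.

Lemma nbhs_chart_inv (t : R) (A : set (R * M)) : nbhs ((t, p) : R * M) A ->
  nbhs ((t, x0) : R * E) [set y | A (y.1, chart_inv S p y.2)].
Proof.
move=> [[P Q] [/= nP nQ] PQ]; exists (P, chart_inv S p @^-1` Q).
  split=> //=; apply: (chart_inv_continuous x0_image).
  by rewrite chart_inv0.
by move=> y [/= y1 y2]; apply: PQ; split.
Qed.

Lemma flow_set_nbhs : nbhs ((0, x0) : R * E) flow_set.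
Proof.
have D0 := flow_dom0 hFl p.
have n1 : nbhs ((0, x0) : R * E) [set y | (chart S p @` dom S p) y.2].
  apply: (@cvg_snd _ _ (nbhs (0 : R)) (nbhs x0)).
  by apply: open_nbhs_nbhs; split; [exact: chart_image_open|exact: x0_image].
have n2 : nbhs ((0, x0) : R * E) [set y | D (y.1, chart_inv S p y.2)].
  apply: nbhs_chart_inv; apply: open_nbhs_nbhs; split => //; exact: flow_dom_open hFl.
have n3 : nbhs ((0, x0) : R * E) [set y | dom S p (Fl y.1 (chart_inv S p y.2))].
  apply: (nbhs_chart_inv (A := [set z | dom S p (Fl z.1 z.2)])).
  apply: (flow_continuous hFl D0) => /=; rewrite (flow0 hFl).
  by apply: open_nbhs_nbhs; split; [exact: dom_open|exact: dom_self].
by apply: filterS (filterI n1 (filterI n2 n3)) => y [? [? ?]]; split.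
Qed.

(** Closure properties of [sm] require open sets. The interior is open at once, and [flow_set_nbhs]
    shows that it still contains the base point at time 0. *)
Definition flow_nbhd : set (R * E) := interior flow_set.

Lemma flow_nbhd_open : open flow_nbhd. Proof. exact: open_interior. Qed.

Lemma flow_nbhd0 : flow_nbhd (0, x0). Proof. exact: flow_set_nbhs. Qed.

Lemma flow_nbhd_sub y : flow_nbhd y -> flow_set y. Proof. exact: interior_subset. Qed.

Lemma sm_flow_chart j : sm (fun y => flow_chart y 0 j) flow_nbhd.
Proof.
apply: Cinfty_coord (flow_smooth hFl p p); first exact: flow_nbhd_open.
exact: flow_nbhd_sub.
Qed.

Lemma flow_chart_cdom y : flow_nbhd y -> cdom S p setT (flow_chart y).
Proof. by move=> /flow_nbhd_sub[_ _ d]; exact: cdom_chart. Qed.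

(** [flow_ode] is stated in the chart centred at the current point [Fl t q]; the transition to the
    chart of [p] turns it into an equation in one chart for all times. *)
Lemma flow_curve q t j : D (t, q) -> dom S p (Fl t q) ->
  isdd (fun s => chart S p (Fl s q) 0 j) t 1 (fieldloc S p X (chart S p (Fl t q)) 0 j).
Proof.
move=> Dt dp; set r := Fl t q in dp *.
have dr := dom_self S r.
have n1 : \forall s \near t, dom S r (Fl s q).
  have cF : Fl s q @[s --> t] --> r.
    apply: (@cvg_comp _ _ _ (fun s => (s, q)) (fun y : R * M => Fl y.1 y.2) _ (nbhs (t, q))).
      by apply: (@cvg_pair _ _ _ (nbhs t) (nbhs t) (nbhs q)); [exact: cvg_id|exact: cvg_cst].
    exact: (flow_continuous hFl Dt).
  by apply: cF; apply: open_nbhs_nbhs; split; [exact: dom_open|].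
apply: (@isdd_near _ _ (fun s => transition S r p (chart S r (Fl s q)) 0 j)).
  by apply: filterS n1 => s ds; rewrite /transition /= chartK.
have [dv vE] := flow_ode hFl Dt.
apply: isdd_eq.
  apply: (@isdd_comp_sm _ _ _ (fun y => transition S r p y 0 j) (fun s => chart S r (Fl s q))
     (cdom S r (dom S p)) t 1 (X r)); first exact/cdom_open/dom_open.
  - exact: sm_tau.
  - exact: cdom_chart.
  - move=> k; split; first exact: derivable_dable dv.
    by rewrite -dd_mx // -[X r]vE.
rewrite fieldloc_chart // mxE; apply: eq_bigr => k _.
by rewrite /tc JacE.
Qed.

Lemma isdd_flow_time y j : flow_nbhd y ->
  isdd (fun z => flow_chart z 0 j) y (1, 0) (fieldloc S p X (flow_chart y) 0 j).
Proof.
case: y => t x /flow_nbhd_sub[/= _ Dt dp]; apply/isdd_line0.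
have -> : (fun r : R => flow_chart ((t, x) + r *: (1, 0)) 0 j) =
    (fun r => chart S p (Fl (t + r) (chart_inv S p x)) 0 j).
  apply/funext => r; rewrite /flow_chart /= scaler0 addr0.
  by rewrite [r *: _]mulr1.
rewrite -[X in isdd _ _ _ X]mulr1.
apply: (@isdd_comp1 _ (fun s => chart S p (Fl s (chart_inv S p x)) 0 j) (fun r => t + r)).
  by rewrite addr0; exact: flow_curve.
apply: isdd_eq; first exact: (isddD (isdd_cst _ _ _) (isdd_id _)).
by rewrite add0r.
Qed.

Definition flow_pt (t : R) : E := flow_chart (t, x0).

Definition flow_diff (t : R) : 'M[R]_N :=
  \matrix_(k, j) dd ((0, ebase R k) : R * E) (fun y => flow_chart y 0 j) (t, x0).

Definition field_diff (x : E) : 'M[R]_N :=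
  \matrix_(k, j) dd (ebase R k) (fun y => fieldloc S p X y 0 j) x.

Lemma line1E r : ((0, x0) + r *: ((1, 0) : R * E)) = (r, x0) :> R * E.
Proof.
by congr (_, _) => /=; rewrite ?scaler0 ?addr0 // add0r [r *: _]mulr1.
Qed.

Lemma isdd_flow_pt t j : flow_nbhd (t, x0) ->
  isdd (fun s => flow_pt s 0 j) t 1 (fieldloc S p X (flow_pt t) 0 j).
Proof.
move=> Wt; have := @isdd_flow_time (t, x0) j Wt.
rewrite -line1E => /isdd_line; rewrite line1E.
by congr (isdd _ _ _ _); apply/funext => s; rewrite line1E.
Qed.

Lemma isdd_flow_space y k j : flow_nbhd y ->
  isdd (fun z => flow_chart z 0 j) y ((0, ebase R k) : R * E)
    (dd ((0, ebase R k) : R * E) (fun z => flow_chart z 0 j) y).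
Proof. by move=> Wy; apply: dableP; exact: sm_dable (sm_flow_chart j) Wy. Qed.

(** The variational equation [L' = L DX]: the time derivative is moved inside the space derivative
    by Schwarz and replaced by the field along the flow. The order of the factors reflects the
    action on row vectors. *)
Lemma isdd_flow_diff t k j : flow_nbhd (t, x0) ->
  isdd (fun s => flow_diff s k j) t 1 ((flow_diff t *m field_diff (flow_pt t)) k j).
Proof.
move=> Wt.
have Wo := flow_nbhd_open.
pose G z := flow_chart z 0 j.
have sG : sm G flow_nbhd := @sm_flow_chart j.
have e : dd ((1, 0) : R * E) (dd ((0, ebase R k) : R * E) G) (t, x0) =
    (flow_diff t *m field_diff (flow_pt t)) k j.
  rewrite (Schwarz_sm _ _ Wo sG Wt).
  apply: isdd_dd; apply: (@isdd_near _ _ (fun z => fieldloc S p X (flow_chart z) 0 j)).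
    by apply: (open_near Wo Wt) => z Wz; rewrite (isdd_dd (isdd_flow_time j Wz)).
  apply: isdd_eq.
    apply: (@isdd_comp_sm _ _ _ (fun y => fieldloc S p X y 0 j) flow_chart (cdom S p setT) _ _
      (\row_l flow_diff t k l)); first exact: cdomT_open.
    - by apply: sm_fieldloc => //; exact: openT.
    - exact: flow_chart_cdom.
    - by move=> l; rewrite !mxE; exact: isdd_flow_space.
  by rewrite [RHS]mxE; apply: eq_bigr => l _; rewrite [field_diff _ _ _]mxE mxE.
rewrite -e.
have : isdd (dd ((0, ebase R k) : R * E) G) ((0, x0) + t *: ((1, 0) : R * E)) (1, 0)
   (dd ((1, 0) : R * E) (dd ((0, ebase R k) : R * E) G) (t, x0)).
  by rewrite line1E; apply: dableP; apply: sm_dable Wt; exact: sm_dd.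
move/isdd_line; congr (isdd _ _ _ _); apply/funext => s.
by rewrite line1E mxE.
Qed.

Lemma flow_pt0 : flow_pt 0 = x0.
Proof. by rewrite /flow_pt /flow_chart /= (flow0 hFl) chart_inv0. Qed.

Lemma flow_diff0 : flow_diff 0 = 1%:M.
Proof.
apply/matrixP => k j; rewrite !mxE.
apply: isdd_dd; apply/isdd_line0.
apply: (@isdd_near _ _ (fun r : R => (x0 + r *: ebase R k) 0 j)).
  have cv : (x0 + r *: ebase R k) @[r --> (0 : R)] --> x0.
    suff : (x0 + r *: ebase R k) @[r --> (0 : R)] --> x0 + (0 : R) *: ebase R k.
      by rewrite scale0r addr0.
    by apply: cvgD; [exact: cvg_cst|apply: cvgZr_tmp; exact: cvg_id].
  have n0 : nbhs x0 (cdom S p setT).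
    by apply: open_nbhs_nbhs; split; [exact: cdomT_open|exact: chart_cdom].
  have n1 : \forall r \near (0 : R), cdom S p setT (x0 + r *: ebase R k) by exact: cv n0.
  apply: filterS n1 => r /cdomP[_ _ e].
  by rewrite /flow_chart /= scaler0 addr0 (flow0 hFl) e.
apply: (isdd_line0 (fun y : E => y 0 j) x0 (ebase R k) _).1.
apply: isdd_eq; first exact: isdd_coord.
by rewrite mxE eqxx /= eq_sym.
Qed.

(** [dmap] ends in the chart of the image point and [flow_diff] in the chart of [p]; [fc] converts
    from the latter to the former. *)
Lemma dmap_flow t : flow_nbhd (t, x0) ->
  dmap S (Fl t) p = flow_diff t *m fc S p (Fl t p).
Proof.
move=> Wt; have [_ /=] := flow_nbhd_sub Wt; rewrite chart_inv0 => Dt dp.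
set r := Fl t p in dp *; have dr := dom_self S r.
have ptE : flow_pt t = chart S p r by rewrite /flow_pt /flow_chart /= chart_inv0.
have nr : \forall x \near x0, dom S p (Fl t (chart_inv S p x)) /\ dom S r (Fl t (chart_inv S p x)).
  have cF : Fl t (chart_inv S p x) @[x --> x0] --> r.
    apply: (@cvg_comp _ _ _ (fun x => (t, chart_inv S p x)) (fun y : R * M => Fl y.1 y.2)
      _ (nbhs (t, p))); last exact: (flow_continuous hFl Dt).
    apply: (@cvg_pair _ _ _ (nbhs x0) (nbhs t) (nbhs p)); first exact: cvg_cst.
    by have := chart_inv_continuous x0_image; rewrite /prop_for /continuous_at chart_inv0.
  have nn : nbhs r (dom S p `&` dom S r).
    by apply: open_nbhs_nbhs; split => //; apply: openI; exact: dom_open.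
  exact: cF nn.
have De k j : isdd (fun x => chart S r (Fl t (chart_inv S p x)) 0 j) x0 (ebase R k)
    ((flow_diff t *m fc S p r) k j).
  apply: (@isdd_near _ _ (fun x => transition S p r (flow_chart (t, x)) 0 j)).
    by apply: filterS nr => x [? ?]; rewrite /transition /flow_chart /= chartK.
  apply: isdd_eq.
    apply: (@isdd_comp_sm _ _ _ (fun y => transition S p r y 0 j) (fun x => flow_chart (t, x))
       (cdom S p (dom S r)) _ _ (\row_l flow_diff t k l)).
    - exact/cdom_open/dom_open.
    - exact: sm_tau.
    - by rewrite -/(flow_pt t) ptE; exact: cdom_chart.
    - move=> l; rewrite !mxE; apply/isdd_line0.
      have /isdd_line0 := isdd_flow_space k l Wt.
      congr (isdd _ _ _ _); apply/funext => s.
      by congr (flow_chart (_, _) 0 l); rewrite /= scaler0 addr0.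
  rewrite [RHS]mxE; apply: eq_bigr => l _; rewrite mxE -/(flow_pt t) ptE.
  by rewrite /fc JacE.
apply/matrixP => k j.
have dv : derivable (chart S r \o Fl t \o chart_inv S p) x0 (ebase R k).
  by apply: dable_derivable => i; exact: isdd_dable (De k i).
by rewrite /dmap mxE -/r (dd_mx j dv) -(isdd_dd (De k j)).
Qed.

End FlowInChart.

(** * Differentiability of the inverse matrix *)

Section InverseDerivative.
Variable R : realType.
Local Notation C := R[i].

Section General.
Variable V : normedModType R.
Implicit Types (f : V -> C) (x v : V).

Lemma complex_invE (z : C) :
  z^-1 = conjc z * (((complex.Re z) * (complex.Re z) + (complex.Im z) * (complex.Im z))^-1)%:C%C.
Proof.
by case: z => a b; apply: complex_eq; rewrite ?ReM ?ImM /= !expr2; ring.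
Qed.

Lemma sqr_Re_Im_eq0 (z : C) :
  (complex.Re z * complex.Re z + complex.Im z * complex.Im z == 0) = (z == 0).
Proof.
case: z => a b /=; rewrite eq_complex /=.
by rewrite paddr_eq0 ?mulf_eq0 ?orbb // -expr2 sqr_ge0.
Qed.

Lemma isdC_inv f x v l : isdC f x v l -> f x != 0 ->
  exists m, isdC (fun y => (f y)^-1) x v m.
Proof.
move=> Hf f0; have [fr fi] := Hf.
pose nf y := complex.Re (f y) * complex.Re (f y) + complex.Im (f y) * complex.Im (f y).
have n0 : nf x != 0 by rewrite sqr_Re_Im_eq0.
have Hn := @isddV _ _ nf x v _ n0 (isddD (isddM fr fr) (isddM fi fi)).
eexists; apply: isdC_near (isdCM (isdCJ Hf) (isdC_real Hn)).
by apply: nearW => y; rewrite complex_invE.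
Qed.

Lemma isdC_prod (I : Type) (r : seq I) (F : I -> V -> C) x v :
  (forall i, exists l, isdC (F i) x v l) ->
  exists l, isdC (fun y => \prod_(i <- r) F i y) x v l.
Proof.
move=> H; elim: r => [|a r [l Hl]].
  by exists 0; under eq_fun do rewrite big_nil; exact: isdC_cst.
have [k Hk] := H a.
eexists; apply: isdC_near (isdCM Hk Hl).
by apply: nearW => y; rewrite big_cons.
Qed.

Lemma isdC_sum_ex (I : Type) (r : seq I) (F : I -> V -> C) x v :
  (forall i, exists l, isdC (F i) x v l) ->
  exists l, isdC (fun y => \sum_(i <- r) F i y) x v l.
Proof.
move=> H; elim: r => [|a r [l Hl]].
  by exists 0; under eq_fun do rewrite big_nil; exact: isdC_cst.
have [k Hk] := H a.
eexists; apply: isdC_near (isdCD Hk Hl).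
by apply: nearW => y; rewrite big_cons.
Qed.

Lemma isdC_det n (F : V -> 'M[C]_n) x v :
  (forall i j, exists l, isdC (fun y => F y i j) x v l) ->
  exists l, isdC (fun y => \det (F y)) x v l.
Proof.
move=> H; apply: isdC_sum_ex => s.
have [l Hl] : exists l, isdC (fun y => \prod_i F y i (perm.fun_of_perm s i)) x v l by apply: isdC_prod.
by eexists; exact: (isdCM (isdC_cst _ _ _) Hl).
Qed.

(** Cramer's formula makes the entries of the inverse quotients of determinants. Existence of the
    derivative suffices here: the value wanted for [phi] is recovered later from the product
    rule. *)
Lemma isdmx_inv n (F : V -> 'M[C]_n) x v L : isdmx F x v L ->
  (\forall y \near x, F y \in unitmx) ->
  exists K, isdmx (fun y => invmx (F y)) x v K.
Proof.
move=> HF Fu.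
have H i j : exists l, isdC (fun y => F y i j) x v l by exists (L i j).
have [d Hd] := isdC_det H.
have d0 : \det (F x) != 0 by rewrite -unitfE -unitmxE (nbhs_singleton Fu).
have [e He] := isdC_inv Hd d0.
have Hinv i j : exists l, isdC (fun y => invmx (F y) i j) x v l.
  have [c Hc] : exists l, isdC (fun y => cofactor (F y) j i) x v l.
    have [l Hl] : exists l, isdC (fun y => \det (row' j (col' i (F y)))) x v l.
      by apply: isdC_det => k m; have [l Hl] := H (lift j k) (lift i m); exists l;
        under eq_fun do rewrite !mxE.
    by eexists; exact: (isdCM (isdC_cst _ _ _) Hl).
  eexists; apply: isdC_near (isdCM He Hc).
  by apply: filterS Fu => y uy; rewrite /invmx uy !mxE.
have [K HK] : exists K : 'I_n -> 'I_n -> C, forall i j, isdC (fun y => invmx (F y) i j) x v (K i j).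
  have [K HK] := choice (fun ij : 'I_n * 'I_n => Hinv ij.1 ij.2).
  by exists (fun i j => K (i, j)) => i j; exact: (HK (i, j)).
by exists (\matrix_(i, j) K i j) => i j; rewrite mxE.
Qed.

End General.

Lemma near_unitmx n (F : R -> 'M[C]_n) (t : R) L : isdmx F t 1 L -> F t \in unitmx ->
  \forall s \near t, F s \in unitmx.
Proof.
move=> HF Ft.
have H i j : exists l, isdC (fun y => F y i j) t 1 l by exists (L i j).
have [d [dr di]] := isdC_det H.
have c := isdd_continuous (isddD (isddM dr dr) (isddM di di)).
have p0 : 0 < complex.Re (\det (F t)) * complex.Re (\det (F t)) +
     complex.Im (\det (F t)) * complex.Im (\det (F t)).
  rewrite lt_neqAle eq_sym sqr_Re_Im_eq0 -unitfE -unitmxE Ft /=.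
  by rewrite addr_ge0 // -expr2 sqr_ge0.
move/cvgr_gt: c => /(_ _ p0); apply: filterS => s /=.
by move/gt_eqF/negbT; rewrite sqr_Re_Im_eq0 -unitfE -unitmxE.
Qed.

End InverseDerivative.

(** * Invariance of the contact planes under the flow *)

Section Preserve.
Variables (R : realType) (n : nat) (M : topologicalType).
Variables (S : smooth_atlas R n.*2 M) (H : contact_structure S).
Local Notation C := R[i].
Local Notation N := n.*2.+1.
Variables (theta : M -> 'cV[R]_N) (T X : M -> 'rV[R]_N) (g : M -> R).
Hypothesis (ht : contact_form H theta) (hT : reeb_field S theta T).
Hypothesis sX : smooth_field S setT X.
Hypothesis hX : forall p, ev (X p) (theta p) = g p /\
    forall v, Hplane H p v -> extd S theta p (X p) v = - dir S p v g.
Variables (D : set (R * M)) (Fl : R -> M -> M).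
Hypothesis hFl : is_flow S X D Fl.
Variable p : M.
Local Notation x0 := (chart S p p).
Local Notation L := (flow_diff S Fl p).
Local Notation gam := (flow_pt S Fl p).
Local Notation A := (cdom S p setT).

Lemma sm_mu : sm (mu S T g p) A.
Proof.
have oA := @cdomT_open _ _ _ S p.
have sg := sm_g ht sX hX p.
apply: (@sm_eq _ _ (fun x => \sum_k fieldloc S p T x 0 k *
    dd (ebase R k) (g \o chart_inv S p) x)) => //.
  by move=> x Ax; rewrite /mu (dd_sum _ oA sg Ax).
apply: sm_sum => // k; apply: smM => //; last exact: sm_dd.
by apply: sm_fieldloc; [exact: openT|case: hT].
Qed.

Lemma near_flow_nbhd : \forall t \near (0 : R), flow_nbhd S D Fl p (t, x0).
Proof.
have h0 := flow_nbhd0 hFl p.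
have : nbhs ((0, x0) : R * 'rV[R]_N) (flow_nbhd S D Fl p).
  by apply: open_nbhs_nbhs; split => //; exact: flow_nbhd_open.
move=> [[P Q] [/= nP nQ] PQ].
by apply: filterS nP => t Pt; apply: PQ; split => //=; exact: nbhs_singleton nQ.
Qed.

(** For [v] in the plane at [p], the function [y t = theta (v L_t)] satisfies [y' = mu y] by the
    variational equation and [lie_theta]; [y 0 = theta (v) = 0] and Gronwall conclude. *)
Lemma flow_preserves : \forall t \near (0 : R),
  flow_nbhd S D Fl p (t, x0) /\
  forall v, Hplane H p v -> v *m L t *m formloc S p theta (gam t) = 0.
Proof.
have oA := @cdomT_open _ _ _ S p.
have gam0 := flow_pt0 hFl p.
pose K : R := `|mu S T g p (gam 0)| + 1.
have cm : \forall t \near (0 : R), `|mu S T g p (gam t)| < K.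
  have c1 : {for 0, continuous gam}.
    apply: rV_continuous => j; apply: isdd_continuous.
    exact: (isdd_flow_pt hFl j (flow_nbhd0 hFl p)).
  have c2 : {for gam 0, continuous (mu S T g p)}.
    by rewrite gam0; exact: sm_continuous sm_mu (chart_cdom S p).
  have := continuous_comp c1 c2.
  move/cvgrPdist_lt => /(_ 1 ltr01); apply: filterS => t /= h.
  rewrite /K -ltrBlDl; apply: le_lt_trans h.
  by rewrite distrC; exact: lerB_dist.
(* The radius [d] is fixed before [v] appears, so one interval of times serves the whole plane. *)
have /nbhs_ballP[d /= d0 Hd] : \forall t \near (0 : R), flow_nbhd S D Fl p (t, x0) /\
    `|mu S T g p (gam t)| <= K.
  apply: filterS (filterI near_flow_nbhd cm) => t [? ?]; split => //; exact: ltW.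
apply/nbhs_ballP; exists d => //= t td; split; first by case: (Hd t td).
move=> v hv; rewrite [LHS]mx11_scalar.
pose y t := (v *m L t *m formloc S p theta (gam t)) 0 0.
rewrite -/(y t) (_ : y t = 0) ?raddf0 //.
have bd s : `|s| < d -> ball (0 : R) d s by rewrite -ball_normE /= sub0r normrN.
apply: (@gronwall0 _ y (fun t => mu S T g p (gam t)) d K).
- move=> s sd; have [Ws Ks] := Hd s (bd s sd); split=> //.
  have As : A (gam s) by exact: flow_chart_cdom Ws.
  have sth l : sm (fun y => formloc S p theta y l 0) A by apply: sm_formloc; case: ht.
  have d1 l : isdd (fun t => (v *m L t) 0 l) s 1 ((v *m (L s *m field_diff S X p (gam s))) 0 l).
    under eq_fun do rewrite mxE; rewrite mxE; apply: isdd_sum => k _.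
    apply: isdd_eq; first exact: (isddM (isdd_cst _ _ _) (isdd_flow_diff sX hFl k l Ws)).
    by rewrite mul0r add0r.
  have d2 l : isdd (fun t => formloc S p theta (gam t) l 0) s 1
      (\sum_k fieldloc S p X (gam s) 0 k *
       dd (ebase R k) (fun y => formloc S p theta y l 0) (gam s)).
    apply: (@isdd_comp_sm _ _ _ (fun y => formloc S p theta y l 0) gam A) => //.
    by move=> k; exact: (isdd_flow_pt hFl k Ws).
  rewrite /y; under eq_fun do rewrite mxE.
  apply: isdd_eq; first by apply: isdd_sum => l _; exact: (isddM (d1 l) (d2 l)).
  rewrite big_split /=.
  have -> : \sum_l (v *m (L s *m field_diff S X p (gam s))) 0 l * formloc S p theta (gam s) l 0 =
     \sum_k (v *m L s) 0 k * \sum_l field_diff S X p (gam s) k l * formloc S p theta (gam s) l 0.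
    transitivity ((v *m L s *m (field_diff S X p (gam s) *m formloc S p theta (gam s))) 0 0).
      by rewrite [in RHS]mulmxA -[in RHS](mulmxA v) [RHS]mxE.
    by rewrite mxE; apply: eq_bigr => k _; rewrite [(field_diff _ _ _ _ *m _) _ _]mxE.
  rewrite -big_split mxE mulr_sumr; apply: eq_bigr => k _ /=.
  rewrite mulrCA -(lie_theta ht hT sX hX k As) -mulrDr; congr (_ * _).
  rewrite -big_split; apply: eq_bigr => l _ /=.
  by rewrite [field_diff _ _ _ _ _ _]mxE addrC.
- rewrite /y gam0 (flow_diff0 hFl) mulmx1 formloc_chart ?fc_id ?mul1mx; last exact: dom_self.
  exact: (HplaneE p ht v).1.
- by move: td; rewrite -ball_normE /= sub0r normrN.
Qed.

End Preserve.

Lemma mxCE (R : realType) a b (A : 'M[R]_(a, b)) i j : mxC A i j = ((A i j)%:C)%C.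
Proof. exact: mxE. Qed.

(** * The derivative of the deformation *)

Section PhiDerivative.
Variables (R : realType) (n : nat) (M : topologicalType).
Variables (S : smooth_atlas R n.*2 M) (H : contact_structure S).
Local Notation C := R[i].
Local Notation N := n.*2.+1.
Variable J : M -> 'M[R]_N.
Hypothesis hJ : compatible_almost_CR H J.
Variables (theta : M -> 'cV[R]_N) (T X : M -> 'rV[R]_N) (g : M -> R).
Hypothesis (ht : contact_form H theta) (hT : reeb_field S theta T).
Hypothesis sX : smooth_field S setT X.
Hypothesis hX : forall p, ev (X p) (theta p) = g p /\
    forall v, Hplane H p v -> extd S theta p (X p) v = - dir S p v g.
Variables (D : set (R * M)) (Fl : R -> M -> M).
Hypothesis hFl : is_flow S X D Fl.
Variable phi : R -> M -> 'M[C]_N.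
Hypothesis hphi : graph_deformation H J Fl phi.
Variable p : M.
Local Notation x0 := (chart S p p).
Local Notation L := (flow_diff S Fl p).
Local Notation gam := (flow_pt S Fl p).
Local Notation A := (cdom S p setT).

Definition Hproj q : 'M[R]_N := 1%:M - theta q *m T q.

(* [J] is meaningful only on the contact hyperplane, so it is first precomposed
   with the projection along [T]. *)
Definition Jloc (x : 'rV[R]_N) : 'M[R]_N :=
  let q := chart_inv S p x in fc S p q *m (Hproj q *m J q) *m tc S p q.

Lemma Hproj_H q v : Hplane H q (v *m Hproj q).
Proof.
apply/(HplaneE q ht); rewrite /ev /Hproj mulmxBr mulmx1 mulmxBl mulmxA -(mulmxA _ (T q)).
have [_ /(_ q)[Tt _]] := hT.
by rewrite [T q *m _]mx11_scalar -/(ev _ _) Tt mulmx1 subrr mxE.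
Qed.

(** Smoothness of [J] is available only through its action on smooth contact fields. The [k]-th row
    of [Jloc] is [J] applied to the contact projection [Y] of the [k]-th coordinate field. *)
Lemma sm_Jloc k j : sm (fun x => Jloc x k j) A.
Proof.
have op := dom_open S p.
have sub : A `<=` cdom S p (dom S p) by move=> x [q [dq _] <-]; exists q.
pose Y q : 'rV[R]_N := ebase R k *m fc S p q *m Hproj q.
have sY : smooth_field S (dom S p) Y.
  apply: (@smooth_field_loc _ _ _ S _ _ p) => // i.
  apply: (@sm_eq _ _ (fun x => (k == i)%:R -
      formloc S p theta x k 0 * fieldloc S p T x 0 i)); first exact: cdom_open.
    move=> x /cdomP[dx _ _]; set q := chart_inv S p x in dx *.
    have -> : fieldloc S p Y x =
        ebase R k - (ebase R k *m formloc S p theta x) *m fieldloc S p T x.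
      rewrite /fieldloc /formloc -/q /Y /Hproj mulmxBr mulmx1 mulmxBl.
      rewrite -(mulmxA (ebase R k) (fc S p q) (tc S p q)).
      by rewrite fc_tc // mulmx1 !mulmxA.
    move: (formloc S p theta x) (fieldloc S p T x) => a b.
    by rewrite /ebase -rowE !mxE big_ord1 !mxE eqxx /= eq_sym.
  apply: smB; [exact: cdom_open|exact: sm_cst|].
  apply: smM; first exact: cdom_open.
    by apply: sm_sub (sm_formloc p k ht.1); apply: cdom_sub.
  have := @sm_fieldloc _ _ _ S _ _ p i openT hT.1.
  by apply: sm_sub; apply: cdom_sub.
have HY q : dom S p q -> Hplane H q (Y q) by move=> _; exact: Hproj_H.
have sYJ := CR_smooth hJ op HY sY.
have := @sm_fieldloc _ _ _ S _ _ p j op sYJ.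
move/(sm_sub sub); congr (sm _ _); apply/funext => x.
rewrite /fieldloc /Y /Jloc /=.
set q := chart_inv S p x.
have -> : ebase R k *m fc S p q *m Hproj q *m J q *m tc S p q =
  ebase R k *m (fc S p q *m (Hproj q *m J q) *m tc S p q) by rewrite !mulmxA.
by rewrite /ebase -rowE mxE.
Qed.

Lemma Jloc0 : Jloc x0 = Hproj p *m J p.
Proof. by rewrite /Jloc chart_inv0 fc_id tc_id mul1mx mulmx1. Qed.

Lemma near_diff_unit : \forall t \near (0 : R), L t \in unitmx.
Proof.
have HL : isdmx (fun t => mxC (L t)) 0 1 (mxC (L 0 *m field_diff S X p (gam 0))).
  move=> i j; rewrite mxE; under eq_fun do rewrite mxE; apply: isdC_real.
  exact: (isdd_flow_diff sX hFl i j (flow_nbhd0 hFl p)).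
have := near_unitmx HL; rewrite (flow_diff0 hFl) mxC1 => /(_ (unitmx1 _ _)).
by apply: filterS => t; rewrite map_unitmx.
Qed.

Lemma CH_mulC q (V : 'rV[C]_N) k (B : 'M[R]_(N, k)) :
  (forall v, Hplane H q v -> v *m B = 0) -> CH H q V -> V *m mxC B = 0.
Proof.
move=> h [r i]; rewrite [V]mxRe_real mulmxDl -scalemxAl -!mxC_mul !h //.
by rewrite mxC0 scaler0 addr0.
Qed.

(** [Z + phi_t Z] is an eigenvector of the pulled-back structure, so its image under the flow is one
    of [J] at the image point. That image is a contact vector by [flow_preserves], so [Hproj] fixes
    it and [J] may be replaced by [Jloc]. *)
Lemma phi_equation : \forall t \near (0 : R), forall Z, H10 H J p Z ->
  H01 H J p (Z *m phi t p) /\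
  (Z + Z *m phi t p) *m (mxC (L t) *m (mxC (Jloc (gam t)) - ('i%C)%:M)) = 0.
Proof.
have := flow_preserves ht hT sX hX hFl p.
move=> np; apply: filterS (filterI np (filterI near_diff_unit (hphi p))).
move=> t [[Wt pres] [Lu [h01 hgraph]]] Z hZ.
split; first exact: h01.
have [hV eV] := (hgraph (Z + Z *m phi t p)).2 (ex_intro2 _ _ Z hZ erefl).
move: hV eV; set V := Z + _ => hV eV.
have [_ /=] := flow_nbhd_sub Wt; rewrite chart_inv0 => Dt dp.
set r := Fl t p in dp *.
have ptE : gam t = chart S p r by rewrite /flow_pt /flow_chart /= chart_inv0.
have irE : chart_inv S p (gam t) = r by rewrite ptE chartK.
have fcu : fc S p r \in unitmx by case: (mulmx1_unit (fc_tc dp)).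
have dFu : dmap S (Fl t) p \in unitmx by rewrite (dmap_flow hFl Wt) unitmx_mul Lu.
have eV' : V *m mxC (dmap S (Fl t) p) *m mxC (J r) = 'i%C *: (V *m mxC (dmap S (Fl t) p)).
  rewrite scalemxAl -eV /pulled_J !mxC_mul !mulmxA -(mulmxA _ (mxC (invmx _))).
  by rewrite -mxC_mul mulVmx // mxC1 mulmx1.
have Vtheta : V *m mxC (dmap S (Fl t) p) *m mxC (theta r) = 0.
  rewrite -mulmxA -mxC_mul; apply: CH_mulC hV => v /pres.
  by rewrite /formloc irE -!mulmxA (dmap_flow hFl Wt) -!mulmxA.
have VP : V *m mxC (dmap S (Fl t) p) *m mxC (Hproj r) = V *m mxC (dmap S (Fl t) p).
  rewrite /Hproj mxCD mxCN mxC1 mxC_mul mulmxBr mulmx1.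
  by rewrite [X in _ - X]mulmxA Vtheta mul0mx subr0.
have dL : mxC (dmap S (Fl t) p) *m mxC (tc S p r) = mxC (L t).
  by rewrite (dmap_flow hFl Wt) -mxC_mul -mulmxA fc_tc // mulmx1.
rewrite mulmxBr mul_mx_scalar mulmxBr -scalemxAr; apply/eqP; rewrite subr_eq0; apply/eqP.
rewrite /Jloc irE !mxC_mul !mulmxA -(mulmxA V) -mxC_mul -(dmap_flow hFl Wt).
by rewrite VP eV' -scalemxAl -mulmxA dL.
Qed.

Lemma H10_Jloc Z : H10 H J p Z -> Z *m mxC (Jloc x0) = 'i%C *: Z.
Proof.
move=> [hZ eZ]; rewrite Jloc0 mxC_mul mulmxA.
have -> : Z *m mxC (Hproj p) = Z; last exact: eZ.
rewrite /Hproj mxCD mxCN mxC1 mxC_mul mulmxBr mulmx1 mulmxA.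
by rewrite (CHE ht p Z).1 // mul0mx subr0.
Qed.

Lemma H01_Jloc Z : H01 H J p Z -> Z *m mxC (Jloc x0) = - 'i%C *: Z.
Proof.
move=> [hZ eZ]; rewrite Jloc0 mxC_mul mulmxA.
have -> : Z *m mxC (Hproj p) = Z; last exact: eZ.
rewrite /Hproj mxCD mxCN mxC1 mxC_mul mulmxBr mulmx1 mulmxA.
by rewrite (CHE ht p Z).1 // mul0mx subr0.
Qed.

(** The derivative at [t = 0] of [L_t (Jloc - i)] along the flow line, by the product rule with
    [L_0 = 1] and [L_0' = DX]. *)
Definition dphi_rhs : 'M[C]_N :=
  mxC (field_diff S X p x0) *m (mxC (Jloc x0) - ('i%C)%:M) +
  dV (mxC (fieldloc S p X x0)) (fun x => mxC (Jloc x)) x0.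

(** Inverting [F] first proves that [phi] is differentiable; only then may [Z phi_t F_t = - Z B_t]
    be differentiated to compute the derivative. *)
Lemma phi_derivative Z : H10 H J p Z ->
  isdmx (fun t => Z *m phi t p) 0 (1 : R) ((2%:R * 'i%C)^-1 *: (Z *m dphi_rhs)).
Proof.
move=> hZ.
pose B t := mxC (L t) *m (mxC (Jloc (gam t)) - ('i%C)%:M).
have HL : isdmx (fun t => mxC (L t)) 0 1 (mxC (L 0 *m field_diff S X p (gam 0))).
  move=> i j; rewrite mxE; under eq_fun do rewrite mxE; apply: isdC_real.
  exact: (isdd_flow_diff sX hFl i j (flow_nbhd0 hFl p)).
have HJ : isdmx (fun t => mxC (Jloc (gam t))) 0 1
    (dV (mxC (fieldloc S p X x0)) (fun x => mxC (Jloc x)) x0).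
  move=> i j; under eq_fun do rewrite mxE.
  apply: isdC_eq.
    apply: isdC_real.
    apply: (@isdd_comp_sm _ _ _ (fun x => Jloc x i j) gam A 0 1 (fieldloc S p X (gam 0))).
    - exact: cdomT_open.
    - exact: sm_Jloc.
    - by rewrite (flow_pt0 hFl); exact: chart_cdom.
    - by move=> k; exact: (isdd_flow_pt hFl k (flow_nbhd0 hFl p)).
  rewrite (flow_pt0 hFl) summxE rmorph_sum; apply: eq_bigr => k _.
  rewrite rmorphM [RHS]mxE mxCE [dmx _ _ _ _ _]mxE; congr (_ * _); apply: complex_eq => /=.
    by congr (dd _ _ _); apply/funext => x; rewrite mxCE.
  rewrite (_ : (fun y => complex.Im (mxC (Jloc y) i j)) = fun=> 0).
    by rewrite (isdd_dd (isdd_cst _ _ _)).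
  by apply/funext => x; rewrite mxCE.
have HB : isdmx B 0 1 dphi_rhs.
  apply: isdmx_eq; first exact: (isdmxM HL (isdmxB HJ (isdmx_cst _ _ _))).
  by rewrite subr0 (flow_diff0 hFl) (flow_pt0 hFl) mul1mx mxC1 mul1mx.
have B0 : B 0 = mxC (Jloc x0) - ('i%C)%:M.
  by rewrite /B (flow_diff0 hFl) (flow_pt0 hFl) mxC1 mul1mx.
(* On [H^{0,1}] the matrix [B 0] is multiplication by [- 2i], so there [F t] acts like [B t], while
   [F 0 = - 2i] is invertible on the whole space. *)
pose F t := B t - B 0 - (2%:R * 'i%C)%:M.
have HF : isdmx F 0 1 dphi_rhs.
  apply: isdmx_eq; first exact: (isdmxB (isdmxB HB (isdmx_cst _ _ _)) (isdmx_cst _ _ _)).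
  by rewrite !subr0.
have c0 : (2%:R * 'i%C : C) != 0 by rewrite mulf_neq0 ?pnatr_eq0 ?i_neq0.
have F0 : F 0 = (- (2%:R * 'i%C))%:M by rewrite /F subrr sub0r raddfN.
have Fu : F 0 \in unitmx by rewrite F0 -scalemx1 unitmxZ ?unitmx1 // unitfE oppr_eq0.
have nFu := near_unitmx HF Fu.
have [K HK] := isdmx_inv HF nFu.
have eq_t : \forall t \near (0 : R), Z *m phi t p *m F t = - (Z *m B t).
  apply: filterS phi_equation => t /(_ Z hZ)[h01 e].
  rewrite /F !mulmxBr mul_mx_scalar B0 mulmxBr mul_mx_scalar (H01_Jloc h01).
  move/eqP: e; rewrite -/(B t) mulmxDl addrC addr_eq0 => /eqP ->.
  rewrite -scalerBl -addrA -opprD -scalerDl.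
  rewrite (_ : - 'i%C - 'i%C + 2%:R * 'i%C = 0) ?scale0r ?subr0 //; ring.
have solve_t : \forall t \near (0 : R), (- (Z *m B t)) *m invmx (F t) = Z *m phi t p.
  apply: filterS (filterI eq_t nFu) => t [<- Ft]; exact: mulmxK.
have HZ := isdmx_cst Z (0 : R) 1.
have Hsol := isdmx_near solve_t (isdmxM (isdmxN (isdmxM HZ HB)) HK).
apply: isdmx_eq; first exact: Hsol.
have Y0 : Z *m phi 0 p = 0.
  rewrite -(nbhs_singleton solve_t) B0 mulmxBr mul_mx_scalar (H10_Jloc hZ) subrr.
  by rewrite oppr0 mul0mx.
(* As [Z phi_0 = 0], the derivative of [F] drops out of the product rule, and [F 0 = - 2i] leaves
   the derivative of [phi] up to that factor. *)
have := isdmx_dmx (isdmxM Hsol HF).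
rewrite Y0 mul0mx addr0 F0 mul_mx_scalar.
rewrite (dmx_near _ eq_t) (isdmx_dmx (isdmxN (isdmxM HZ HB))) mul0mx add0r => e.
apply: (scalerI c0); rewrite scalerA divff // scale1r.
by apply: oppr_inj; rewrite -scaleNr; exact: esym e.
Qed.

Lemma phi_derivableC Z j : H10 H J p Z -> derivableC (fun t => (Z *m phi t p) 0 j) 0.
Proof.
by move=> /phi_derivative/(_ 0 j)[[r _] [i _]]; move: r i; rewrite dable.unlock.
Qed.

Lemma infinitesimal_deformationE Z : H10 H J p Z ->
  infinitesimal_deformation phi p Z = (2%:R * 'i%C)^-1 *: (Z *m dphi_rhs).
Proof.
move=> hZ; apply/rowP => j; rewrite mxE /deriveC.
have [/isdd_dd r /isdd_dd i] := phi_derivative hZ 0 j.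
by move: r i; rewrite dd.unlock => -> ->; case: (_ 0 j).
Qed.

End PhiDerivative.

Lemma mxRe_lmul (R : realType) a b c (B : 'M[R]_(a, b)) (V : 'M[R[i]]_(b, c)) :
  mxRe (mxC B *m V) = B *m mxRe V.
Proof.
apply/matrixP => i j; rewrite !mxE Re_sum; apply: eq_bigr => k _.
by rewrite !mxE ReM /= mul0r subr0.
Qed.

Lemma mxIm_lmul (R : realType) a b c (B : 'M[R]_(a, b)) (V : 'M[R[i]]_(b, c)) :
  mxIm (mxC B *m V) = B *m mxIm V.
Proof.
apply/matrixP => i j; rewrite !mxE Im_sum; apply: eq_bigr => k _.
by rewrite !mxE ImM /= mul0r addr0.
Qed.

Lemma col_mulmx (K : pzRingType) a b c (A : 'M[K]_(a, b)) (B : 'M[K]_(b, c)) j :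
  col j (A *m B) = A *m col j B.
Proof. by rewrite !colE mulmxA. Qed.

Lemma bform_mxD (R : realType) N (V W : 'rV[R[i]]_N) (A B : 'M[R[i]]_N) :
  bform V (A + B) W = bform V A W + bform V B W.
Proof. by rewrite /bform mulmxDr mulmxDl mxE. Qed.

Lemma bform_mxZ (R : realType) N (V W : 'rV[R[i]]_N) c (A : 'M[R[i]]_N) :
  bform V (c *: A) W = c * bform V A W.
Proof. by rewrite /bform -scalemxAr -scalemxAl mxE. Qed.

Lemma ev_conj (R : realType) N (V : 'rV[R[i]]_N) (e : 'cV[R[i]]_N) :
  ev (mxconj V) (mxconj e) = conjc (ev V e).
Proof. by rewrite /ev -mxconj_mul mxE. Qed.

(** * Frames, coframes and gradients in the chart of [p] *)

Section FrameInChart.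
Variables (R : realType) (n : nat) (M : topologicalType).
Variables (S : smooth_atlas R n.*2 M) (H : contact_structure S).
Local Notation C := R[i].
Local Notation N := n.*2.+1.
Variable J : M -> 'M[R]_N.
Hypothesis hJ : compatible_almost_CR H J.
Variables (theta : M -> 'cV[R]_N) (T : M -> 'rV[R]_N).
Hypothesis (ht : contact_form H theta) (hT : reeb_field S theta T).
Variables (U : set M) (Z : M -> 'M[C]_(n, N)) (th : M -> 'M[C]_(N, n)).
Hypothesis hZ : admissible_frame H J T U Z th.
Variable p : M.
Hypothesis Up : U p.
Local Notation x0 := (chart S p p).
Local Notation A := (cdom S p U).
Local Notation ci := (chart_inv S p).

Definition Zloc x : 'M[C]_(n, N) := Z (ci x) *m mxC (tc S p (ci x)).
Definition thloc x : 'M[C]_(N, n) := mxC (fc S p (ci x)) *m th (ci x).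
Definition thetaloc x : 'cV[C]_N := mxC (formloc S p theta x).
Definition Xloc (X : M -> 'rV[R]_N) x : 'rV[C]_N := mxC (fieldloc S p X x).

Lemma U_open : open U. Proof. by case: hZ. Qed.
Lemma A_open : open A. Proof. exact/cdom_open/U_open. Qed.
Lemma A_x0 : A x0. Proof. by apply: cdom_chart => //; exact: dom_self. Qed.
Lemma A_subT : A `<=` cdom S p setT. Proof. exact: cdom_sub. Qed.

Lemma admissible_p q : U q -> admissible_at H J T q (Z q) (th q).
Proof. by case: hZ => _ _ _; apply. Qed.

Lemma smx_Zloc : smx Zloc A.
Proof.
move=> a j; have [_ /(_ a)[hr hi] _ _] := hZ.
have := sm_fieldloc p j U_open hr; have := sm_fieldloc p j U_open hi.
move=> si sr; split.
  apply: sm_eq sr; first exact: A_open.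
  by move=> x _; rewrite /fieldloc -mxRe_mul -row_mul !mxE.
apply: sm_eq si; first exact: A_open.
by move=> x _; rewrite /fieldloc -mxIm_mul -row_mul !mxE.
Qed.

Lemma smx_thloc : smx thloc A.
Proof.
move=> i c; have [_ _ /(_ c)[hr hi] _] := hZ.
have := sm_formloc p i hr; have := sm_formloc p i hi.
move=> si sr; split.
  apply: sm_eq sr; first exact: A_open.
  by move=> x _; rewrite /formloc -mxRe_lmul -col_mulmx !mxE.
apply: sm_eq si; first exact: A_open.
by move=> x _; rewrite /formloc -mxIm_lmul -col_mulmx !mxE.
Qed.

Lemma smx_thetaloc : smx thetaloc A.
Proof.
apply: smxC => i j; rewrite (ord1 j).
by apply: sm_sub A_subT _; apply: sm_formloc; case: ht.
Qed.

Lemma smx_Xloc X : smooth_field S setT X -> smx (Xloc X) A.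
Proof.
move=> sX; apply: smxC => i j; rewrite (ord1 i).
by apply: sm_sub A_subT _; apply: sm_fieldloc => //; exact: openT.
Qed.

Lemma tcfcC x : A x -> mxC (tc S p (ci x)) *m mxC (fc S p (ci x)) = 1%:M.
Proof. by move=> /cdomP[dx _ _]; rewrite -mxC_mul tc_fc // mxC1. Qed.

Lemma fctcC x : A x -> mxC (fc S p (ci x)) *m mxC (tc S p (ci x)) = 1%:M.
Proof. by move=> /cdomP[dx _ _]; rewrite -mxC_mul fc_tc // mxC1. Qed.

Lemma loc_mul a b (V : 'M[C]_(a, N)) (W : 'M[C]_(N, b)) x : A x ->
  (V *m mxC (tc S p (ci x))) *m (mxC (fc S p (ci x)) *m W) = V *m W.
Proof. by move=> Ax; rewrite mulmxA -(mulmxA V) tcfcC // mulmx1. Qed.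

Lemma A_U x : A x -> U (ci x). Proof. by case/cdomP. Qed.

Lemma XlocE X x : Xloc X x = mxC (X (ci x)) *m mxC (tc S p (ci x)).
Proof. by rewrite /Xloc /fieldloc mxC_mul. Qed.
Lemma thetalocE x : thetaloc x = mxC (fc S p (ci x)) *m mxC (theta (ci x)).
Proof. by rewrite /thetaloc /formloc mxC_mul. Qed.

Lemma Zloc_thlocc x : A x -> Zloc x *m mxconj (thloc x) = 0.
Proof.
move=> Ax; rewrite /thloc mxconj_mul mxconj_real loc_mul //.
exact: Z_thc (admissible_p (A_U Ax)).
Qed.
Lemma Zloc_theta x : A x -> Zloc x *m thetaloc x = 0.
Proof.
by move=> Ax; rewrite thetalocE loc_mul // (Z_theta ht (admissible_p (A_U Ax))).
Qed.

Lemma extm_real (e : 'rV[R]_N -> 'cV[R]_N) x :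
  extm (fun y => mxC (e y)) x = mxC (rext e x).
Proof.
have d (k l : 'I_N) : dmx (ebase R k) (fun y => mxC (e y)) x l 0 =
    ((dd (ebase R k) (fun y => e y l 0) x)%:C)%C.
  rewrite mxE; apply: complex_eq => /=.
    by congr (dd _ _ _); apply/funext => y; rewrite mxCE.
  rewrite (_ : (fun y => complex.Im (mxC (e y) l 0)) = fun=> 0).
    by rewrite (isdd_dd (isdd_cst _ _ _)).
  by apply/funext => y; rewrite mxCE.
by apply/matrixP => k l; rewrite mxE mxCE [rext _ _ _ _]mxE !d rmorphB.
Qed.

Lemma bform_loc x (V W : 'rV[C]_N) : A x ->
  bform (V *m mxC (tc S p (ci x))) (extm thetaloc x) (W *m mxC (tc S p (ci x))) =
  bform V (mxC (dtheta S theta (ci x))) W.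
Proof.
move=> Ax; have [dx Ux ex] := cdomP Ax.
rewrite extm_real /dtheta.
rewrite (@rext_tau _ _ _ S setT theta p) //; last 2 first.
- exact: openT.
- by case: ht.
by rewrite ex /bform !mxC_mul mxC_tr trmx_mul !mulmxA.
Qed.

Lemma row_Zloc a x : row a (Zloc x) = row a (Z (ci x)) *m mxC (tc S p (ci x)).
Proof. by rewrite row_mul. Qed.

Lemma bform_Zloc_Zloc x a b : A x ->
  bform (row a (Zloc x)) (extm thetaloc x) (row b (Zloc x)) = 0.
Proof.
move=> Ax; rewrite !row_Zloc bform_loc //.
exact: (Om_Z_Z hJ ht (admissible_p (A_U Ax))).
Qed.

Lemma ci0 : ci x0 = p. Proof. exact: chart_inv0. Qed.
Lemma Zloc0 : Zloc x0 = Z p.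
Proof. by rewrite /Zloc ci0 tc_id mxC1 mulmx1. Qed.
Lemma thloc0 : thloc x0 = th p.
Proof. by rewrite /thloc ci0 fc_id mxC1 mul1mx. Qed.
Lemma Xloc0 X : Xloc X x0 = mxC (X p).
Proof. by rewrite XlocE ci0 tc_id mxC1 mulmx1. Qed.
(** Scalar functions are treated as 1 by 1 matrices, so that the product rules for matrices apply to
    components; smoothness is needed to expand the real directional derivatives in the basis. *)
Lemma dirC_dV (G : M -> C) V : smx (fun x => ((G (ci x))%:M : 'M[C]_1)) A ->
  dirC S p V G = dV V (fun x => (G (ci x))%:M : 'M[C]_1) x0 0 0.
Proof.
move=> sG.
have [sr si] := sG 0 0.
have e1 : (fun q => complex.Re (G q)) \o ci = (fun x => complex.Re (((G (ci x))%:M : 'M[C]_1) 0 0)).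
  by apply/funext => x; rewrite /= mxE mulr1n.
have e2 : (fun q => complex.Im (G q)) \o ci = (fun x => complex.Im (((G (ci x))%:M : 'M[C]_1) 0 0)).
  by apply/funext => x; rewrite /= mxE mulr1n.
rewrite /dirC !dirE e1 e2 !(dd_sum _ A_open sr A_x0) !(dd_sum _ A_open si A_x0).
rewrite /dV summxE; apply: complex_eq => /=.
  rewrite Re_sum -sumrB; apply: eq_bigr => k _.
  by rewrite !mxE ReM.
rewrite Im_sum -big_split; apply: eq_bigr => k _.
by rewrite !mxE ImM.
Qed.

Lemma extdC_loc c V W :
  extdC S (fun q => col c (th q)) p V W = bform V (extm (fun x => col c (thloc x)) x0) W.
Proof.
have [_ _ /(_ c)[hr hi] _] := hZ.
have e (eta : M -> 'cV[R]_N) v w : smooth_form S U eta ->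
    extd S eta p v w = (v *m rext (formloc S p eta) x0 *m w^T) 0 0.
  move=> se; rewrite (@extdE _ _ _ S U eta p p) ?tc_id ?mulmx1 //; first exact: U_open.
  exact: dom_self.
rewrite /extdC (bilinC_form (B := rext (formloc S p (fun q => mxRe (col c (th q)))) x0)); last first.
  by move=> v w; exact: e.
rewrite (bilinC_form (B := rext (formloc S p (fun q => mxIm (col c (th q)))) x0)); last first.
  by move=> v w; exact: e.
have -> : extm (fun x => col c (thloc x)) x0 =
    mxC (rext (formloc S p (fun q => mxRe (col c (th q)))) x0) +
    'i%C *: mxC (rext (formloc S p (fun q => mxIm (col c (th q)))) x0).
  have dr (k l : 'I_N) : complex.Re (dmx (ebase R k) (fun x => col c (thloc x)) x0 l 0) =
      dd (ebase R k) (fun y => formloc S p (fun q => mxRe (col c (th q))) y l 0) x0.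
    rewrite mxE /=; congr (dd _ _ _); apply/funext => y.
    by rewrite /formloc -mxRe_lmul -col_mulmx [RHS]mxE.
  have di (k l : 'I_N) : complex.Im (dmx (ebase R k) (fun x => col c (thloc x)) x0 l 0) =
      dd (ebase R k) (fun y => formloc S p (fun q => mxIm (col c (th q))) y l 0) x0.
    rewrite mxE /=; congr (dd _ _ _); apply/funext => y.
    by rewrite /formloc -mxIm_lmul -col_mulmx [RHS]mxE.
  apply/matrixP => k l; rewrite mxE [RHS]mxE [X in _ = _ + X]mxE !mxCE.
  rewrite ![rext _ _ _ _]mxE -!dr -!di.
  by apply: complex_eq; rewrite ?(ReD, ImD, ReN, ImN, ReM, ImM) /=; ring.
by rewrite bform_mxD bform_mxZ.
Qed.

Local Notation hmx q := (levi_mx S J theta q (Z q)).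

Lemma levi_loc b c x : A x -> hmx (ci x) b c =
  - 'i%C * bform (row b (Zloc x)) (extm thetaloc x) (mxconj (row c (Zloc x))).
Proof.
move=> Ax; rewrite !row_Zloc mxconj_mul mxconj_real bform_loc //.
exact: (levi_mxE ht (admissible_p (A_U Ax))).
Qed.

Lemma smx_levi b c : smx (fun x => (hmx (ci x) b c)%:M : 'M[C]_1) A.
Proof.
apply: (@smx_eq _ _ _ A_open _ _ (fun x => - 'i%C *: (row b (Zloc x) *m
    extm thetaloc x *m (mxconj (row c (Zloc x)))^T))).
  by move=> x Ax; rewrite levi_loc // [LHS]mx11_scalar mxE.
apply: smxZ; first exact: A_open.
apply: smxM; first exact: A_open.
  apply: smxM; [exact: A_open|exact/smx_row/smx_Zloc|].
  by apply: smx_extm => //; [exact: A_open|exact: smx_thetaloc].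
by apply/smx_tr/smxJ; [exact: A_open|exact/smx_row/smx_Zloc].
Qed.

Section Gradient.
Variable g : M -> R.
Hypothesis sg : forall q, sm (g \o chart_inv S q) (cdom S q setT).

Definition gradloc x : 'cV[C]_N := mxC (\col_k dd (ebase R k) (g \o ci) x).

Lemma smx_gradloc : smx gradloc A.
Proof.
apply: smxC => k j; under eq_fun do rewrite mxE.
by apply: sm_dd; exact: sm_sub A_subT _.
Qed.

Lemma extm_gradloc x : A x -> extm gradloc x = 0.
Proof.
move=> Ax; rewrite extm_real -[RHS]mxC0; congr mxC; apply/matrixP => k l; rewrite !mxE.
have e (i j : 'I_N) : dd (ebase R i) (fun y => (\col_k dd (ebase R k) (g \o ci) y) j 0) x =
    dd (ebase R i) (dd (ebase R j) (g \o ci)) x.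
  by congr (dd _ _ _); apply/funext => y; rewrite mxE.
by rewrite !e (Schwarz_sm _ _ A_open (sm_sub A_subT (sg p)) Ax) subrr.
Qed.

Lemma dirC_grad V x : A x -> dirC S (ci x) V (fun q => (g q)%:C%C) =
  ev (V *m mxC (tc S p (ci x))) (gradloc x).
Proof.
move=> Ax; have [dx Ux ex] := cdomP Ax.
have d0 v : dir S (ci x) v (fun q => complex.Im (g q)%:C%C) = 0.
  by rewrite dirE; exact: isdd_dd (isdd_cst _ _ _).
have d1 v : dir S (ci x) v (fun q => complex.Re (g q)%:C%C) =
    (v *m tc S p (ci x) *m \col_k dd (ebase R k) (g \o ci) x) 0 0.
  have oT : open (setT : set M) by exact: openT.
  rewrite (@dir_transport _ _ _ S setT p _ _ _ oT I dx (sg p)).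
  rewrite ex (dd_sum _ (@cdomT_open _ _ _ S p) (sg p)); last exact: A_subT.
  by rewrite [RHS]mxE; apply: eq_bigr => k _; congr (_ * _); rewrite mxE.
rewrite /dirC !d0 !d1 subr0 add0r /gradloc /ev -!mulmxA -mxC_mul.
move: (tc _ _ _ *m _) => u.
rewrite [V in RHS]mxRe_real mulmxDl -scalemxAl -!mxC_mul.
move: (mxRe V *m u) (mxIm V *m u) => a b; rewrite !mxE.
by apply: complex_eq; rewrite ?(ReD, ImD, ReM, ImM) /=; ring.
Qed.

Lemma nab_loc b x : A x -> nab S g Z b (ci x) = ev (row b (Zloc x)) (gradloc x).
Proof. by move=> Ax; rewrite /nab dirC_grad // row_Zloc. Qed.

Lemma nabbar_loc b x : A x ->
  nabbar S g Z b (ci x) = ev (mxconj (row b (Zloc x))) (gradloc x).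
Proof.
move=> Ax; rewrite /nabbar dirC_grad // row_Zloc mxconj_mul mxconj_real.
by congr (ev (_ *m _) _); apply/matrixP => i j; rewrite !mxE.
Qed.

Lemma nabbar_conj b x : A x ->
  nabbar S g Z b (ci x) = conjc (nab S g Z b (ci x)).
Proof.
move=> Ax; rewrite nabbar_loc // nab_loc // -ev_conj.
by rewrite /gradloc mxconj_real.
Qed.

End Gradient.
End FrameInChart.

Lemma smx_sum (R : realType) N (A : set 'rV[R]_N) a b I (r : seq I)
    (F : I -> 'rV[R]_N -> 'M[R[i]]_(a, b)) : open A ->
  (forall i, smx (F i) A) -> smx (fun y => \sum_(i <- r) F i y) A.
Proof.
move=> oA H i j; split; under eq_fun do rewrite summxE ?Re_sum ?Im_sum;
  by apply: sm_sum => // k; case: (H k i j).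
Qed.

Lemma row_mxconj (R : realType) a b (V : 'M[R[i]]_(a, b)) k : row k (mxconj V) = mxconj (row k V).
Proof. by apply/matrixP => i j; rewrite !mxE. Qed.

Lemma col_mxconj (R : realType) a b (V : 'M[R[i]]_(a, b)) k : col k (mxconj V) = mxconj (col k V).
Proof. by apply/matrixP => i j; rewrite !mxE. Qed.

Lemma ev_row_col (K : nzRingType) a b c (V : 'M[K]_(a, b)) (W : 'M[K]_(b, c)) i j :
  ev (row i V) (col j W) = (V *m W) i j.
Proof. by rewrite /ev -row_mul -col_mulmx !mxE. Qed.

Lemma extm_conj (R : realType) N (A : set 'rV[R]_N) (F : 'rV[R]_N -> 'cV[R[i]]_N) x :
  open A -> smx F A -> A x -> extm (fun y => mxconj (F y)) x = mxconj (extm F x).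
Proof.
move=> oA sF Ax.
have d k : dmx (ebase R k) (fun y => mxconj (F y)) x = mxconj (dmx (ebase R k) F x).
  exact: isdmx_dmx (isdmxJ (@smx_isdmx _ _ _ _ _ _ _ _ sF Ax)).
apply/matrixP => k l; rewrite [LHS]mxE !d 2![mxconj _ _ _]mxE [RHS]mxE.
by rewrite [extm _ _ _ _]mxE conjD conjN.
Qed.

(** * The Killing operator *)

Section LeviContraction.
Variables (R : realType) (n : nat) (M : topologicalType).
Variables (S : smooth_atlas R n.*2 M) (H : contact_structure S).
Local Notation C := R[i].
Local Notation N := n.*2.+1.
Variable J : M -> 'M[R]_N.
Hypothesis hJ : compatible_almost_CR H J.
Variables (theta : M -> 'cV[R]_N) (T : M -> 'rV[R]_N).
Hypothesis (ht : contact_form H theta) (hT : reeb_field S theta T).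

(** When [W] is expanded in the frame, [T] is in the kernel of [d theta] and [H^{1,0}] is isotropic,
    so only the components along the conjugates of [Z_c] contribute. *)
Lemma bform_Z q (Z : 'M[C]_(n, N)) th b W : admissible_at H J T q Z th ->
  bform W (mxC (dtheta S theta q)) (row b Z) =
  - 'i%C * \sum_c levi_mx S J theta q Z b c * ev W (mxconj (col c th)).
Proof.
move=> hZ; rewrite -{1}[W]mulmx1 -(frame_decomposition hJ ht hT hZ) !mulmxDr !mulmxA.
rewrite !bformDl [W *m _]mx11_scalar mul_scalar_mx bformZl (T_Om ht hT) mulr0 add0r.
have comb (u : 'rV[C]_n) (B : 'M[C]_(n, N)) :
    bform (u *m B) (mxC (dtheta S theta q)) (row b Z) =
    \sum_c u 0 c * bform (row c B) (mxC (dtheta S theta q)) (row b Z).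
  by rewrite mulmx_sum_row bform_suml; apply: eq_bigr => c _; rewrite bformZl.
rewrite !comb big1 ?add0r; last by move=> c _; rewrite (Om_Z_Z hJ ht hZ) mulr0.
rewrite mulr_sumr; apply: eq_bigr => c _.
rewrite (levi_mxE ht hZ) (bform_anti (row b Z) _ (OmC_tr S theta q)) row_mxconj.
rewrite -col_mxconj /ev -col_mulmx [col _ _ _ _]mxE.
move: (bform _ _ _) (_ *m _) => e u.
transitivity (- ('i%C * 'i%C) * (e * u 0 c)); [by rewrite ii; ring|ring].
Qed.

Lemma ham_bform X g q V :
  (forall p v, Hplane H p v -> extd S theta p (X p) v = - dir S p v g) ->
  CH H q V ->
  bform (mxC (X q)) (mxC (dtheta S theta q)) V = - dirC S q V (fun r => (g r)%:C%C).
Proof.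
move=> hX [r i].
have d0 v : dir S q v (fun q => complex.Im (g q)%:C%C) = 0.
  by rewrite dirE; exact: isdd_dd (isdd_cst _ _ _).
have e v : Hplane H q v ->
    bform (mxC (X q)) (mxC (dtheta S theta q)) (mxC v) = ((- dir S q v g)%:C)%C.
  by move=> hv; rewrite -hX // (@extd_dtheta _ _ _ _ H) // /bform -mxC_tr -!mxC_mul mxCE.
rewrite [V in LHS]mxRe_real bformDr bformZr !e //.
rewrite /dirC !d0; apply: complex_eq; rewrite ?(ReD, ImD, ReN, ImN, ReM, ImM) /=; ring.
Qed.

End LeviContraction.

(** * The bracket of [X] with the frame through the Tanaka-Webster structure equations *)

Section KillingFormula.
Variables (R : realType) (n : nat) (M : topologicalType).
Variables (S : smooth_atlas R n.*2 M) (H : contact_structure S).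
Local Notation C := R[i].
Local Notation N := n.*2.+1.
Variable J : M -> 'M[R]_N.
Hypothesis hJ : compatible_almost_CR H J.
Variables (theta : M -> 'cV[R]_N) (T : M -> 'rV[R]_N).
Hypothesis (ht : contact_form H theta) (hT : reeb_field S theta T).
Variables (U : set M) (Z : M -> 'M[C]_(n, N)) (th : M -> 'M[C]_(N, n)).
Hypothesis hZ : admissible_frame H J T U Z th.
Variables (om : M -> 'I_n -> 'I_n -> 'cV[C]_N) (Ator : M -> 'I_n -> 'I_n -> C).
Variable Nij : M -> 'I_n -> 'I_n -> 'I_n -> C.
Hypothesis htw : tanaka_webster S J theta U Z th om Ator Nij.
Variables (X : M -> 'rV[R]_N) (g : M -> R).
Hypothesis sX : smooth_field S setT X.
Hypothesis hX : forall p, ev (X p) (theta p) = g p /\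
    forall v, Hplane H p v -> extd S theta p (X p) v = - dir S p v g.
Variable p : M.
Hypothesis Up : U p.
Local Notation x0 := (chart S p p).
Local Notation A := (cdom S p U).
Local Notation ci := (chart_inv S p).
Local Notation hmx q := (levi_mx S J theta q (Z q)).
Local Notation Zl := (Zloc S Z p).
Local Notation thl := (thloc S th p).
Local Notation tl := (thetaloc S theta p).
Local Notation Xl := (Xloc S p X).
Local Notation gC := (fun q : M => (g q)%:C%C).

(* [X^{cbar}] *)
Definition Xbar c x : C := ev (Xl x) (mxconj (col c (thl x))).

(* [theta^{cbar} ([X, Z_a])] *)
Definition bracket_comp a c : C :=
  ev (lieb Xl (fun x => row a (Zl x)) x0) (mxconj (col c (thl x0))).

Let oA : open A := A_open hZ (p := p).
Let Ax0 : A x0 := A_x0 S Up.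
Let sZ a := smx_row a (smx_Zloc hZ p).
Let sthc c : smx (fun x => mxconj (col c (thl x))) A :=
  smxJ oA (smx_col c (smx_thloc hZ p)).
Let sXl : smx Xl A := smx_Xloc U p sX.
Let stl : smx tl A := smx_thetaloc ht U p.
Let sg q : sm (g \o chart_inv S q) (cdom S q setT) := sm_g ht sX hX q.

Lemma Xl_grad y V : A y -> ev V (tl y) = 0 ->
  bform (Xl y) (extm tl y) V = - ev V (gradloc S p g y).
Proof.
move=> Ay V0.
have eV : V = (V *m mxC (fc S p (ci y))) *m mxC (tc S p (ci y)).
  by rewrite -mulmxA (fctcC Ay) mulmx1.
rewrite [in LHS]eV XlocE (bform_loc ht _ _ Ay) (@ham_bform _ _ _ _ H _ ht X g) //.
- by rewrite (dirC_grad sg _ Ay) -eV.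
- by move=> q; case: (hX q).
apply/(CHE ht); rewrite -mulmxA -thetalocE.
by rewrite [_ *m _]mx11_scalar; move: V0; rewrite /ev => ->; rewrite raddf0.
Qed.

Lemma bform_Zl y W b : A y ->
  bform W (extm tl y) (row b (Zl y)) =
  - 'i%C * \sum_c hmx (ci y) b c * ev W (mxconj (col c (thl y))).
Proof.
move=> Ay.
have eW : W = (W *m mxC (fc S p (ci y))) *m mxC (tc S p (ci y)).
  by rewrite -mulmxA (fctcC Ay) mulmx1.
rewrite [in LHS]eW row_Zloc (bform_loc ht _ _ Ay).
rewrite (bform_Z hJ ht hT b _ (admissible_p hZ (A_U Ay))).
congr (_ * _); apply: eq_bigr => c _; congr (_ * _).
by rewrite /ev /thloc col_mulmx mxconj_mul mxconj_real mulmxA.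
Qed.

(** Two values of [d theta (X, Z_b)] are compared: [- Z_b g] from the Hamiltonian equation and
    [- i h_{b cbar} X^{cbar}] from the frame. *)
Lemma nab_Xbar y b : A y ->
  nab S g Z b (ci y) = 'i%C * \sum_c hmx (ci y) b c * Xbar c y.
Proof.
move=> Ay; have z0 : ev (row b (Zl y)) (tl y) = 0.
  by rewrite /ev -row_mul (Zloc_theta ht hZ Ay) linear0 mxE.
have := Xl_grad Ay z0; rewrite bform_Zl // mulNr => /oppr_inj ->.
by rewrite (nab_loc Z sg b Ay).
Qed.

(** The conjugate of [nab_Xbar], solved for the components of [X] with the inverse Levi matrix; [g]
    is real and the Levi matrix Hermitian. *)
Lemma nab_up_X d : ev (mxC (X p)) (col d (th p)) = 'i%C * nab_up S J theta g Z d p.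
Proof.
have hp := admissible_p hZ Up.
have e b : nabbar S g Z b p = - 'i%C * \sum_c hmx p c b * ev (mxC (X p)) (col c (th p)).
  have := nabbar_conj Z sg b Ax0; rewrite nab_Xbar // ci0 => ->.
  rewrite conjM conji conj_sum; congr (_ * _); apply: eq_bigr => c _.
  rewrite conjM (levi_hermitian ht hp) /Xbar; congr (_ * _).
  by rewrite Xloc0 thloc0 -ev_conj mxconjK mxconj_real.
rewrite /nab_up mulr_sumr.
have -> : \sum_b 'i%C * (invmx (hmx p) b d * nabbar S g Z b p) =
   \sum_b \sum_c ev (mxC (X p)) (col c (th p)) * (hmx p c b * invmx (hmx p) b d).
  apply: eq_bigr => b _; rewrite e !mulr_sumr; apply: eq_bigr => c _.
  transitivity (- ('i%C * 'i%C) * (ev (mxC (X p)) (col c (th p)) *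
     (hmx p c b * invmx (hmx p) b d))); first by ring.
  by rewrite ii opprK mul1r.
have hh c : \sum_b hmx p c b * invmx (hmx p) b d = (c == d)%:R.
  by have /matrixP/(_ c d) := mulmxV (levi_unit hJ ht hp); rewrite !mxE.
rewrite exchange_big /=; under eq_bigr do rewrite -mulr_sumr hh.
by rewrite (bigD1 d) //= eqxx mulr1 big1 ?addr0 // => c /negbTE ->; rewrite mulr0.
Qed.

Lemma Xbar0 c : Xbar c x0 = conjc (ev (mxC (X p)) (col c (th p))).
Proof. by rewrite /Xbar Xloc0 thloc0 -ev_conj mxconj_real. Qed.

Lemma dir_nab a b :
  dirC S p (row a (Z p)) (nab S g Z b) = 'i%C * \sum_c
    (dirC S p (row a (Z p)) (fun q => hmx q b c) * Xbar c x0 +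
     hmx p b c * dV (row a (Z p)) (fun x => Xl x *m mxconj (col c (thl x))) x0 0 0).
Proof.
have e y : A y -> 'i%C *: (\sum_c (hmx (ci y) b c)%:M *m (Xl y *m mxconj (col c (thl y))))
    = (nab S g Z b (ci y))%:M :> 'M_1.
  move=> Ay; rewrite nab_Xbar // -scale_scalar_mx; congr (_ *: _).
  rewrite raddf_sum; apply: eq_bigr => c _.
  by rewrite mul_scalar_mx [Xl y *m _]mx11_scalar scale_scalar_mx.
have sh c := smx_levi ht hZ p b c.
have sXc c : smx (fun x => Xl x *m mxconj (col c (thl x))) A by exact: smxM.
have sterm c := smxM oA (sh c) (sXc c).
have ssum : smx (fun y => \sum_c (hmx (ci y) b c)%:M *m (Xl y *m mxconj (col c (thl y)))) A.
  by apply: smx_sum.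
rewrite (dirC_dV hZ Up) -?(dV_eq oA _ Ax0 e); last exact: smx_eq e (smxZ oA _ ssum).
rewrite (dVZ _ _ ssum Ax0) mxE; congr (_ * _).
rewrite (dV_sum oA _ _ sterm Ax0) summxE; apply: eq_bigr => c _.
rewrite (dVM _ (sh c) (sXc c) Ax0) mxE ci0; congr (_ + _).
  rewrite (dirC_dV hZ Up) //.
  by rewrite mxE big_ord1.
by rewrite mul_scalar_mx mxE.
Qed.

(** In Cartan's formula for [theta^{cbar}] the term [X (theta^{cbar} (Z_a))] vanishes identically,
    and [d theta^{cbar} (X, Z_a)] is the conjugate of the structure equation evaluated on [X] and
    the conjugate of [Z_a]. *)
Lemma bracket_compE a c :
  bracket_comp a c =
    - dV (row a (Z p)) (fun x => Xl x *m mxconj (col c (thl x))) x0 0 0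
    - \sum_e Xbar e x0 * ev (row a (Z p)) (mxconj (om p e c))
    - conjc (Ator p a c) * gC p
    + \sum_e conjc (Nij p c a e) * ev (mxC (X p)) (col e (th p)).
Proof.
have hp := admissible_p hZ Up.
rewrite /bracket_comp (Cartan sXl (sZ a) (sthc c) Ax0).
rewrite (dV_eq oA _ Ax0 (G := fun=> 0)) ?dV_cst; last first.
  move=> y Ay; rewrite -col_mxconj -col_mulmx -row_mul (Zloc_thlocc hZ Ay).
  by rewrite row0 col0.
rewrite mxE sub0r Zloc0 -!addrA; congr (_ + _).
rewrite (extm_conj oA (smx_col c (smx_thloc hZ p)) Ax0).
have -> : bform (Xl x0) (mxconj (extm (fun x => col c (thl x)) x0)) (row a (Z p)) =
    conjc (extdC S (fun q => col c (th q)) p (mxC (X p)) (row a (mxconj (Z p)))).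
  rewrite (extdC_loc hZ Up) Xloc0 /bform row_mxconj.
  rewrite -[in LHS](mxconj_real (X p)) -[in LHS](mxconjK (row a (Z p))).
  by rewrite -mxconj_tr -!mxconj_mul mxE.
rewrite (TW_structure htw) //.
have zt d : ev (row a (mxconj (Z p))) (col d (th p)) = 0.
  by rewrite ev_row_col (Zc_th hp) mxE.
have ztc d : ev (row a (mxconj (Z p))) (mxconj (col d (th p))) = (a == d)%:R.
  by rewrite -col_mxconj ev_row_col (Zc_thc hp) mxE.
have zth : ev (row a (mxconj (Z p))) (mxC (theta p)) = 0.
  by rewrite /ev -row_mul (Zc_theta ht hp) row0 mxE.
have xth : ev (mxC (X p)) (mxC (theta p)) = gC p.
  by rewrite /ev -mxC_mul mxCE; have [<- _] := hX p.
rewrite !conjD opprD opprD -addrA; congr (_ + _).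
  rewrite conj_sum; congr (- _); apply: eq_bigr => e _.
  rewrite /wedge zt mul0r subr0 conjM Xbar0; congr (_ * _).
  by rewrite -ev_conj row_mxconj mxconjK.
congr (_ + _).
  rewrite conj_sum (bigD1 a) //= big1 ?addr0 => [|e /negbTE ea].
    rewrite /wedge ztc zth eqxx xth mulr1 mul0r subr0 conjM conjc_real.
    by [].
  by rewrite /wedge ztc zth eq_sym ea mulr0 mul0r subr0 mulr0 conjc0.
rewrite -conjN.
pose x e := ev (mxC (X p)) (mxconj (col e (th p))).
have -> : \sum_e \sum_b Nij p c e b *
    wedge (mxconj (col e (th p))) (mxconj (col b (th p))) (mxC (X p)) (row a (mxconj (Z p))) =
    \sum_e (Nij p c e a - Nij p c a e) * x e.
  have w e b : wedge (mxconj (col e (th p))) (mxconj (col b (th p))) (mxC (X p))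
      (row a (mxconj (Z p))) = x e * (a == b)%:R - (a == e)%:R * x b.
    by rewrite /wedge !ztc.
  under eq_bigr do under eq_bigr do rewrite w mulrBr.
  under eq_bigr do rewrite sumrB.
  rewrite sumrB [X in _ - X]exchange_big -sumrB /=; apply: eq_bigr => e _.
  have pick (G : 'I_n -> C) : \sum_i G i * (a == i)%:R = G a.
    rewrite (bigD1 a) //= eqxx mulr1 big1 ?addr0 // => i.
    by rewrite eq_sym => /negbTE ->; rewrite mulr0.
  rewrite mulrBl -(pick (fun i => Nij p c e i * x e)) -(pick (fun i => Nij p c i e * x e)).
  by congr (_ - _); apply: eq_bigr => i _; ring.
(* Skewness merges the two halves of the Nijenhuis sum and absorbs the factor one half. *)
have sk e : Nij p c e a = - Nij p c a e.
  have /eqP := TW_Nijenhuis_skew htw c a e Up.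
  rewrite mulf_eq0 invr_eq0 pnatr_eq0 /= addrC addr_eq0 => /eqP; exact.
rewrite mulr_sumr -sumrN conj_sum; apply: eq_bigr => e _.
rewrite sk.
have -> : - (2%:R^-1 * ((- Nij p c a e - Nij p c a e) * x e)) = Nij p c a e * x e.
  by field.
by rewrite conjM /x -ev_conj mxconjK mxconj_real.
Qed.

(** By [TW_metric] the derivative of [h_{b cbar}] along [Z_a] has two parts: one cancels the
    connection term of the second covariant derivative, the other is the connection term left by the
    structure equation. *)
Lemma lowered_bracket a b :
  \sum_c hmx p b c * bracket_comp a c =
    'i%C * nab2 S g Z om a b p - A_low S J theta Z Ator a b p * gC p +
    'i%C * \sum_d N_low S J theta Z Nij b a d p * nab_up S J theta g Z d p.
Proof.
pose o e c := ev (row a (Z p)) (mxconj (om p e c)).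
pose D c := dV (row a (Z p)) (fun x => Xl x *m mxconj (col c (thl x))) x0 0 0.
have n2 : 'i%C * nab2 S g Z om a b p =
    - \sum_c hmx p b c * D c - \sum_c hmx p b c * \sum_e Xbar e x0 * o e c.
  have nb c : nab S g Z c p = 'i%C * \sum_d hmx p c d * Xbar d x0.
    by have := nab_Xbar c Ax0; rewrite ci0.
  rewrite /nab2 dir_nab mulrBr mulrA ii mulN1r.
  under [X in - X]eq_bigr do rewrite -(TW_metric htw) // mulrDl.
  rewrite 2!big_split /= -/D.
  have -> : 'i%C * (\sum_c ev (row a (Z p)) (om p b c) * nab S g Z c p) =
      - \sum_c \sum_d hmx p c d * ev (row a (Z p)) (om p b c) * Xbar d x0.
    rewrite mulr_sumr -sumrN; apply: eq_bigr => c _.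
    transitivity ('i%C * 'i%C * (ev (row a (Z p)) (om p b c) *
      \sum_d hmx p c d * Xbar d x0)); first by rewrite nb; ring.
    rewrite ii mulN1r mulr_sumr; congr (- _).
    by apply: eq_bigr => d _; ring.
  have -> : \sum_c \sum_d hmx p c d * ev (row a (Z p)) (om p b c) * Xbar d x0 =
      \sum_i (\sum_d hmx p d i * ev (row a (Z p)) (om p b d)) * Xbar i x0.
    by rewrite exchange_big; apply: eq_bigr => c _; rewrite mulr_suml.
  have -> : \sum_i (\sum_d hmx p b d * ev (row a (Z p)) (mxconj (om p i d))) * Xbar i x0 =
     \sum_c hmx p b c * \sum_e Xbar e x0 * o e c.
    under [RHS]eq_bigr do rewrite mulr_sumr.
    rewrite [RHS]exchange_big; apply: eq_bigr => c _; rewrite mulr_suml.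
    by apply: eq_bigr => d _; rewrite /o; ring.
  by rewrite -/D; ring.
have Nn : 'i%C * (\sum_d N_low S J theta Z Nij b a d p * nab_up S J theta g Z d p) =
    \sum_c hmx p b c * \sum_e conjc (Nij p c a e) * ev (mxC (X p)) (col e (th p)).
  rewrite mulr_sumr; under [RHS]eq_bigr do rewrite mulr_sumr.
  rewrite [RHS]exchange_big; apply: eq_bigr => d _.
  rewrite nab_up_X /N_low mulr_suml mulr_sumr; apply: eq_bigr => c _; ring.
rewrite n2 Nn /A_low mulr_suml -!sumrN -!big_split /=; apply: eq_bigr => c _.
by rewrite bracket_compE -/(D c) -/(o _ c); ring.
Qed.

(** By [bform_Zl] the two sides are [i d theta ([X, Z_a], Z_b)] and the same with [a] and [b]
    exchanged, to which [contact_lie_symmetric] applies with [eta = d g]. *)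
Lemma lowered_bracket_sym a b :
  \sum_c hmx p b c * bracket_comp a c = \sum_c hmx p a c * bracket_comp b c.
Proof.
have e i j : \sum_c hmx p j c * bracket_comp i c =
    'i%C * bform (lieb Xl (fun x => row i (Zl x)) x0) (extm tl x0) (row j (Zl x0)).
  by rewrite (bform_Zl _ _ Ax0) mulrA mulrN ii opprK mul1r ci0.
rewrite !e; congr (_ * _).
have z0 i y : A y -> ev (row i (Zl y)) (tl y) = 0.
  by move=> Ay; rewrite /ev -row_mul (Zloc_theta ht hZ Ay) row0 mxE.
apply: (contact_lie_symmetric oA (eta := gradloc S p g) stl (smx_gradloc U p sg) sXl
  (sZ a) (sZ b) Ax0 (z0 a) (z0 b)).
- by move=> y; exact: (bform_Zloc_Zloc hJ ht hZ a b).
- by move=> y V; exact: Xl_grad.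
- exact: (extm_gradloc hZ sg Ax0).
Qed.

End KillingFormula.

(** * Symmetry of the torsion and identification with the Killing operator *)

Section Torsion.
Variables (R : realType) (n : nat) (M : topologicalType).
Variables (S : smooth_atlas R n.*2 M) (H : contact_structure S).
Local Notation C := R[i].
Local Notation N := n.*2.+1.
Variable J : M -> 'M[R]_N.
Hypothesis hJ : compatible_almost_CR H J.
Variables (theta : M -> 'cV[R]_N) (T : M -> 'rV[R]_N).
Hypothesis (ht : contact_form H theta) (hT : reeb_field S theta T).
Variables (U : set M) (Z : M -> 'M[C]_(n, N)) (th : M -> 'M[C]_(N, n)).
Hypothesis hZ : admissible_frame H J T U Z th.
Variables (om : M -> 'I_n -> 'I_n -> 'cV[C]_N) (Ator : M -> 'I_n -> 'I_n -> C).
Variable Nij : M -> 'I_n -> 'I_n -> 'I_n -> C.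
Hypothesis htw : tanaka_webster S J theta U Z th om Ator Nij.
Variables (p : M) (Up : U p).

Lemma dirC_cst (c : C) V : dirC S p V (fun=> c) = 0.
Proof.
by rewrite /dirC !dirE !(isdd_dd (isdd_cst _ _ _)) subrr addr0.
Qed.

(* The Reeb field is the contact Hamiltonian field of the constant [1], for
   which the formula for the deformation reduces to [- A_{ab}]. *)
Lemma A_low_sym a b : A_low S J theta Z Ator a b p = A_low S J theta Z Ator b a p.
Proof.
have [sT hTT] := hT.
have hX q : ev (T q) (theta q) = 1 /\
    forall v, Hplane H q v -> extd S theta q (T q) v = - dir S q v (fun=> 1 : R).
  have [-> e] := hTT q; split=> // v _.
  by rewrite e dirE (isdd_dd (isdd_cst _ _ _)) oppr0.
have nab0 c : nab S (fun=> 1 : R) Z c = fun=> 0.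
  apply/funext => q; rewrite /nab /dirC !dirE !(isdd_dd (isdd_cst _ _ _)).
  by rewrite subrr addr0.
have nabbar0 c : nabbar S (fun=> 1 : R) Z c p = 0 by exact: dirC_cst.
have e i j : \sum_c levi_mx S J theta p (Z p) j c * bracket_comp S Z th T p i c =
    - A_low S J theta Z Ator i j p.
  rewrite (lowered_bracket hJ ht hT hZ htw sT hX Up).
  rewrite /nab2 nab0 dirC_cst big1 ?subrr ?mulr0; last by move=> c _; rewrite nab0 mulr0.
  rewrite big1 ?mulr0 ?addr0 ?add0r ?mulr1 // => d _.
  by rewrite /nab_up big1 ?mulr0 // => c _; rewrite nabbar0 mulr0.
apply: oppr_inj; rewrite -!e.
exact: (lowered_bracket_sym hJ ht hT hZ sT hX Up).
Qed.

Variables (X : M -> 'rV[R]_N) (g : M -> R).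
Hypothesis sX : smooth_field S setT X.
Hypothesis hX : forall p, ev (X p) (theta p) = g p /\
    forall v, Hplane H p v -> extd S theta p (X p) v = - dir S p v g.
Local Notation hmx q := (levi_mx S J theta q (Z q)).

(** Doubling the symmetric left side allows [lowered_bracket] to be used once for [(a, b)] and once
    for [(b, a)]; this produces the symmetrized second derivative and Nijenhuis terms. *)
Lemma lowered_bracket_Killing a b :
  \sum_c hmx p b c * bracket_comp S Z th X p a c =
  (CR_Killing S J theta g Z om Ator Nij p a b).1.
Proof.
have two : (2%:R : C) != 0 by rewrite pnatr_eq0.
apply: (mulfI two); rewrite [LHS]mulr_natl mulr2n.
rewrite [X in _ + X](lowered_bracket_sym hJ ht hT hZ sX hX Up).
rewrite !(lowered_bracket hJ ht hT hZ htw sX hX Up) /= (A_low_sym b a) /sym2.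
have -> : \sum_c 2%:R^-1 * (N_low S J theta Z Nij a b c p + N_low S J theta Z Nij b a c p) *
      nab_up S J theta g Z c p =
   2%:R^-1 * (\sum_c N_low S J theta Z Nij a b c p * nab_up S J theta g Z c p +
     \sum_c N_low S J theta Z Nij b a c p * nab_up S J theta g Z c p).
  by rewrite -big_split mulr_sumr; apply: eq_bigr => c _ /=; ring.
move: (nab2 _ _ _ _ a b p) (nab2 _ _ _ _ b a p) (A_low _ _ _ _ _ _ _ _).
move: (\sum_d _) (\sum_d N_low _ _ _ _ _ a b d p * _) => x y z t u.
by move: ((g p)%:C)%C ('i%C : C) => v w; field.
Qed.

Lemma nabbar2_conj a b : nabbar2 S g Z om a b p = conjc (nab2 S g Z om a b p).
Proof.
have sg := sm_g ht sX hX.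
have oA := A_open hZ (p := p); have Ax0 := A_x0 S Up.
have nc c : nabbar S g Z c p = conjc (nab S g Z c p).
  by have := nabbar_conj Z sg c Ax0; rewrite ci0.
have sn c : smx (fun x => (nab S g Z c (chart_inv S p x))%:M : 'M[C]_1) (cdom S p U).
  apply: (@smx_eq _ _ _ oA _ _ (fun x => row c (Zloc S Z p x) *m gradloc S p g x)).
    by move=> x Ax; rewrite (nab_loc Z sg c Ax) [LHS]mx11_scalar.
  by apply: smxM => //; [exact/smx_row/(smx_Zloc hZ)|exact: smx_gradloc].
have e x : cdom S p U x -> mxconj ((nab S g Z b (chart_inv S p x))%:M : 'M[C]_1) =
    (nabbar S g Z b (chart_inv S p x))%:M.
  by move=> Ax; rewrite (nabbar_conj Z sg b Ax) [LHS]mx11_scalar !mxE mulr1n.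
rewrite /nabbar2 /nab2 conjD conjN conj_sum; congr (_ - _); last first.
  by apply: eq_bigr => c _; rewrite nc conjM row_mxconj ev_conj.
rewrite (dirC_dV hZ Up) ?(dirC_dV hZ Up) //.
  rewrite -(dV_eq oA _ Ax0 e) row_mxconj (dVJ _ (sn b) Ax0).
  by rewrite mxE.
have sJ := smxJ oA (sn b).
exact: (smx_eq oA e sJ).
Qed.

Lemma nabbar_up_conj d : nabbar_up S J theta g Z d p = conjc (nab_up S J theta g Z d p).
Proof.
have sg := sm_g ht sX hX; have Ax0 := A_x0 S Up.
have nc c : nabbar S g Z c p = conjc (nab S g Z c p).
  by have := nabbar_conj Z sg c Ax0; rewrite ci0.
have hp := admissible_p hZ Up.
have hh : (mxconj (hmx p))^T = hmx p.
  by apply/matrixP => i j; rewrite mxE [mxconj _ _ _]mxE (levi_hermitian ht hp).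
rewrite /nabbar_up /nab_up conj_sum; apply: eq_bigr => b _.
rewrite conjM nc conjcK; congr (_ * _).
by rewrite -[in LHS]hh -trmx_inv mxE /mxconj -map_invmx mxE.
Qed.

(** Reality of the operator: [g] is real, the Levi matrix is Hermitian, and the barred connection
    forms are the conjugates of the others. *)
Lemma CR_Killing_conj a b : (CR_Killing S J theta g Z om Ator Nij p a b).2 =
  conjc (CR_Killing S J theta g Z om Ator Nij p a b).1.
Proof.
have hp := admissible_p hZ Up.
have c2 : conjc (2%:R^-1 : C) = 2%:R^-1 by rewrite fmorphV rmorph_nat.
have alg (x y u s : C) (r : R) :
    conjc ('i%C * (2%:R^-1 * (x + y)) - u * (r%:C)%C + 'i%C * s) =
    - 'i%C * (2%:R^-1 * (conjc x + conjc y)) - conjc u * (r%:C)%C - 'i%C * conjc s.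
  by rewrite !(conjD, conjN, conjM) conji c2 conjc_real; ring.
rewrite /= /sym2 alg; congr (_ * (_ * (_ + _)) - _ * _ - _ * _).
- exact: nabbar2_conj.
- exact: nabbar2_conj.
- rewrite /Abar_low /A_low conj_sum; apply: eq_bigr => c _.
  by rewrite conjM conjcK (levi_hermitian ht hp).
rewrite conj_sum; apply: eq_bigr => c _.
have Nc i j : Nbar_low S J theta Z Nij i j c p = conjc (N_low S J theta Z Nij i j c p).
  rewrite /Nbar_low /N_low conj_sum; apply: eq_bigr => s _.
  by rewrite conjM conjcK (levi_hermitian ht hp).
by rewrite nabbar_up_conj !Nc !conjM conjD c2.
Qed.

End Torsion.

(** * From the derivative of the deformation to the bracket *)

Section MixedComponent.
Variables (R : realType) (n : nat) (M : topologicalType).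
Variables (S : smooth_atlas R n.*2 M) (H : contact_structure S).
Local Notation C := R[i].
Local Notation N := n.*2.+1.
Variable J : M -> 'M[R]_N.
Hypothesis hJ : compatible_almost_CR H J.
Variables (theta : M -> 'cV[R]_N) (T X : M -> 'rV[R]_N) (g : M -> R).
Hypothesis (ht : contact_form H theta) (hT : reeb_field S theta T).
Hypothesis sX : smooth_field S setT X.
Hypothesis hX : forall p, ev (X p) (theta p) = g p /\
    forall v, Hplane H p v -> extd S theta p (X p) v = - dir S p v g.
Variables (D : set (R * M)) (Fl : R -> M -> M).
Hypothesis hFl : is_flow S X D Fl.
Variable phi : R -> M -> 'M[C]_N.
Hypothesis hphi : graph_deformation H J Fl phi.
Variables (U : set M) (Z : M -> 'M[C]_(n, N)) (th : M -> 'M[C]_(N, n)).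
Hypothesis hZ : admissible_frame H J T U Z th.
Variables (p : M) (Up : U p).
Local Notation x0 := (chart S p p).
Local Notation A := (cdom S p U).
Local Notation ci := (chart_inv S p).
Local Notation JC := (fun x => mxC (Jloc S J theta T p x)).

Lemma mxC_Hproj q : mxC (Hproj theta T q) = 1%:M - mxC (theta q) *m mxC (T q).
Proof. by rewrite /Hproj mxCD mxCN mxC1 mxC_mul. Qed.

Lemma Zloc_Jloc x : A x -> Zloc S Z p x *m JC x = 'i%C *: Zloc S Z p x.
Proof.
move=> Ax; have hq := admissible_p hZ (A_U Ax).
rewrite /Zloc /Jloc !mxC_mul -!mulmxA (mulmxA (mxC (tc _ _ _))) (tcfcC Ax) mul1mx.
rewrite mulmxA mxC_Hproj mulmxBr mulmx1 (mulmxA (Z _) (mxC (theta _))) (Z_theta ht hq) mul0mx subr0.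
by rewrite mulmxA (Z_J hq) -scalemxAl.
Qed.

(** The covectors [theta^{bbar}] are [- i] eigenvectors of the transpose of [J]; the projection
    along [T] is the sum of the two frame terms of [frame_decomposition]. *)
Lemma Jloc_thc : JC x0 *m mxconj (th p) = - 'i%C *: mxconj (th p).
Proof.
have hq := admissible_p hZ Up.
have P : mxC (Hproj theta T p) = th p *m Z p + mxconj (th p) *m mxconj (Z p).
  by rewrite mxC_Hproj -(frame_decomposition hJ ht hT hq) -[X in X - _]addrA [LHS]addrC addKr.
rewrite Jloc0 mxC_mul P.
rewrite !mulmxDl -!mulmxA (mulmxA (Z p)) (Z_J hq) (mulmxA (mxconj (Z p))) (Zc_J hq).
by rewrite -!scalemxAl (Z_thc hq) (Zc_thc hq) scaler0 mulmx0 add0r -scalemxAr mulmx1.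
Qed.

Lemma mul_field_diff V : V *m mxC (field_diff S X p x0) = dV V (Xloc S p X) x0.
Proof.
apply/rowP => j; rewrite mxE summxE; apply: eq_bigr => k _.
rewrite [in RHS]mxE mxCE mxE [dmx _ _ _ _ _]mxE; congr (_ * _).
apply: complex_eq => /=.
  by congr (dd _ _ _); apply/funext => y; rewrite mxCE.
rewrite (_ : (fun y => complex.Im (Xloc S p X y 0 j)) = fun=> 0).
  by rewrite (isdd_dd (isdd_cst _ _ _)).
by apply/funext => y; rewrite mxCE.
Qed.

(** Differentiating [Z_a J = i Z_a] along [X] trades the derivative of [J] for one of [Z_a], and
    [Z_a *m dphi_rhs] becomes [- [X, Z_a] (J - i)]. On [theta^{bbar}] the factor [J - i] is [- 2i],
    which cancels [(2i)^-1] and the sign. *)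
Lemma mixed_componentE a b :
  mixed_component Z th (infinitesimal_deformation phi p) p a b =
  bracket_comp S Z th X p a b.
Proof.
have hq := admissible_p hZ Up.
have oA := A_open hZ (p := p); have Ax0 := A_x0 S Up.
have sZ := smx_row a (smx_Zloc hZ p).
have sJ : smx JC A.
  by apply: smxC => i j; exact: sm_sub (@A_subT _ _ _ S U p) (sm_Jloc hJ ht hT p i j).
rewrite /mixed_component (infinitesimal_deformationE hJ ht hT sX hX hFl hphi (Z_H10 hq a)).
have eJ y : A y -> row a (Zloc S Z p y) *m JC y = 'i%C *: row a (Zloc S Z p y).
  by move=> Ay; rewrite -row_mul Zloc_Jloc // linearZ.
have dJ := dVM (Xloc S p X x0) sZ sJ Ax0.
rewrite (dV_eq oA _ Ax0 eJ) (dVZ _ _ sZ Ax0) Zloc0 in dJ.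
have -> : row a (Z p) *m dphi_rhs S J theta T X p =
   - lieb (Xloc S p X) (fun x => row a (Zloc S Z p x)) x0 *m (JC x0 - ('i%C)%:M).
  rewrite /dphi_rhs mulmxDr mulmxA mul_field_diff /lieb Zloc0 opprB mulmxBl; congr (_ + _).
  rewrite [X in _ = - X]mulmxBr mul_mx_scalar dJ opprB.
  by rewrite [RHS]addrC addKr.
rewrite evZ /bracket_comp /ev -col_mxconj thloc0 -mulmxA -col_mulmx mulmxBl Jloc_thc.
rewrite mul_scalar_mx -scalerBl mulNmx.
set L := lieb _ _ _.
have -> : col b ((- 'i%C - 'i%C) *: mxconj (th p)) = - (2%:R * 'i%C) *: col b (mxconj (th p)).
  by rewrite linearZ; congr (_ *: _); ring.
rewrite scaleNr mulmxN opprK -scalemxAr mxE mulrA mulVf ?mul1r //.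
  by rewrite col_mxconj.
by rewrite mulf_neq0 ?pnatr_eq0 ?i_neq0.
Qed.

End MixedComponent.

Theorem proposition3p1 (R : realType) (n : nat) (M : topologicalType)
    (S : smooth_atlas R n.*2 M) (H : contact_structure S)
    (J : M -> 'M[R]_(n.*2.+1)) (hJ : compatible_almost_CR H J)
    (f : M -> 'M[R[i]]_(n.*2.+1, 1 + n) -> R) (hf : real_density11 H J f)
    (X : M -> 'rV[R]_(n.*2.+1)) (hX : contact_hamiltonian H J f X)
    (D : set (R * M)) (Fl : R -> M -> M) (hFl : is_flow S X D Fl)
    (phi : R -> M -> 'M[R[i]]_(n.*2.+1)) (hphi : graph_deformation H J Fl phi) :
  (forall p Z j, H10 H J p Z -> derivableC (fun t => (Z *m phi t p) 0 j) 0) /\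
  forall (theta : M -> 'cV[R]_(n.*2.+1)) (T : M -> 'rV[R]_(n.*2.+1)) (g : M -> R)
    (U : set M) (Z : M -> 'M[R[i]]_(n, n.*2.+1)) (th : M -> 'M[R[i]]_(n.*2.+1, n))
    (om : M -> 'I_n -> 'I_n -> 'cV[R[i]]_(n.*2.+1))
    (A : M -> 'I_n -> 'I_n -> R[i]) (Nij : M -> 'I_n -> 'I_n -> 'I_n -> R[i]),
    contact_form H theta -> reeb_field S theta T ->
    trivialization H J theta T f g ->
    admissible_frame H J T U Z th ->
    tanaka_webster S J theta U Z th om A Nij ->
    forall (p : M) (a b : 'I_n), U p ->
      lowered_components S J theta Z th (infinitesimal_deformation phi p) p a b =
      CR_Killing S J theta g Z om A Nij p a b.
Proof.
have [sX [theta0 [T0 [g0 [ht0 hT0 _ hX0]]]]] := hX.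
split=> [p Z j|theta T g U Z th om A Nij ht hT tr hZ htw p a b Up].
  (* Differentiability of [phi] does not refer to a contact form, so the one supplied by
     [contact_hamiltonian] is enough; the formula itself needs the equations moved to the given
     [theta]. *)
  exact: (phi_derivableC hJ ht0 hT0 sX hX0 hFl hphi).
have hX1 := hamiltonian_equations hJ hf hX ht hT tr.
have hq := admissible_p hZ Up.
have e1 : \sum_c levi_mx S J theta p (Z p) b c *
      mixed_component Z th (infinitesimal_deformation phi p) p a c =
    (CR_Killing S J theta g Z om A Nij p a b).1.
  rewrite -(lowered_bracket_Killing hJ ht hT hZ htw Up sX hX1).
  by apply: eq_bigr => c _; rewrite (mixed_componentE hJ ht hT sX hX1 hFl hphi hZ Up).
rewrite /lowered_components e1 [RHS]surjective_pairing; congr (_, _).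
(* The second components on both sides are the conjugates of the first ones, on the left because the
   Levi matrix is Hermitian. *)
rewrite (CR_Killing_conj ht hZ _ _ _ Up sX hX1) -e1 conj_sum; apply: eq_bigr => c _.
by rewrite conjM (levi_hermitian ht hq).
Qed.
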